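(* Let $\alpha\in(1,2)$, $c>1$, and let $\theta$ be a smooth admissible function with respect to $c$ and $\alpha$. Let $x\mapsto p(x,t)$, $t>0$, be the semistable densities corresponding to the semi-fractional diffusion equation $$\frac{\partial}{\partial t}p(x,t)=\frac{\partial^\alpha}{\partial_{c,\theta}(-x)^\alpha}p(x,t)$$ with point source initial condition. Then there are a continuously differentiable, $\log(c)$-periodic function $g:\mathbb{R}\to\mathbb{R}$ and a function $f:(0,\infty)\to\mathbb{R}$ with $s+f(s)>0$ for all $s>0$, where $f$ and $g$ depend only on $c$, $\alpha$ and $\theta$, such that for all $x>0$ and $s>0$ the Laplace transform with respect to time $\widetilde p(x,s)=\int_0^\infty e^{-st}p(x,t)\,dt$ takes the form $$\widetilde{p}(x,s)=\frac1{\alpha}\,\frac{s^{1/\alpha}g(\log s)\exp\left(-x\,s^{1/\alpha}g(\log s)\right)}{s+f(s)}.$$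
   Context: Let $\alpha\in(1,2)$ and $c>1$. A function $\theta:\mathbb{R}\to(0,\infty)$ is called admissible (with respect to $c$ and $\alpha$) if it is $\log(c^{1/\alpha})$-periodic and $x\mapsto x^{-\alpha}\theta(\log x)$ is non-increasing on $(0,\infty)$. It is called smooth if it is continuous and piecewise continuously differentiable. Given such a $\theta$, let $\phi$ be the Lévy measure concentrated on $(-\infty,0)$ with $\phi(-\infty,-x)=x^{-\alpha}\theta(\log x)$ for $x>0$. The negative semi-fractional derivative of order $\alpha$ is defined, for suitable functions $f$, by $$\frac{\partial^\alpha}{\partial_{c,\theta}(-x)^\alpha}f(x)=\int_{-\infty}^{0}\left(f(x-y)-f(x)+yf'(x)\right)d\phi(y)=\int_0^\infty\left(f'(x+y)-f'(x)\right)y^{-\alpha}\theta(\log y)\,dy .$$ The corresponding (negatively skewed) semistable densities $x\mapsto p(x,t)$, which solve the semi-fractional diffusion equation with point source $p(x,0)=\delta(x)$, are the probability densities on $\mathbb{R}$ with Fourier transform $\int_{\mathbb{R}}e^{ikx}p(x,t)\,dx=\exp(t\psi(k))$, $k\in\mathbb{R}$, where $$\psi(k)=\int_{-\infty}^0\left(e^{ikx}-1-ikx\right)d\phi(x).$$ *)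

(* Defs.v *)
From HB Require Import structures.
From mathcomp Require Import all_boot all_order all_algebra.
From mathcomp Require Import all_classical all_reals all_analysis.
From mathcomp Require Import complex.

Set Implicit Arguments.
Unset Strict Implicit.
Unset Printing Implicit Defensive.

Import Order.TTheory GRing.Theory Num.Theory.
Import numFieldNormedType.Exports.

Local Open Scope classical_set_scope.
Local Open Scope ring_scope.
Local Open Scope complex_scope.

Section Regularity.
Context {R : realType}.
Implicit Types f : R -> R.

Definition continuously_differentiable f : Prop :=
  (forall x, derivable f x 1) /\ continuous (derive1 f).

(* For an f that is continuous on [a, b], this says that the restriction of f
   to [a, b] is C^1, with one-sided derivatives at the endpoints: by the mean
   value theorem they are the limits of f' at a and b. *)
Definition C1_piece f (a b : R) : Prop :=
  [/\ {in `]a, b[, forall x, derivable f x 1},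
      {in `]a, b[, continuous (derive1 f)},
      cvg (derive1 f x @[x --> a^'+]) &
      cvg (derive1 f x @[x --> b^'-])].

Definition piecewise_continuously_differentiable f : Prop :=
  forall a b : R, a < b -> exists2 s : seq R, itv_partition a b s &
    forall i, (i < size s)%N -> C1_piece f (nth b (a :: s) i) (nth b s i).

Definition smooth f : Prop :=
  continuous f /\ piecewise_continuously_differentiable f.

End Regularity.

Definition admissible {R : realType} (c alpha : R) (theta : R -> R) : Prop :=
  [/\ forall x, 0 < theta x,
      periodic theta (ln (c `^ alpha^-1)) &
      forall x y, 0 < x -> x <= y ->
        y `^ (- alpha) * theta (ln y) <= x `^ (- alpha) * theta (ln x)].

Section ComplexIntegral.
Context {R : realType}.

Definition expC (z : R[i]) : R[i] :=
  (expR (complex.Re z))%:C * (cos (complex.Im z) +i* sin (complex.Im z)).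

(* As for Rintegral, this is meaningful only when both parts are integrable. *)
Definition Cintegral (mu : {measure set (measurableTypeR R) -> \bar R}) (D : set R)
    (h : R -> R[i]) : R[i] :=
  Rintegral mu D (fun x => complex.Re (h x)) +i*
  Rintegral mu D (fun x => complex.Im (h x)).

End ComplexIntegral.

Section Semistable.
Context {R : realType}.
Implicit Types phi : {measure set (measurableTypeR R) -> \bar R}.

Definition levy_measure phi : Prop :=
  phi [set 0] = 0%E /\
  (\int[phi]_x (Num.min 1 (x ^+ 2))%:E < +oo)%E.

Definition semistable_levy_measure (alpha : R) (theta : R -> R) phi : Prop :=
  [/\ levy_measure phi,
      phi `[0, +oo[%classic = 0%E &
      forall x, 0 < x ->
        phi `]-oo, - x[%classic = (x `^ (- alpha) * theta (ln x))%:E].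

Definition psi phi (k : R) : R[i] :=
  Cintegral phi `]-oo, 0[ (fun x => expC (0 +i* (k * x)) - 1 - (0 +i* (k * x))).

Definition fourier_transform (u : R -> R) (k : R) : R[i] :=
  Cintegral lebesgue_measure setT (fun x => expC (0 +i* (k * x)) * (u x)%:C).

Definition probability_density (u : R -> R) : Prop :=
  [/\ measurable_fun setT u,
      forall x, 0 <= u x &
      (\int[lebesgue_measure]_x (u x)%:E = 1)%E].

(* A Fourier transform determines a density only almost everywhere; asking for
   continuity in x selects the version p x t that is meant pointwise. *)
Definition semistable_densities phi (p : R -> R -> R) : Prop :=
  forall t, 0 < t ->
    [/\ probability_density (fun x => p x t),
        continuous (fun x => p x t) &
        forall k, fourier_transform (fun x => p x t) k = expC (t%:C * psi phi k)].

Definition laplace_time (p : R -> R -> R) (x s : R) : \bar R :=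
  (\int[lebesgue_measure]_(t in `]0%R, +oo[) (expR (- (s * t)) * p x t)%:E)%E.

End Semistable.

(* Main.v *)
From HB Require Import structures.
Require Import Defs.
From mathcomp Require Import all_boot all_order all_algebra.
From mathcomp Require Import all_classical all_reals all_analysis.
From mathcomp Require Import measurable_realfun normal_distribution.
From mathcomp Require Import complex ring lra.

(** Notation: [psi] is the characteristic exponent, with real and imaginary part
    [psi_re] and [psi_im], and [Psi l = psi (- i l)], for [l > 0], is the Laplace
    exponent [\int (exp (l y) - 1 - l y) dphi(y)].  The jumps of the semistable
    process are negative, so [Psi] is finite; it is an increasing bijection of
    the positive half-line, with inverse [Phi].

    The theorem rests on the formula ([laplace_time_exponential])

      [\int_0^oo exp (- s t) p x t dt = exp (- q x) / Psi' q],   [q = Phi s],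

    for [x > 0].  Self-similarity of the Levy measure gives
    [Psi (c^(1/alpha) l) = c Psi l] ([Psi_scaling]), hence
    [Phi (c s) = c^(1/alpha) Phi s], so that [s^(- 1/alpha) Phi s] is a periodic
    function [g] of [log s], of period [log c] and as smooth as [Phi].  Writing
    [s + f s] for [Phi s * Psi' (Phi s) / alpha] gives the statement.  All this
    depends on [theta] alone, because the tails determine the Levy measure
    ([semistable_measure_unique]).

    The formula is proved analytically, without the process.

    1. Since [- Re psi] is at least of order [|k|^alpha] ([psi_re_growth]), the Fourier
       transform of [p (.) t] is integrable and can be inverted
       ([fourier_inversion]); integrating the inversion formula in time shows that
       the left-hand side is the resolvent density [u x], the Fourier integral of
       [1 / (s - psi)] ([laplace_time_resolvent]).

    2. Let [U] be the convolution of [u] with a gaussian of small variance.  It is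
       smooth and solves [s U - A U = gaussian], where [A] is the generator
       ([smooth_resolvent_equation]).  On functions defined to the right of [d > 0],
       [A] is well defined, as it looks to the right only, and [exp (- q x)] solves
       [s v - A v = 0] because [Psi q = s].  The maximum principle on
       [`[d, +oo[] ([maximum_principle]) compares the two, up to the size of the
       gaussian at [d], which vanishes in the limit.  Hence
       [u x = C exp (- q x)] for [x > 0] ([resolvent_density_exponential]).

    3. To find [C], the integral of [u x exp (l x)] over the line, for
       [0 < l < q], is [1 / (s - Psi l)] ([tilted_massE]).  This follows from the
       equation of [U] at a far away point with a large variance, chosen so that
       the gaussian, once normalised, becomes [exp (l x)].  At [l = q] the left-hand
       side has a pole with residue given by [C], and the right-hand side by
       [1 / Psi' q] ([exponential_constantE]). *)

Set Implicit Arguments.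
Unset Strict Implicit.
Unset Printing Implicit Defensive.

Import Order.TTheory GRing.Theory Num.Theory.
Import numFieldNormedType.Exports.

Local Open Scope classical_set_scope.
Local Open Scope ring_scope.
Local Notation normr := Num.norm.

(** * Dominated convergence and Fubini for real-valued integrals *)

Section domination.
Context d (T : measurableType d) (R : realType).
Variable m : {measure set T -> \bar R}.
Implicit Types (D : set T) (f g : T -> R).

Lemma dominated_integrable D f g : measurable D -> measurable_fun D f ->
  m.-integrable D (EFin \o g) -> (forall x, D x -> `|f x| <= g x) ->
  m.-integrable D (EFin \o f).
Proof.
move=> mD mf ig fg; apply: (le_integrable mD _ _ ig).
  exact/measurable_EFinP.
by move=> x Dx /=; rewrite lee_fin (le_trans (fg x Dx))// ler_norm.
Qed.

Lemma measurable_integrable D f : m.-integrable D (EFin \o f) ->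
  measurable_fun D f.
Proof. by move=> /measurable_int /measurable_EFinP. Qed.

Lemma RintegrableZl D f (k : R) : measurable D ->
  m.-integrable D (EFin \o f) -> m.-integrable D (EFin \o (fun x => k * f x)).
Proof.
move=> mD iF; rewrite (_ : _ \o _ = fun x => k%:E * (EFin \o f) x)%E.
  exact: integrableZl.
by apply/funext => x /=; rewrite EFinM.
Qed.

Lemma integrable_bounded_mul D f g (K : R) : measurable D ->
  measurable_fun D f -> (forall x, D x -> `|f x| <= K) ->
  m.-integrable D (EFin \o g) -> m.-integrable D (EFin \o (f \* g)).
Proof.
move=> mD mf fK ig.
apply: (@dominated_integrable _ _ (fun x => K * `|g x|)) => //.
- by apply: measurable_funM => //; exact: measurable_integrable.
- apply: RintegrableZl => //; exact: integrable_norm.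
- by move=> x Dx /=; rewrite normrM ler_wpM2r// fK.
Qed.

Lemma RintegrableN D f : measurable D -> m.-integrable D (EFin \o f) ->
  m.-integrable D (EFin \o (fun x => - f x)).
Proof.
move=> mD fi; rewrite (_ : _ \o _ = -%E \o (EFin \o f))//.
exact: integrableN.
Qed.

Lemma RintegrableD D f g : measurable D -> m.-integrable D (EFin \o f) ->
  m.-integrable D (EFin \o g) ->
  m.-integrable D (EFin \o (fun x => f x + g x)).
Proof.
move=> mD fi gi; rewrite (_ : _ \o _ = (EFin \o f) \+ (EFin \o g))%E//.
exact: integrableD.
Qed.

Lemma RintegrableB D f g : measurable D -> m.-integrable D (EFin \o f) ->
  m.-integrable D (EFin \o g) ->
  m.-integrable D (EFin \o (fun x => f x - g x)).
Proof.
move=> mD fi gi; rewrite (_ : _ \o _ = (EFin \o f) \- (EFin \o g))%E//.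
exact: integrableB.
Qed.

Lemma Rintegral_dominated_cvg D (f_ : nat -> T -> R) f g : measurable D ->
  (forall n, measurable_fun D (f_ n)) ->
  (forall x, D x -> f_ n x @[n --> \oo] --> f x) ->
  m.-integrable D (EFin \o g) ->
  (forall n x, D x -> `|f_ n x| <= g x) ->
  (\int[m]_(x in D) f_ n x) @[n --> \oo] --> \int[m]_(x in D) f x.
Proof.
move=> mD mf ff ig fg.
have mF : measurable_fun D f by exact: (measurable_fun_cvg mf).
have fgi x : D x -> `|f x| <= g x.
  move=> Dx; have /cvg_norm fx := ff x Dx.
  rewrite -(cvg_lim _ fx)//; apply: limr_le; first by apply/cvg_ex; exists `|f x|.
  by apply: nearW => n; exact: fg.
have [] := @dominated_convergence _ _ _ m D mD (fun n => EFin \o f_ n)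
  (EFin \o f) (EFin \o g).
- by move=> n; exact/measurable_EFinP.
- exact/measurable_EFinP.
- by apply: aeW => x Dx; apply: cvg_EFin; [exact: nearW|exact: ff].
- by [].
- by apply: aeW => x n Dx /=; rewrite lee_fin fg.
move=> fi _ fcvg; apply: fine_cvg; rewrite fineK//.
exact: integrable_fin_num.
Qed.

End domination.

(** Repackages sigma-finiteness as a structure, so that product measures can be
    formed with a measure that is only a variable. *)
Lemma sigma_finite_measure_of d (T : measurableType d) (R : realType)
    (m : {measure set T -> \bar R}) : sigma_finite setT m ->
  exists m' : {sigma_finite_measure set T -> \bar R},
    m' = m :> (set T -> \bar R).
Proof.
move=> sm.
pose B := isSigmaFinite.Build _ _ _ m sm.
pose B' := isSFinite.Build _ _ _ (Measure.sort m)
  (sfinite_measure_sigma_finite sm).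
pose m' : {sigma_finite_measure set T -> \bar R} :=
  HB.pack (Measure.sort m) B B'.
by exists m'.
Qed.

(** Fubini's theorem for real-valued iterated integrals on measurable sets [D1]
    and [D2], under the mere iterated bound [hf] by an integrable [f]: the
    integrand is extended by zero outside [D1 `*` D2], where the theorem for
    sigma-finite measures applies. *)
Section fubini.
Context d1 d2 (T1 : measurableType d1) (T2 : measurableType d2) (R : realType).
Variables (m1 : {measure set T1 -> \bar R}) (m2 : {measure set T2 -> \bar R}).
Hypotheses (sm1 : sigma_finite setT m1) (sm2 : sigma_finite setT m2).
Variables (D1 : set T1) (D2 : set T2).
Hypotheses (mD1 : measurable D1) (mD2 : measurable D2).
Variable h : T1 * T2 -> R.
Hypothesis mh : measurable_fun setT h.
Hypothesis ih2 : forall x, D1 x -> m2.-integrable D2 (EFin \o (fun y => h (x, y))).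
Hypothesis ih1 : forall y, D2 y -> m1.-integrable D1 (EFin \o (fun x => h (x, y))).
Variable f : T1 -> R.
Hypothesis if1 : m1.-integrable D1 (EFin \o f).
Hypothesis hf : forall x, D1 x -> \int[m2]_(y in D2) `|h (x, y)| <= f x.

Let h' := h \_ (D1 `*` D2).

Let mh' : measurable_fun setT h'.
Proof.
apply/(measurable_restrictT _ (measurableX mD1 mD2)).
exact: measurable_funTS.
Qed.

Let h'E x : D1 x -> (fun y => h' (x, y)) = (fun y => h (x, y)) \_ D2.
Proof.
move=> Dx; apply/funext => y; rewrite /h' /patch.
congr (if _ then _ else _).
by apply/idP/idP; rewrite !inE/= => //; case.
Qed.

Let h'N x y : ~ D1 x -> h' (x, y) = 0.
Proof. by move=> Dx; rewrite /h' /patch memNset//= => -[]. Qed.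

Let h'E1 y : D2 y -> (fun x => h' (x, y)) = (fun x => h (x, y)) \_ D1.
Proof.
move=> Dx; apply/funext => x; rewrite /h' /patch.
congr (if _ then _ else _).
by apply/idP/idP; rewrite !inE/= => //; case.
Qed.

Let h'N1 x y : ~ D2 y -> h' (x, y) = 0.
Proof. by move=> Dx; rewrite /h' /patch memNset//= => -[]. Qed.

Section product.
Variables (n1 : {sigma_finite_measure set T1 -> \bar R}).
Variables (n2 : {sigma_finite_measure set T2 -> \bar R}).
Hypotheses (n1E : n1 = m1 :> (set T1 -> \bar R)).
Hypotheses (n2E : n2 = m2 :> (set T2 -> \bar R)).

Let e1 D F : (\int[n1]_(x in D) F x = \int[m1]_(x in D) F x)%E.
Proof. by apply: eq_measure_integral => A mA _; exact: (congr1 (@^~ A) n1E). Qed.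

Let e2 D F : (\int[n2]_(x in D) F x = \int[m2]_(x in D) F x)%E.
Proof. by apply: eq_measure_integral => A mA _; exact: (congr1 (@^~ A) n2E). Qed.

Let int : (n1 \x n2)%E.-integrable setT (EFin \o h').
Proof.
apply/integrable12ltyP; first exact/measurable_EFinP.
rewrite e1; under eq_integral do rewrite e2.
apply: (@le_lt_trans _ _ (\int[m1]_x ((Num.Def.normr \o f) \_ D1 x)%:E)%E).
  apply: ge0_le_integral => //.
  - by move=> x _; exact: integral_ge0.
  - under eq_fun do rewrite -e2.
    apply: (measurable_fun_fubini_tonelli_F (fun xy => `|(EFin \o h') xy|)%E) => //.
    by do 2 apply: measurableT_comp => //.
  - apply/measurable_EFinP; apply/(measurable_restrictT _ mD1).
    apply: measurableT_comp => //; exact: measurable_integrable if1.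
  - move=> x _; rewrite /patch; case: ifPn => [|].
      rewrite inE => Dx.
      have -> : (\int[m2]_y `|(EFin \o h') (x, y)| =
                 \int[m2]_(y in D2) (`|h (x, y)|)%:E)%E.
        rewrite [RHS]integral_mkcond; apply: eq_integral => y _ /=.
        by rewrite [h' _](congr1 (@^~ y) (h'E Dx)) /patch; case: ifP => //; rewrite normr0.
      rewrite -[leLHS]fineK.
        by rewrite lee_fin /= (le_trans (hf Dx))// ler_norm.
      apply: integrable_fin_num => //.
      exact: integrable_norm (ih2 Dx).
    rewrite notin_setE => Dx /=.
    by rewrite integral0_eq// => y _; rewrite h'N//= normr0.
rewrite (_ : (\int[m1]_x _)%E = \int[m1]_(x in D1) (`|f x|)%:E)%E.
  exact: integrable_lty (integrable_norm if1).
rewrite [RHS]integral_mkcond; apply: eq_integral => x _.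
by rewrite /patch; case: ifP.
Qed.

Let FE x : fubini_F n2 (EFin \o h') x =
  (((fun x => \int[m2]_(y in D2) h (x, y)) \_ D1) x)%:E.
Proof.
rewrite /fubini_F e2 /patch.
case: ifPn => [|]; rewrite ?inE ?notin_setE => Dx.
  rewrite /Rintegral fineK; last exact: integrable_fin_num (ih2 Dx).
  rewrite [RHS]integral_mkcond; apply: eq_integral => y _ /=.
  by rewrite [h' _](congr1 (@^~ y) (h'E Dx)) /patch; case: ifP.
by rewrite integral0_eq// => y _; rewrite /= h'N.
Qed.

Lemma Rintegral_swap_product :
  \int[m1]_(x in D1) (\int[m2]_(y in D2) h (x, y)) =
  \int[m2]_(y in D2) (\int[m1]_(x in D1) h (x, y)).
Proof.
have := Fubini int.
rewrite e1 e2 {1 4}/Rintegral => FU.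
have {}FU : (\int[m1]_(x in D1) (\int[m2]_(y in D2) h (x, y))%:E =
    \int[m2]_x \int[n1]_y (EFin \o h') (y, x))%E.
  rewrite -FU integral_mkcond; apply: eq_integral => x _.
  by rewrite [RHS](FE x) /patch; case: ifP.
rewrite FU; congr fine.
rewrite [RHS]integral_mkcond; apply: eq_integral => y _; rewrite e1 /patch.
case: ifPn => [|]; rewrite ?inE ?notin_setE => Dx.
  rewrite /Rintegral fineK; last exact: integrable_fin_num (ih1 Dx).
  rewrite [RHS]integral_mkcond; apply: eq_integral => x _ /=.
  by rewrite [h' _](congr1 (@^~ x) (h'E1 Dx)) /patch; case: ifP.
by rewrite integral0_eq// => x _; rewrite /= h'N1.
Qed.

Let GE y : fubini_G n1 (EFin \o h') y =
  (((fun y => \int[m1]_(x in D1) h (x, y)) \_ D2) y)%:E.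
Proof.
rewrite /fubini_G e1 /patch.
case: ifPn => [|]; rewrite ?inE ?notin_setE => Dy.
  rewrite /Rintegral fineK; last exact: integrable_fin_num (ih1 Dy).
  rewrite [RHS]integral_mkcond; apply: eq_integral => x _ /=.
  by rewrite [h' _](congr1 (@^~ x) (h'E1 Dy)) /patch; case: ifP.
by rewrite integral0_eq// => x _; rewrite /= h'N1.
Qed.

Lemma integrable_Rintegral_swap_product :
  m2.-integrable D2 (EFin \o (fun y => \int[m1]_(x in D1) h (x, y))).
Proof.
apply/integrableP; split.
  apply/measurable_EFinP/(measurable_restrictT _ mD2); apply/measurable_EFinP.
  by have := measurable_fubini_G int; rewrite (funext GE).
have mi := measurable_int _ int.
have : (\int[n2]_y \int[n1]_x `|(EFin \o h') (x, y)| < +oo)%E.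
  exact/integrable21ltyP.
apply: le_lt_trans.
rewrite e2 integral_mkcond; apply: ge0_le_integral => //.
- by move=> y _; rewrite erestrict_ge0.
- rewrite (_ : _ \_ D2 = (fun y => `|fubini_G n1 (EFin \o h') y|)%E).
    by apply: measurableT_comp => //; exact: measurable_fubini_G int.
  apply/funext => y; rewrite GE /patch; by case: ifP => //= _; rewrite ?normr0.
- apply: (measurable_fun_fubini_tonelli_G (fun xy => `|(EFin \o h') xy|)%E) => //.
  by apply: measurableT_comp.
- move=> y _; apply: (@le_trans _ _ (`|fubini_G n1 (EFin \o h') y|)%E).
    by rewrite GE /patch; case: ifP => //= _; rewrite ?normr0.
  by apply: le_abse_integral => //; exact: measurableT_comp.
Qed.

End product.

Lemma Rintegral_swap :
  \int[m1]_(x in D1) (\int[m2]_(y in D2) h (x, y)) =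
  \int[m2]_(y in D2) (\int[m1]_(x in D1) h (x, y)).
Proof.
have [n1 n1E] := sigma_finite_measure_of sm1.
have [n2 n2E] := sigma_finite_measure_of sm2.
exact: Rintegral_swap_product n1E n2E.
Qed.

Lemma integrable_Rintegral_swap :
  m2.-integrable D2 (EFin \o (fun y => \int[m1]_(x in D1) h (x, y))).
Proof.
have [n1 n1E] := sigma_finite_measure_of sm1.
have [n2 n2E] := sigma_finite_measure_of sm2.
exact: integrable_Rintegral_swap_product n1E n2E.
Qed.

End fubini.

(** The form in which Fubini's theorem is used most often: a kernel dominated
    by a product of integrable functions of one variable. *)
Lemma Rintegral_swap_dominated d1 d2 (T1 : measurableType d1)
    (T2 : measurableType d2) (R : realType)
    (m1 : {measure set T1 -> \bar R}) (m2 : {measure set T2 -> \bar R})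
    (D1 : set T1) (D2 : set T2) (h : T1 * T2 -> R) (f : T1 -> R) (g : T2 -> R) :
  sigma_finite setT m1 -> sigma_finite setT m2 ->
  measurable D1 -> measurable D2 -> measurable_fun setT h ->
  m1.-integrable D1 (EFin \o f) -> m2.-integrable D2 (EFin \o g) ->
  (forall x y, D1 x -> D2 y -> `|h (x, y)| <= f x * g y) ->
  \int[m1]_(x in D1) (\int[m2]_(y in D2) h (x, y)) =
  \int[m2]_(y in D2) (\int[m1]_(x in D1) h (x, y)).
Proof.
move=> sm1 sm2 mD1 mD2 mh fi gi hfg.
have mh1 y : measurable_fun D1 (fun x => h (x, y)).
  by apply: measurable_funTS; exact: measurableT_comp.
have mh2 x : measurable_fun D2 (fun y => h (x, y)).
  by apply: measurable_funTS; exact: measurableT_comp.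
have hi2 x : D1 x -> m2.-integrable D2 (EFin \o (fun y => h (x, y))).
  move=> Dx; apply: (@dominated_integrable _ _ _ _ _ _ (fun y => f x * g y)) => //.
    exact: RintegrableZl.
  by move=> y Dy; exact: hfg.
apply: (@Rintegral_swap _ _ _ _ _ _ _ _ _ _ _ _ _ _ _ _ _
    (fun x => (\int[m2]_(y in D2) g y) * f x)) => //.
- move=> y Dy; apply: (@dominated_integrable _ _ _ _ _ _ (fun x => g y * f x)) => //.
    exact: RintegrableZl.
  by move=> x Dx; rewrite mulrC; exact: hfg.
- exact: RintegrableZl.
- move=> x Dx; rewrite mulrC -RintegralZl//; apply: le_Rintegral => //.
  + exact: integrable_norm (hi2 _ Dx).
  + exact: RintegrableZl.
  + by move=> y Dy; exact: hfg.
Qed.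

(** * Parameter integrals and improper integrals *)

Section parameter_integrals.
Context d (T : measurableType d) (R : realType).
Variable m : {measure set T -> \bar R}.

(** Differentiation under the integral sign, in terms of [is_derive]. *)
Lemma is_derive_Rintegral (D : set T) (f f' : R -> T -> R) (G : T -> R)
    (a r : R) : measurable D -> 0 < r ->
  (forall x, `|x - a| < r -> m.-integrable D (EFin \o f x)) ->
  (forall x y, `|x - a| < r -> D y -> is_derive x 1 (f ^~ y) (f' x y)) ->
  m.-integrable D (EFin \o G) ->
  (forall x y, `|x - a| < r -> D y -> `|f' x y| <= G y) ->
  is_derive a 1 (fun x => \int[m]_(y in D) f x y) (\int[m]_(y in D) f' a y).
Proof.
move=> mD r0 fi df Gi fG.
pose u := a - r; pose v := a + r.
have I x : x \in `]u, v[ -> `|x - a| < r.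
  by rewrite in_itv/= ltr_norml /u /v => /andP[? ?]; apply/andP; split; lra.
have ar : `|a - a| < r by rewrite subrr normr0.
have Ia : `]u, v[%classic a.
  by rewrite /= in_itv/= /u /v; apply/andP; split; lra.
have d1E x y : `|x - a| < r -> D y -> partial1of2 f x y = f' x y.
  move=> xr Dy; rewrite partial1of2E.
  by have := df x y xr Dy => ?; rewrite derive_val.
have G0 y : 0 <= (normr \o G) y by exact: normr_ge0.
have Gi' : m.-integrable D (EFin \o (normr \o G)) by exact: integrable_norm.
have H1 x : `]u, v[%classic x -> m.-integrable D (EFin \o f x).
  by move=> /= /I; exact: fi.
have H2 x y : `]u, v[%classic x -> D y -> derivable (f ^~ y) x 1.
  by move=> /= /I xr Dy; have := df x y xr Dy => -[].
have H3 x y : `]u, v[%classic x -> D y ->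
    `|partial1of2 f x y| <= (normr \o G) y.
  move=> /= /I xr Dy; rewrite d1E//= (le_trans (fG x y xr Dy))//.
  exact: ler_norm.
have D1 := derivable_under_integral mD Ia H1 H2 G0 Gi' H3.
have D2 := differentiation_under_integral mD Ia H1 H2 G0 Gi' H3.
apply: (DeriveDef D1); rewrite -derive1E D2; apply: eq_Rintegral => y; rewrite inE => Dy.
exact: d1E.
Qed.

(** Continuity of a parameter integral at a point, from a local bound. *)
Lemma continuous_Rintegral (D : set T) (f : R -> T -> R) (G : T -> R)
    (a r : R) : measurable D -> 0 < r ->
  (forall x, `|x - a| < r -> measurable_fun D (f x)) ->
  (forall x y, `|x - a| < r -> D y -> {for x, continuous (f ^~ y)}) ->
  m.-integrable D (EFin \o G) ->
  (forall x y, `|x - a| < r -> D y -> `|f x y| <= G y) ->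
  {for a, continuous (fun x => \int[m]_(y in D) f x y)}.
Proof.
move=> mD r0 fi df Gi fG.
pose u := a - r; pose v := a + r.
have I x : x \in `]u, v[ -> `|x - a| < r.
  by rewrite in_itv/= ltr_norml /u /v => /andP[? ?]; apply/andP; split; lra.
have Ia : a \in `]u, v[%classic.
  by rewrite inE /= in_itv/= /u /v; apply/andP; split; lra.
apply: (continuity_under_integral mD _ _ Gi _ Ia).
- move=> x /= /I xr; apply: (dominated_integrable mD (fi _ xr) Gi).
  by move=> y; exact: fG.
- by apply: aeW => y Dy x; rewrite inE /= => /I xr; exact: df.
- by move=> x /= /I xr; apply: aeW => y; exact: fG.
Qed.

End parameter_integrals.

Section improper.
Context (R : realType).
Local Notation mu := (@lebesgue_measure R).

Lemma Rintegral_FTC2 (f F : R -> R) (a b : R) : a < b -> continuous f ->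
  (forall x, is_derive (x : R) 1 F (f x)) ->
  \int[mu]_(x in `[a, b]) f x = F b - F a.
Proof.
move=> ab cf dF.
have dF1 x : derivable F x 1 by have [] := dF x.
have cF x : {for x, continuous F}.
  by apply: differentiable_continuous; exact/derivable1_diffP.
rewrite /Rintegral (@continuous_FTC2 _ f F)//.
- exact: continuous_subspaceT.
- split => //.
  + by apply: cvg_at_right_filter; exact: cF.
  + by apply: cvg_at_left_filter; exact: cF.
- by move=> x _; rewrite derive1E; have := dF x => ?; rewrite derive_val.
Qed.

(** The fundamental theorem of calculus on the whole line. *)
Lemma Rintegral_line (f F : R -> R) (l l' : R) :
  mu.-integrable setT (EFin \o f) -> continuous f ->
  (forall x, is_derive (x : R) 1 F (f x)) ->
  F n%:R @[n --> \oo] --> l -> F (- n%:R) @[n --> \oo] --> l' ->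
  \int[mu]_x f x = l - l'.
Proof.
move=> fi cf dF Fl Fl'.
have mf : measurable_fun setT f by exact: continuous_measurable_fun.
pose A n : set R := `[(- n.+1%:R), n.+1%:R]%classic.
have mA n : measurable (A n) by exact: measurable_itv.
have h1 : (\int[mu]_x (f \_ (A n)) x) @[n --> \oo] --> \int[mu]_x f x.
  apply: (@Rintegral_dominated_cvg _ _ _ mu _ (fun n => f \_ (A n)) f (normr \o f)) => //.
  - move=> n; apply: (measurable_restrictT _ (mA n)).1.
    exact: measurable_funTS.
  - move=> x _; apply: cvg_near_cst; near=> n; rewrite /patch ifT// inE /A /=.
    have : `|x| <= n%:R by near: n; exact: nbhs_infty_ger.
    rewrite in_itv/= ler_norml => /andP[xn nx].
    by rewrite -natr1; apply/andP; split; lra.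
  - exact: integrable_norm.
  - by move=> n x _; rewrite /patch; case: ifP => //=; rewrite normr0.
have h2 n : \int[mu]_x (f \_ (A n)) x = F n.+1%:R - F (- n.+1%:R).
  rewrite -Rintegral_mkcond; apply: Rintegral_FTC2 => //.
  by rewrite -subr_gt0 opprK addr_gt0.
apply: (cvg_unique _ h1) => //=.
rewrite [X in X @ _ --> _](_ : _ = fun n => F n.+1%:R - F (- n.+1%:R)); last first.
  by apply/funext => n; exact: h2.
apply: cvgB.
  by rewrite (cvg_shiftS (fun n => F n%:R)).
by rewrite (cvg_shiftS (fun n => F (- n%:R))).
Unshelve. all: end_near. Qed.

Lemma Rintegral_half_line (f F : R -> R) (l : R) :
  mu.-integrable `]0, +oo[ (EFin \o f) -> continuous f ->
  (forall x, is_derive (x : R) 1 F (f x)) ->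
  F n%:R @[n --> \oo] --> l ->
  \int[mu]_(x in `]0, +oo[) f x = l - F 0.
Proof.
move=> fi cf dF Fl.
pose A n : set R := `]0, n.+1%:R]%classic.
have mA n : measurable (A n) by exact: measurable_itv.
have mf : measurable_fun setT f by exact: continuous_measurable_fun.
have h1 : (\int[mu]_(x in `]0, +oo[) (f \_ (A n)) x) @[n --> \oo] -->
    \int[mu]_(x in `]0, +oo[) f x.
  apply: (@Rintegral_dominated_cvg _ _ _ mu _ (fun n => f \_ (A n)) f (normr \o f)) => //.
  - move=> n; apply: measurable_funTS; apply: (measurable_restrictT _ (mA n)).1.
    exact: measurable_funTS.
  - move=> x /=; rewrite in_itv/= andbT => x0.
    apply: cvg_near_cst; near=> n; rewrite /patch ifT// inE /A /=.
    have : x <= n%:R by near: n; exact: nbhs_infty_ger.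
    by rewrite in_itv/= x0/= -natr1 => ?; lra.
  - exact: integrable_norm.
  - by move=> n x _; rewrite /patch; case: ifP => //=; rewrite normr0.
have h2 n : \int[mu]_(x in `]0, +oo[) (f \_ (A n)) x = F n.+1%:R - F 0.
  rewrite -Rintegral_mkcondr (_ : _ `&` _ = `]0, n.+1%:R]%classic); last first.
    apply/seteqP; split => x /=; rewrite !in_itv/= ?andbT; first by case.
    by move=> xn; split=> //; case/andP: xn.
  rewrite Rintegral_itv_obnd_cbnd; first exact: Rintegral_FTC2.
  apply: (integrableS _ _ _ fi) => //.
  by move=> x /=; rewrite !in_itv/= andbT => /andP[].
apply: (cvg_unique _ h1) => //=.
rewrite [X in X @ _ --> _](_ : _ = fun n => F n.+1%:R - F 0); last first.
  by apply/funext => n; exact: h2.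
apply: cvgB; last exact: cvg_cst.
by rewrite (cvg_shiftS (fun n => F n%:R)).
Unshelve. all: end_near. Qed.

End improper.

(** * Trigonometric integrals and gaussians *)

(** Proves measurability of a real function built from measurable ones by the
    usual operations, by recursion on its syntax. *)
Ltac meas := repeat match goal with
  | |- measurable_fun _ (fun _ => ?c) => exact: measurable_cst
  | H : measurable_fun setT ?f |- measurable_fun _ ?f => exact: (measurable_funTS H)
  | H : measurable_fun setT ?f |- measurable_fun _ (fun x => ?f x) => exact: (measurable_funTS H)
  | |- measurable_fun _ (fun x => x) => exact: measurable_id
  | |- measurable_fun _ (fun x => x.1) => apply: measurable_funTS; exact: measurable_fst
  | |- measurable_fun _ (fun x => x.2) => apply: measurable_funTS; exact: measurable_snd
  | |- measurable_fun _ (fun x => - _) => apply: (measurableT_comp (@oppr_measurable _ setT))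
  | |- measurable_fun _ (fun x => _ + - _) => apply: measurable_funB
  | |- measurable_fun _ (fun x => _ + _) => apply: measurable_funD
  | |- measurable_fun _ (fun x => _ * _) => apply: measurable_funM
  | |- measurable_fun _ (fun x => _ ^+ _) => apply: measurable_funX
  | |- measurable_fun _ (fun x => expR _) => apply: (measurableT_comp (@measurable_expR _))
  | |- measurable_fun _ (fun x => normr _) => apply: (measurableT_comp (@normr_measurable _ setT))
  | |- measurable_fun _ (fun x => cos _) => apply: (measurableT_comp (continuous_measurable_fun (@continuous_cos _)))
  | |- measurable_fun _ (fun x => sin _) => apply: (measurableT_comp (continuous_measurable_fun (@continuous_sin _)))
  | H : measurable_fun setT ?f |- measurable_fun _ (fun x => ?f _) => apply: (measurableT_comp H)
  | |- measurable_fun _ _ => done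
  end.

(** Computes a derivative from the instances of [is_derive] and closes the
    remaining algebraic identity. *)
Ltac deriv := apply: is_derive_eq; rewrite /GRing.scale /=; try field.

Section trig.
Context (R : realType).
Local Notation mu := (@lebesgue_measure R).

Lemma cosM_le1 (m x : R) : `|m * cos x| <= `|m|.
Proof. by rewrite normrM ler_piMr// ler_norml cos_geN1 cos_le1. Qed.

Lemma sinM_le1 (m x : R) : `|m * sin x| <= `|m|.
Proof. by rewrite normrM ler_piMr// ler_norml sin_geN1 sin_le1. Qed.

(** When [m] and [n] are the real and imaginary part of a function [F] such that
    [F (- k)] is conjugate to [F k], this is the integral of [exp (- i k x) F k];
    all the Fourier integrals below have this symmetry, which keeps the analysis
    real. *)
Definition trig_integral (m n : R -> R) (x : R) : R :=
  \int[mu]_k (m k * cos (k * x) + n k * sin (k * x)).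

Section trig_integral.
Variables m n : R -> R.
Hypotheses (mi : mu.-integrable setT (EFin \o m)).
Hypotheses (ni : mu.-integrable setT (EFin \o n)).

Lemma integrable_trig (x : R) :
  mu.-integrable setT (EFin \o (fun k => m k * cos (k * x) + n k * sin (k * x))).
Proof.
have mm := measurable_integrable mi; have mn := measurable_integrable ni.
apply: (@dominated_integrable _ _ _ mu _ _ (fun k => `|m k| + `|n k|)) => //.
- meas.
- by apply: RintegrableD => //; exact: integrable_norm.
- move=> k _; rewrite (le_trans (ler_normD _ _))//.
  by apply: lerD; [exact: cosM_le1|exact: sinM_le1].
Qed.

Lemma trig_integral_le (x : R) :
  `|trig_integral m n x| <= \int[mu]_k (`|m k| + `|n k|).
Proof.
apply: le_trans (le_normr_Rintegral _ (integrable_trig x)) _ => //.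
apply: le_Rintegral => //.
- exact: integrable_norm (integrable_trig x).
- by apply: RintegrableD => //; exact: integrable_norm.
- move=> k _; rewrite (le_trans (ler_normD _ _))//.
  by apply: lerD; [exact: cosM_le1|exact: sinM_le1].
Qed.

Lemma continuous_trig_integral : continuous (trig_integral m n).
Proof.
have mm := measurable_integrable mi; have mn := measurable_integrable ni.
move=> x.
apply: (@continuous_Rintegral _ _ _ mu setT
  (fun x k => m k * cos (k * x) + n k * sin (k * x))
  (fun k => `|m k| + `|n k|) x 1) => //.
- by move=> y _; meas.
- move=> y k _ _; apply: differentiable_continuous; apply/derivable1_diffP.
  by apply: ex_derive.
- by apply: RintegrableD => //; exact: integrable_norm.
- move=> y k _ _; rewrite (le_trans (ler_normD _ _))//.
  by apply: lerD; [exact: cosM_le1|exact: sinM_le1].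
Qed.

Hypotheses (kmi : mu.-integrable setT (EFin \o (fun k => k * m k))).
Hypotheses (kni : mu.-integrable setT (EFin \o (fun k => k * n k))).

(** Differentiation turns [(m, n)] into [(k n, - k m)], that is [F] into
    [- i k F]. *)
Lemma is_derive_trig_integral (x : R) :
  is_derive x 1 (trig_integral m n)
    (trig_integral (fun k => k * n k) (fun k => - (k * m k)) x).
Proof.
have mm := measurable_integrable mi; have mn := measurable_integrable ni.
apply: (@is_derive_Rintegral _ _ _ mu setT
  (fun x k => m k * cos (k * x) + n k * sin (k * x))
  (fun x k => (k * n k) * cos (k * x) + - (k * m k) * sin (k * x))
  (fun k => `|k * n k| + `|k * m k|) x 1) => //.
- by move=> y _; exact: integrable_trig.
- by move=> y k _ _; deriv.
- by apply: RintegrableD => //; exact: integrable_norm.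
- move=> y k _ _; rewrite (le_trans (ler_normD _ _))//.
  rewrite -(normrN (k * m k)).
  by apply: lerD; [exact: cosM_le1|exact: sinM_le1].
Qed.

End trig_integral.
End trig.

Section gauss.
Context (R : realType).
Local Notation mu := (@lebesgue_measure R).

Definition gauss (v x : R) : R := expR (- (v * x ^+ 2 / 2)).

Lemma gauss_ge0 v x : 0 <= gauss v x. Proof. exact: expR_ge0. Qed.

Lemma gauss0 v : gauss v 0 = 1.
Proof. by rewrite /gauss expr0n/= mulr0 mul0r oppr0 expR0. Qed.

Lemma gauss_le1 v x : 0 <= v -> gauss v x <= 1.
Proof.
move=> v0; rewrite -[leRHS]expR0 ler_expR oppr_le0.
by rewrite divr_ge0// mulr_ge0// sqr_ge0.
Qed.

Lemma measurable_gauss v : measurable_fun setT (gauss v).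
Proof. by rewrite /gauss; meas. Qed.

(** A quadratic moment costs half of the precision [v]. *)
Lemma gauss_moment v x : 0 < v -> (1 + x ^+ 2) * gauss v x <= (1 + 4 / v) * gauss (v / 2) x.
Proof.
move=> v0.
have -> : gauss v x = gauss (v / 2) x * gauss (v / 2) x.
  by rewrite /gauss -expRD; congr expR; field.
rewrite mulrA ler_wpM2r ?gauss_ge0//.
have h : v * x ^+ 2 / 4 * gauss (v / 2) x <= 1.
  rewrite /gauss expRN -ler_pdivlMr ?invr_gt0 ?expR_gt0// invrK mul1r.
  have := expR_ge1Dx (v / 2 * x ^+ 2 / 2); apply: le_trans.
  have -> : v / 2 * x ^+ 2 / 2 = v * x ^+ 2 / 4 by field.
  by rewrite lerDr.
rewrite mulrDl mul1r lerD//; first by apply: gauss_le1; lra.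
have -> : 4 / v = 4 / v * 1 by rewrite mulr1.
have -> : x ^+ 2 * gauss (v / 2) x = 4 / v * (v * x ^+ 2 / 4 * gauss (v / 2) x).
  by field; lra.
by rewrite ler_wpM2l// divr_ge0// ltW.
Qed.

Lemma gaussE v m x : 0 < v -> normal_pdf m (Num.sqrt v)^-1 x =
  (Num.sqrt (2 * pi / v))^-1 * gauss v (x - m).
Proof.
move=> v0; have s0 : (Num.sqrt v)^-1 != 0.
  by rewrite invr_eq0 gt_eqF// sqrtr_gt0.
rewrite normal_pdfE//= /normal_peak /normal_fun exprVn sqr_sqrtr 1?ltW//.
congr (_^-1 * expR _); last by field; lra.
by congr Num.sqrt; field; lra.
Qed.

Lemma integrable_gauss v m : 0 < v ->
  mu.-integrable setT (EFin \o (fun x => gauss v (x - m))).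
Proof.
move=> v0.
have z0 : Num.sqrt (2 * pi / v) != 0.
  by rewrite gt_eqF// sqrtr_gt0 divr_gt0// mulr_gt0// pi_gt0.
have := RintegrableZl (Num.sqrt (2 * pi / v)) measurableT
  (integrable_normal_pdf m (Num.sqrt v)^-1).
congr (mu.-integrable _ (EFin \o _)); apply/funext => x /=.
by rewrite gaussE// mulrA divff// mul1r.
Qed.

Lemma integral_gauss v m : 0 < v ->
  \int[mu]_x gauss v (x - m) = Num.sqrt (2 * pi / v).
Proof.
move=> v0.
have z0 : Num.sqrt (2 * pi / v) != 0.
  by rewrite gt_eqF// sqrtr_gt0 divr_gt0// mulr_gt0// pi_gt0.
have : \int[mu]_x normal_pdf m (Num.sqrt v)^-1 x = 1.
  by rewrite /Rintegral integral_normal_pdf.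
under eq_Rintegral do rewrite gaussE//.
rewrite RintegralZl//; last exact: integrable_gauss.
by move/(congr1 ( *%R (Num.sqrt (2 * pi / v)))); rewrite mulrA divff// mul1r mulr1.
Qed.

Lemma integrable_gauss_moment (v m : R) (f : R -> R) (K : R) : 0 < v -> measurable_fun setT f ->
  (forall x, `|f x| <= K * (1 + (x - m) ^+ 2)) ->
  mu.-integrable setT (EFin \o (fun x => f x * gauss v (x - m))).
Proof.
move=> v0 mf fK.
have mg := measurable_gauss v.
apply: (@dominated_integrable _ _ _ mu _ _
  (fun x => K * (1 + 4 / v) * gauss (v / 2) (x - m))) => //.
- meas.
- by apply: RintegrableZl => //; apply: integrable_gauss; lra.
- move=> x _; rewrite normrM (ger0_norm (gauss_ge0 _ _)).
  have K0 : 0 <= K.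
    have := le_trans (normr_ge0 _) (fK m).
    by rewrite subrr expr0n/= addr0 mulr1.
  rewrite -mulrA (le_trans (ler_wpM2r (gauss_ge0 _ _) (fK x)))//.
  by rewrite -mulrA ler_wpM2l// gauss_moment.
Qed.

(** The linear ordinary differential equation that characterises gaussians. *)
Lemma gauss_ode (v : R) (F : R -> R) :
  (forall k, is_derive (k : R) 1 F (- (v * k) * F k)) ->
  forall k, F k = F 0 * gauss v k.
Proof.
move=> dF k.
pose H k := F k * expR (v * k ^+ 2 / 2).
have dH (x : R) : is_derive x 1 H 0 by have := dF x => ?; rewrite /H; deriv.
have := is_derive_0_is_cst k 0 dH.
rewrite /H expr0n/= mulr0 mul0r expR0 mulr1 => <-.
by rewrite /gauss expRN mulfK// gt_eqF// expR_gt0.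
Qed.

Lemma cvg_nat0_of_decay (f : R -> R) (C m : R) :
  (forall x, `|f x| * `|x - m| <= C) ->
  f n%:R @[n --> \oo] --> 0 /\ f (- n%:R) @[n --> \oo] --> 0.
Proof.
move=> fC.
have C0 : 0 <= C by apply: le_trans (fC m); rewrite mulr_ge0.
have H e x : 0 < e -> C / e + 1 <= `|x - m| -> `|f x| <= e.
  move=> e0 Cx.
  have h := fC x.
  have h1 : C < `|x - m| * e by rewrite -ltr_pdivrMr//; lra.
  rewrite leNgt; apply/negP => ef.
  have : `|x - m| * e <= `|f x| * `|x - m|.
    by rewrite mulrC ler_wpM2r// ltW.
  lra.
split; apply/cvgrPdist_le => /= e e0; near=> n; rewrite sub0r normrN; apply: H => //.
- have : `|m| + (C / e + 1) <= n%:R by near: n; exact: nbhs_infty_ger.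
  have := lerB_dist n%:R m; rewrite (@ger0_norm _ n%:R)//; lra.
- have : `|m| + (C / e + 1) <= n%:R by near: n; exact: nbhs_infty_ger.
  have := lerB_dist (- n%:R) m; rewrite normrN (@ger0_norm _ n%:R)//; lra.
Unshelve. all: end_near. Qed.

Lemma gauss_decay v x : 0 < v -> gauss v x * `|x| <= 1 + 4 / v.
Proof.
move=> v0; have h := gauss_moment x v0.
have g1 : gauss (v / 2) x <= 1 by apply: gauss_le1; lra.
have g0 := gauss_ge0 v x.
have v4 : 0 < 4 / v by rewrite divr_gt0.
have x1 : `|x| <= 1 + x ^+ 2.
  by rewrite -real_normK ?num_real//; nra.
have : gauss v x * `|x| <= gauss v x * (1 + x ^+ 2) by rewrite ler_wpM2l.
nra.
Qed.

(** The Fourier transform of a gaussian solves [gauss_ode]: differentiation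
    under the integral followed by an integration by parts. *)
Lemma fourier_gauss v m k : 0 < v ->
  \int[mu]_x (cos (k * (x - m)) * gauss v (x - m)) =
    Num.sqrt (2 * pi / v) * gauss v^-1 k /\
  \int[mu]_x (sin (k * (x - m)) * gauss v (x - m)) = 0.
Proof.
move=> v0.
have mg := measurable_gauss v.
have vi0 : 0 <= v^-1 by rewrite invr_ge0 ltW.
have ic j : mu.-integrable setT (EFin \o (fun x => cos (j * (x - m)) * gauss v (x - m))).
  apply: (@integrable_gauss_moment _ _ _ 1) => //; first by meas.
  by move=> x; rewrite mul1r -[cos _]mul1r (le_trans (cosM_le1 _ _))// normr1 lerDl sqr_ge0.
have isn j : mu.-integrable setT (EFin \o (fun x => sin (j * (x - m)) * gauss v (x - m))).
  apply: (@integrable_gauss_moment _ _ _ 1) => //; first by meas.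
  by move=> x; rewrite mul1r -[sin _]mul1r (le_trans (sinM_le1 _ _))// normr1 lerDl sqr_ge0.
have x1 (x : R) : `|x| <= 1 * (1 + x ^+ 2).
  by rewrite -real_normK ?num_real//; have := normr_ge0 x; nra.
have ixc j : mu.-integrable setT
    (EFin \o (fun x => ((x - m) * cos (j * (x - m))) * gauss v (x - m))).
  apply: (@integrable_gauss_moment _ _ _ 1) => //; first by meas.
  by move=> x; rewrite (le_trans (cosM_le1 _ _))//.
have ixs j : mu.-integrable setT
    (EFin \o (fun x => ((x - m) * sin (j * (x - m))) * gauss v (x - m))).
  apply: (@integrable_gauss_moment _ _ _ 1) => //; first by meas.
  by move=> x; rewrite (le_trans (sinM_le1 _ _))//.
have iG : mu.-integrable setT (EFin \o (fun x => `|x - m| * gauss v (x - m))).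
  apply: (@integrable_gauss_moment _ _ _ 1) => //; first by meas.
  by move=> x; rewrite normr_id.
have g0 x := gauss_ge0 v x.
pose C j := \int[mu]_x (cos (j * (x - m)) * gauss v (x - m)).
pose S j := \int[mu]_x (sin (j * (x - m)) * gauss v (x - m)).
have dC (j : R) : is_derive j 1 C (- (v^-1 * j) * C j).
  have partsC : \int[mu]_x
      (- ((x - m) * sin (j * (x - m)) * gauss v (x - m)) +
       (v^-1 * j) * (cos (j * (x - m)) * gauss v (x - m))) = 0 - 0.
    have [l1 l2] : v^-1 * (sin (j * (n%:R - m)) * gauss v (n%:R - m)) @[n --> \oo] --> 0 /\
        v^-1 * (sin (j * (- n%:R - m)) * gauss v (- n%:R - m)) @[n --> \oo] --> 0.
      apply: (@cvg_nat0_of_decay (fun x => v^-1 * (sin (j * (x - m)) * gauss v (x - m)))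
        (v^-1 * (1 + 4 / v)) m).
      move=> x; rewrite normrM (ger0_norm vi0) -mulrA ler_wpM2l//.
      apply: le_trans (gauss_decay (x - m) v0); rewrite ler_wpM2r// mulrC.
      by rewrite (le_trans (sinM_le1 _ _))// ger0_norm.
    apply: (@Rintegral_line _ _ (fun x => v^-1 * (sin (j * (x - m)) * gauss v (x - m))) _ _ _ _ _ l1 l2).
    - have -> : (fun x => - ((x - m) * sin (j * (x - m)) * gauss v (x - m)) +
          (v^-1 * j) * (cos (j * (x - m)) * gauss v (x - m))) =
          (fun x => (v^-1 * j) * (cos (j * (x - m)) * gauss v (x - m)) -
           ((x - m) * sin (j * (x - m)) * gauss v (x - m))).
        by apply/funext => x; rewrite addrC.
      by apply: RintegrableB => //; exact: RintegrableZl.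
    - move=> x; apply: differentiable_continuous; apply/derivable1_diffP.
      by rewrite /gauss; apply: ex_derive.
    - by move=> x; rewrite /gauss; deriv; lra.
  have fC : \int[mu]_x (- ((x - m) * sin (j * (x - m)) * gauss v (x - m))) = - (v^-1 * j) * C j.
    move: partsC; rewrite RintegralD//; first last.
      exact: RintegrableZl.
      exact: (RintegrableN measurableT (ixs j)).
    by rewrite RintegralZl// subr0 => /eqP; rewrite addr_eq0 mulNr => /eqP.
  rewrite -fC.
  apply: (@is_derive_Rintegral _ _ _ mu setT
    (fun j x => cos (j * (x - m)) * gauss v (x - m))
    (fun j x => - ((x - m) * sin (j * (x - m)) * gauss v (x - m)))
    (fun x => `|x - m| * gauss v (x - m)) j 1) => //.
  - by move=> y x _ _; deriv.
  - move=> y x _ _; rewrite normrN normrM (ger0_norm (g0 _)) ler_wpM2r//.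
    exact: sinM_le1.
have dS (j : R) : is_derive j 1 S (- (v^-1 * j) * S j).
  have partsS : \int[mu]_x
      (((x - m) * cos (j * (x - m)) * gauss v (x - m)) +
       (v^-1 * j) * (sin (j * (x - m)) * gauss v (x - m))) = 0 - 0.
    have [l1 l2] : - v^-1 * (cos (j * (n%:R - m)) * gauss v (n%:R - m)) @[n --> \oo] --> 0 /\
        - v^-1 * (cos (j * (- n%:R - m)) * gauss v (- n%:R - m)) @[n --> \oo] --> 0.
      apply: (@cvg_nat0_of_decay (fun x => - v^-1 * (cos (j * (x - m)) * gauss v (x - m)))
        (v^-1 * (1 + 4 / v)) m).
      move=> x; rewrite normrM normrN (ger0_norm vi0) -mulrA ler_wpM2l//.
      apply: le_trans (gauss_decay (x - m) v0); rewrite ler_wpM2r// mulrC.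
      by rewrite (le_trans (cosM_le1 _ _))// ger0_norm.
    apply: (@Rintegral_line _ _ (fun x => - v^-1 * (cos (j * (x - m)) * gauss v (x - m))) _ _ _ _ _ l1 l2).
    - by apply: RintegrableD => //; exact: RintegrableZl.
    - move=> x; apply: differentiable_continuous; apply/derivable1_diffP.
      by rewrite /gauss; apply: ex_derive.
    - by move=> x; rewrite /gauss; deriv; lra.
  have fS : \int[mu]_x ((x - m) * cos (j * (x - m)) * gauss v (x - m)) = - (v^-1 * j) * S j.
    move: partsS; rewrite RintegralD//; last exact: RintegrableZl.
    by rewrite RintegralZl// subr0 => /eqP; rewrite addr_eq0 mulNr => /eqP.
  rewrite -fS.
  apply: (@is_derive_Rintegral _ _ _ mu setT
    (fun j x => sin (j * (x - m)) * gauss v (x - m))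
    (fun j x => ((x - m) * cos (j * (x - m)) * gauss v (x - m)))
    (fun x => `|x - m| * gauss v (x - m)) j 1) => //.
  - by move=> y x _ _; deriv.
  - move=> y x _ _; rewrite normrM (ger0_norm (g0 _)) ler_wpM2r//.
    exact: cosM_le1.
split.
  rewrite -/(C k) (gauss_ode dC); congr (_ * _).
  rewrite -(integral_gauss m v0); apply: eq_Rintegral => x _.
  by rewrite mul0r cos0 mul1r.
rewrite -/(S k) (gauss_ode dS) /S.
under eq_Rintegral do rewrite mul0r sin0 mul0r.
by rewrite Rintegral_cst// mul0r mul0r.
Qed.

End gauss.

(** * Gaussian kernels and Fourier inversion *)

Section kernel.
Context (R : realType).
Local Notation mu := (@lebesgue_measure R).

Lemma sigma_finite_lebesgue : sigma_finite setT mu.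
Proof. exact: sigma_finiteT. Qed.

(** The density of the centered normal law of variance [w]. *)
Definition gauss_kernel (w x : R) : R :=
  (Num.sqrt (2 * pi * w))^-1 * gauss w^-1 x.

Lemma gauss_kernel_ge0 w x : 0 <= gauss_kernel w x.
Proof. by rewrite mulr_ge0 ?gauss_ge0// invr_ge0 sqrtr_ge0. Qed.

Lemma measurable_gauss_kernel w : measurable_fun setT (gauss_kernel w).
Proof. by have := measurable_gauss (w^-1 : R) => ?; rewrite /gauss_kernel; meas. Qed.

Let peak_neq0 (w : R) : 0 < w -> Num.sqrt (2 * pi * w) != 0.
Proof. by move=> w0; rewrite gt_eqF// sqrtr_gt0 !mulr_gt0// pi_gt0. Qed.

Lemma integrable_gauss_kernel w m : 0 < w ->
  mu.-integrable setT (EFin \o (fun x => gauss_kernel w (x - m))).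
Proof.
by move=> w0; apply: RintegrableZl => //; apply: integrable_gauss; rewrite invr_gt0.
Qed.

Lemma integral_gauss_kernel w m : 0 < w -> \int[mu]_x gauss_kernel w (x - m) = 1.
Proof.
move=> w0; have w1 : 0 < w^-1 by rewrite invr_gt0.
rewrite /gauss_kernel RintegralZl//; last exact: integrable_gauss.
by rewrite integral_gauss// invrK mulVf// peak_neq0.
Qed.

Let integrable_trigM (f : R -> R) w m : 0 < w -> measurable_fun setT f ->
  (forall x, `|f x| <= 1) ->
  mu.-integrable setT (EFin \o (fun x => f x * gauss_kernel w (x - m))).
Proof.
move=> w0 mf f1; apply: (@integrable_bounded_mul _ _ _ mu _ f _ 1) => //.
exact: integrable_gauss_kernel.
Qed.

Lemma integrable_cos_gauss_kernel w m k c : 0 < w ->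
  mu.-integrable setT (EFin \o (fun x => cos (k * (x - c)) * gauss_kernel w (x - m))).
Proof.
move=> w0; apply: integrable_trigM => //; first by meas.
by move=> x; rewrite ler_norml cos_geN1 cos_le1.
Qed.

Lemma integrable_sin_gauss_kernel w m k c : 0 < w ->
  mu.-integrable setT (EFin \o (fun x => sin (k * (x - c)) * gauss_kernel w (x - m))).
Proof.
move=> w0; apply: integrable_trigM => //; first by meas.
by move=> x; rewrite ler_norml sin_geN1 sin_le1.
Qed.

Lemma fourier_gauss_kernel w m k : 0 < w ->
  \int[mu]_x (cos (k * x) * gauss_kernel w (x - m)) = cos (k * m) * gauss w k /\
  \int[mu]_x (sin (k * x) * gauss_kernel w (x - m)) = sin (k * m) * gauss w k.
Proof.
move=> w0; have w1 : 0 < w^-1 by rewrite invr_gt0.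
have ic := integrable_cos_gauss_kernel m k m w0.
have isn := integrable_sin_gauss_kernel m k m w0.
have [fc fs] := fourier_gauss m k w1.
have {}fc : \int[mu]_x (cos (k * (x - m)) * gauss_kernel w (x - m)) = gauss w k.
  rewrite /gauss_kernel.
  transitivity ((Num.sqrt (2 * pi * w))^-1 *
      \int[mu]_x (cos (k * (x - m)) * gauss w^-1 (x - m))).
    rewrite -RintegralZl//; first by apply: eq_Rintegral => x _; ring.
    have := RintegrableZl (Num.sqrt (2 * pi * w)) measurableT ic.
    congr (mu.-integrable _ (EFin \o _)); apply/funext => x /=.
    by rewrite /gauss_kernel mulrCA mulVKf// peak_neq0.
  by rewrite fc !invrK mulKf// peak_neq0.
have {}fs : \int[mu]_x (sin (k * (x - m)) * gauss_kernel w (x - m)) = 0.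
  rewrite /gauss_kernel.
  transitivity ((Num.sqrt (2 * pi * w))^-1 *
      \int[mu]_x (sin (k * (x - m)) * gauss w^-1 (x - m))).
    rewrite -RintegralZl//; first by apply: eq_Rintegral => x _; ring.
    have := RintegrableZl (Num.sqrt (2 * pi * w)) measurableT isn.
    congr (mu.-integrable _ (EFin \o _)); apply/funext => x /=.
    by rewrite /gauss_kernel mulrCA mulVKf// peak_neq0.
  by rewrite fs mulr0.
split.
- under eq_Rintegral => x _.
    rewrite (_ : k * x = k * (x - m) + k * m); last by ring.
    rewrite cosD mulrBl mulrAC (mulrC _ (cos (k * m))) [X in _ - X]mulrAC
      (mulrC _ (sin (k * m))).
    over.
  rewrite RintegralB//; [|exact: RintegrableZl..].
  by rewrite !RintegralZl// fc fs; ring.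
- under eq_Rintegral => x _.
    rewrite (_ : k * x = k * (x - m) + k * m); last by ring.
    rewrite sinD mulrDl mulrAC (mulrC _ (cos (k * m))) [X in _ + X]mulrAC
      (mulrC _ (sin (k * m))).
    over.
  rewrite RintegralD//; [|exact: RintegrableZl..].
  by rewrite !RintegralZl// fc fs; ring.
Qed.

Lemma integrable_gauss0 w : 0 < w -> mu.-integrable setT (EFin \o gauss w).
Proof.
move=> /(integrable_gauss 0); congr (mu.-integrable _ (EFin \o _)).
by apply/funext => x; rewrite subr0.
Qed.

(** A gaussian is itself a Fourier transform. *)
Lemma gauss_kernel_fourier w x : 0 < w ->
  gauss_kernel w x = (2 * pi)^-1 * \int[mu]_k (gauss w k * cos (k * x)).
Proof.
move=> w0; have [+ _] := fourier_gauss 0 x w0.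
under eq_Rintegral => k _ do rewrite subr0 mulrC (mulrC x).
move=> ->; rewrite /gauss_kernel mulrA; congr (_ * _).
have p0 := pi_gt0 R.
have pw : 0 <= pi / w by rewrite divr_ge0// ltW.
have h : Num.sqrt (2 * pi * w) * Num.sqrt (2 * pi / w) = 2 * pi.
  rewrite -sqrtrM; last by rewrite !mulr_ge0// ltW.
  rewrite (_ : 2 * pi * w * (2 * pi / w) = (2 * pi) ^+ 2); last by field; rewrite gt_eqF.
  by rewrite sqrtr_sqr ger0_norm// mulr_ge0// ltW.
have q := peak_neq0 w0.
apply: (mulfI q); rewrite divff// mulrCA h mulVf//.
by rewrite mulf_neq0 ?gt_eqF.
Qed.

(** Convolution with a gaussian multiplies the Fourier transform by a
    gaussian. *)
Lemma gauss_kernel_convolution (m n : R -> R) w a : 0 < w ->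
  mu.-integrable setT (EFin \o m) -> mu.-integrable setT (EFin \o n) ->
  \int[mu]_x (trig_integral m n x * gauss_kernel w (x - a)) =
  trig_integral (fun k => gauss w k * m k) (fun k => gauss w k * n k) a.
Proof.
move=> w0 mi ni.
have mm := measurable_integrable mi; have mn := measurable_integrable ni.
have mg := measurable_gauss_kernel w.
pose h (z : R * R) := (m z.2 * cos (z.2 * z.1) + n z.2 * sin (z.2 * z.1)) *
  gauss_kernel w (z.1 - a).
have mh : measurable_fun setT h by rewrite /h; meas.
have gi := integrable_gauss_kernel a w0.
transitivity (\int[mu]_x (\int[mu]_k h (x, k))).
  apply: eq_Rintegral => x _; rewrite /h/= /trig_integral.
  by rewrite RintegralZr//; exact: integrable_trig.
rewrite (@Rintegral_swap_dominated _ _ _ _ _ mu mu setT setT h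
  (fun x => gauss_kernel w (x - a)) (fun k => `|m k| + `|n k|)) //;
  [|exact: sigma_finite_lebesgue..| | ].
- rewrite /trig_integral; apply: eq_Rintegral => k _; rewrite /h /=.
  have [fc fs] := fourier_gauss_kernel a k w0.
  have ic := integrable_cos_gauss_kernel a k 0 w0.
  have isn := integrable_sin_gauss_kernel a k 0 w0.
  have {}ic : mu.-integrable setT
    (EFin \o (fun x => cos (k * x) * gauss_kernel w (x - a))).
    move: ic; congr (mu.-integrable _ (EFin \o _)).
    by apply/funext => x; rewrite subr0.
  have {}isn : mu.-integrable setT
    (EFin \o (fun x => sin (k * x) * gauss_kernel w (x - a))).
    move: isn; congr (mu.-integrable _ (EFin \o _)).
    by apply/funext => x; rewrite subr0.
  under eq_Rintegral => x _ do rewrite mulrDl -!mulrA.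
  rewrite RintegralD//; [|exact: RintegrableZl..].
  by rewrite !RintegralZl// fc fs; ring.
- by apply: RintegrableD => //; exact: integrable_norm.
- move=> x k _ _; rewrite /h /= normrM (ger0_norm (gauss_kernel_ge0 _ _)) mulrC.
  rewrite ler_wpM2l ?gauss_kernel_ge0// (le_trans (ler_normD _ _))//.
  by apply: lerD; [exact: cosM_le1|exact: sinM_le1].
Qed.

Local Notation wn n := (n.+1%:R^-1 : R).

Lemma harmonic_small (e : R) : 0 < e -> \forall n \near \oo, n.+1%:R^-1 <= e.
Proof.
move=> e0; near=> n.
have : e^-1 <= n%:R by near: n; exact: nbhs_infty_ger.
move=> h; rewrite invf_ple ?posrE// (le_trans h)// ler_nat.
by [].
Unshelve. all: end_near. Qed.

(** Away from its center the kernel is small compared with a fixed gaussian. *)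
Lemma gauss_kernel_tail (eta : R) : 0 < eta -> exists2 C, 0 <= C & forall n z,
  eta <= `|z| -> gauss_kernel (wn n) z <= C * n.+1%:R^-1 * gauss 1 z.
Proof.
move=> eta0; pose b := Num.min 1 (eta ^+ 2 / 4).
have b0 : 0 < b by rewrite lt_min ltr01/= divr_gt0// exprn_gt0.
(* [exp (- z) <= 1 / (1 + z)] used twice gives a factor [n ^- 2], one power of
   which is consumed by the height of the peak. *)
exists (b ^- 2); first by rewrite invr_ge0 exprn_ge0// ltW.
move=> n z ez.
have N1 : 1 <= n.+1%:R :> R by rewrite ler1n.
have nE : n%:R = n.+1%:R - 1 :> R by rewrite -natr1 addrK.
set N : R := n.+1%:R in N1 nE *.
have z2 : eta ^+ 2 <= z ^+ 2 by rewrite -[z ^+ 2]real_normK ?num_real// lerXn2r ?nnegrE// ltW.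
have pk : (Num.sqrt (2 * pi * wn n))^-1 <= N.
  have p2 := pi_gt0 R; have p3 := @pi_ge2 R.
  rewrite invf_ple ?posrE; [|by rewrite sqrtr_gt0 !mulr_gt0// invr_gt0; lra|lra].
  rewrite -[leLHS]ger0_norm; last by rewrite invr_ge0; lra.
  rewrite -sqrtr_sqr ler_sqrt; last by rewrite !mulr_ge0// ltW// invr_gt0.
  rewrite -/N exprVn.
  have -> : N ^- 2 = N^-1 * N^-1 by rewrite -exprVn expr2.
  rewrite ler_wpM2r ?invr_ge0//.
  have : N^-1 <= 1 by rewrite invf_le1; lra.
  by move=> /le_trans; apply; lra.
have gE : gauss (wn n)^-1 z = gauss 1 z * expR (- (n%:R * z ^+ 2 / 4)) ^+ 2.
  by rewrite /gauss invrK (expr2 (expR _)) -!expRD -/N nE; congr expR; lra.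
have eb : expR (- (n%:R * z ^+ 2 / 4)) <= (b * N)^-1.
  rewrite expRN lef_pV2 ?posrE ?expR_gt0//; last by rewrite mulr_gt0//; lra.
  apply: le_trans (expR_ge1Dx _).
  have b1 : b <= 1 by rewrite ge_min lexx.
  have b2 : b <= z ^+ 2 / 4.
    by rewrite /b ge_min; apply/orP; right; lra.
  have n0 : 0 <= n%:R :> R by [].
  have : b * n%:R <= z ^+ 2 / 4 * n%:R by rewrite ler_wpM2r.
  have -> : N = n%:R + 1 by rewrite nE subrK.
  have -> : n%:R * z ^+ 2 / 4 = z ^+ 2 / 4 * n%:R by ring.
  by lra.
rewrite /gauss_kernel gE.
have g0 := gauss_ge0 1 z.
have E0 : 0 <= expR (- (n%:R * z ^+ 2 / 4)) by exact: expR_ge0.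
have E2 : expR (- (n%:R * z ^+ 2 / 4)) ^+ 2 <= (b * N)^-1 ^+ 2.
  by rewrite lerXn2r ?nnegrE// invr_ge0 mulr_ge0//; lra.
rewrite mulrCA [leRHS]mulrC ler_wpM2l//.
apply: le_trans (ler_pM _ _ pk E2) _.
- by rewrite invr_ge0 sqrtr_ge0.
- by rewrite exprn_ge0.
rewrite le_eqVlt; apply/orP; left; apply/eqP; rewrite /N; field.
by rewrite gt_eqF ?ltr0n// gt_eqF.
Qed.

Lemma cvg_gauss_kernel_away (d : R) : 0 < d ->
  gauss_kernel (wn n) d @[n --> \oo] --> (0 : R).
Proof.
move=> d0; have [C C0 HC] := gauss_kernel_tail d0.
have h : C * n.+1%:R^-1 @[n --> \oo] --> (0 : R).
  by rewrite -[X in _ --> X](mulr0 C); apply: cvgMr; exact: cvg_harmonic.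
apply: (@squeeze_cvgr _ _ _ _ (cst 0) _ _ _ _ _ h); last exact: cvg_cst.
apply: nearW => n; rewrite gauss_kernel_ge0/=.
apply: (le_trans (HC n d _)); first exact: ler_norm.
by rewrite ler_piMr ?gauss_le1// mulr_ge0.
Qed.

(** The kernels of variance [1 / (n + 1)] form an approximate identity: near
    [x] the continuity of [p] is used, and away from [x] the uniform bound
    [gauss_kernel_tail]. *)
Lemma gauss_kernel_approximation (p : R -> R) x :
  mu.-integrable setT (EFin \o p) -> {for x, continuous p} ->
  \int[mu]_y (p y * gauss_kernel (wn n) (y - x)) @[n --> \oo] --> p x.
Proof.
move=> ip cp.
have w0 n : 0 < wn n by rewrite invr_gt0.
have mp := measurable_integrable ip.
apply/cvgrPdist_le => /= e e0.
have e2 : 0 < e / 2 by lra.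
move/cvgrPdist_le : cp => /(_ _ e2)[eta /= eta0 peta].
have [C C0 KC] := gauss_kernel_tail eta0.
pose M := \int[mu]_y (`|p y| + `|p x| * gauss 1 (y - x)).
have iM : mu.-integrable setT (EFin \o (fun y => `|p y| + `|p x| * gauss 1 (y - x))).
  apply: RintegrableD => //; first exact: integrable_norm.
  by apply: RintegrableZl => //; exact: integrable_gauss.
have M0 : 0 <= M.
  by apply: Rintegral_ge0 => y _; rewrite addr_ge0// mulr_ge0// gauss_ge0.
near=> n.
have sm : n.+1%:R^-1 <= e / 2 / (C * M + 1).
  near: n; apply: harmonic_small; rewrite divr_gt0//.
  by have := mulr_ge0 C0 M0; lra.
have mK := measurable_gauss_kernel (wn n).
have iK := integrable_gauss_kernel x (w0 n).
pose B y := e / 2 * gauss_kernel (wn n) (y - x) +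
    C * n.+1%:R^-1 * (`|p y| + `|p x| * gauss 1 (y - x)).
have iB : mu.-integrable setT (EFin \o B).
  by apply: RintegrableD => //; exact: RintegrableZl.
have pB y : `|(p y - p x) * gauss_kernel (wn n) (y - x)| <= B y.
  rewrite normrM (ger0_norm (gauss_kernel_ge0 _ _)).
  have K0 := gauss_kernel_ge0 (wn n) (y - x).
  have g0 := gauss_ge0 1 (y - x).
  have g1 : gauss 1 (y - x) <= 1 by exact: gauss_le1.
  have N0 : 0 <= n.+1%:R^-1 :> R by [].
  have Cn0 := mulr_ge0 C0 N0.
  rewrite /B; have [yx|yx] := ltP `|y - x| eta.
    have h : `|p y - p x| <= e / 2.
      by rewrite distrC; apply: peta; rewrite /= distrC.
    apply: le_trans (ler_wpM2r K0 h) _; rewrite lerDl mulr_ge0//.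
    by rewrite addr_ge0// mulr_ge0.
  have := KC n _ yx => KN.
  have h : `|p y - p x| <= `|p y| + `|p x| by exact: ler_normB.
  have h2 := ler_pM (normr_ge0 _) K0 h KN.
  apply: le_trans h2 _.
  apply: (@le_trans _ _ (C / n.+1%:R * (`|p y| + `|p x| * gauss 1 (y - x)))).
    rewrite mulrCA ler_wpM2l// mulrDl lerD2r ler_piMr//.
  by rewrite lerDr mulr_ge0//; lra.
have ipK : mu.-integrable setT (EFin \o (fun y => (p y - p x) * gauss_kernel (wn n) (y - x))).
  apply: (@dominated_integrable _ _ _ mu _ _ B) => //.
  meas.
have -> : p x - \int[mu]_y (p y * gauss_kernel (wn n) (y - x)) =
    - \int[mu]_y ((p y - p x) * gauss_kernel (wn n) (y - x)).
  have -> : \int[mu]_y (p y * gauss_kernel (wn n) (y - x)) =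
     \int[mu]_y ((p y - p x) * gauss_kernel (wn n) (y - x) + p x * gauss_kernel (wn n) (y - x)).
    by apply: eq_Rintegral => y _; ring.
  rewrite RintegralD//; last exact: RintegrableZl.
  by rewrite RintegralZl// integral_gauss_kernel// mulr1 opprD addrCA subrr addr0.
rewrite normrN (le_trans (le_normr_Rintegral _ ipK))//.
have : \int[mu]_y `|(p y - p x) * gauss_kernel (wn n) (y - x)| <= \int[mu]_y B y.
  by apply: le_Rintegral => //; exact: integrable_norm.
move=> /le_trans; apply.
rewrite /B RintegralD//; [|exact: RintegrableZl..].
rewrite (@RintegralZl _ _ _ mu setT (fun y => gauss_kernel (wn n) (y - x)) (e / 2))//.
rewrite integral_gauss_kernel// mulr1 RintegralZl// -/M.
have CM1 : 0 < C * M + 1 by have := mulr_ge0 C0 M0; lra.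
have h1 : C * n.+1%:R^-1 * M <= e / 2.
  rewrite mulrAC; have := ler_wpM2l (mulr_ge0 C0 M0) sm.
  move=> /le_trans; apply; rewrite mulrCA ler_piMr//; first by lra.
  by rewrite ler_pdivrMr// mul1r; lra.
by rewrite [leRHS](splitr e) lerD2l.
Unshelve. all: end_near. Qed.

Lemma cvg_gauss_wn (k : R) : gauss (wn n) k @[n --> \oo] --> (1 : R).
Proof.
rewrite -[X in _ --> X](@expR0 R); apply: continuous_cvg; first exact: continuous_expR.
rewrite -[X in _ --> X]oppr0; apply: cvgN.
rewrite (_ : 0 = 0 * k ^+ 2 / 2); last by rewrite !mul0r.
apply: cvgMl; apply: cvgMl; exact: cvg_harmonic.
Qed.

(** Removing the gaussian regularisation of a trigonometric integral. *)
Lemma cvg_trig_integral_gauss (m n : R -> R) x :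
  mu.-integrable setT (EFin \o m) -> mu.-integrable setT (EFin \o n) ->
  trig_integral (fun k => gauss (wn N) k * m k) (fun k => gauss (wn N) k * n k) x
    @[N --> \oo] --> trig_integral m n x.
Proof.
move=> mi ni.
have mm := measurable_integrable mi; have mn := measurable_integrable ni.
apply: (@Rintegral_dominated_cvg _ _ _ mu setT
  (fun N k => gauss (wn N) k * m k * cos (k * x) + gauss (wn N) k * n k * sin (k * x)) _
  (fun k => `|m k| + `|n k|)) => //.
- by move=> N; have := measurable_gauss (wn N) => ?; meas.
- move=> k _.
  rewrite [X in _ --> X](_ : _ = 1 * m k * cos (k * x) + 1 * n k * sin (k * x));
    last by rewrite !mul1r.
  by apply: cvgD; apply: cvgMl; apply: cvgMl; exact: cvg_gauss_wn.
- by apply: RintegrableD => //; exact: integrable_norm.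
- move=> N k _; rewrite (le_trans (ler_normD _ _))//.
  have g0 := gauss_ge0 (wn N) k.
  have g1 : gauss (wn N) k <= 1 by apply: gauss_le1; rewrite invr_ge0.
  by apply: lerD; [apply: le_trans (cosM_le1 _ _) _|apply: le_trans (sinM_le1 _ _) _];
    rewrite normrM (ger0_norm g0) ler_piMl.
Qed.

(** Fourier inversion at a point of continuity of an integrable function with
    integrable Fourier transform, by gaussian regularisation. *)
Lemma fourier_inversion (p : R -> R) x :
  mu.-integrable setT (EFin \o p) -> {for x, continuous p} ->
  let pc k := \int[mu]_y (cos (k * y) * p y) in
  let ps k := \int[mu]_y (sin (k * y) * p y) in
  mu.-integrable setT (EFin \o pc) -> mu.-integrable setT (EFin \o ps) ->
  p x = (2 * pi)^-1 * trig_integral pc ps x.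
Proof.
move=> ip cp pc ps ipc ips.
have mp := measurable_integrable ip.
have pi2 : 2 * pi != 0 :> R by rewrite mulf_neq0// gt_eqF// pi_gt0.
have w0 n : 0 < wn n by rewrite invr_gt0.
have H n : \int[mu]_y (p y * gauss_kernel (wn n) (y - x)) =
   (2 * pi)^-1 * trig_integral (fun k => gauss (wn n) k * pc k)
     (fun k => gauss (wn n) k * ps k) x.
  have mg := measurable_gauss (wn n).
  pose h (z : R * R) := p z.1 * (gauss (wn n) z.2 * cos (z.2 * (z.1 - x))).
  have ig := integrable_gauss0 (w0 n).
  have ih y : mu.-integrable setT (EFin \o (fun k => gauss (wn n) k * cos (k * (y - x)))).
    apply: (@dominated_integrable _ _ _ mu _ _ (gauss (wn n))) => //.
      meas.
    by move=> k _; rewrite (le_trans (cosM_le1 _ _))// ger0_norm// gauss_ge0.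
  transitivity ((2 * pi)^-1 * \int[mu]_y (\int[mu]_k h (y, k))).
    have E : (fun y => \int[mu]_k h (y, k)) =
        (fun y => 2 * pi * (p y * gauss_kernel (wn n) (y - x))).
      apply/funext => y; rewrite /h /= RintegralZl// gauss_kernel_fourier//.
      by rewrite (mulrCA (2 * pi)) mulVKf.
    rewrite E RintegralZl//; first by rewrite mulrA mulVf// mul1r.
    apply: (@dominated_integrable _ _ _ mu _ _
      (fun y => (Num.sqrt (2 * pi * wn n))^-1 * `|p y|)) => //.
    - by have := measurable_gauss_kernel (wn n) => ?; meas.
    - by apply: RintegrableZl => //; exact: integrable_norm.
    - move=> y _; rewrite normrM mulrC ler_wpM2r// ger0_norm ?gauss_kernel_ge0//.
      rewrite /gauss_kernel ler_piMr ?invr_ge0 ?sqrtr_ge0//.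
      by apply: gauss_le1; rewrite invr_ge0 ltW.
  congr (_ * _).
  rewrite (@Rintegral_swap_dominated _ _ _ _ _ mu mu setT setT h
    (normr \o p) (gauss (wn n))) //; [|exact: sigma_finite_lebesgue..| | | ].
  - apply: eq_Rintegral => k _; rewrite /h /=.
    have ipcos : mu.-integrable setT (EFin \o (fun y => cos (k * y) * p y)).
      apply: (@integrable_bounded_mul _ _ _ mu _ (fun y => cos (k * y)) _ 1) => //.
        meas.
      by move=> y _; rewrite ler_norml cos_geN1 cos_le1.
    have ipsin : mu.-integrable setT (EFin \o (fun y => sin (k * y) * p y)).
      apply: (@integrable_bounded_mul _ _ _ mu _ (fun y => sin (k * y)) _ 1) => //.
        meas.
      by move=> y _; rewrite ler_norml sin_geN1 sin_le1.
    under eq_Rintegral => y _.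
      rewrite (_ : p y * _ = gauss (wn n) k * cos (k * x) * (cos (k * y) * p y) +
          gauss (wn n) k * sin (k * x) * (sin (k * y) * p y)); last first.
        by rewrite mulrBr cosB; ring.
      over.
    rewrite RintegralD//; [|exact: RintegrableZl..].
    by rewrite !RintegralZl// -/(pc k) -/(ps k); ring.
  - by rewrite /h; meas.
  - exact: integrable_norm.
  - move=> y k _ _; rewrite /h /= normrM ler_wpM2l//.
    by rewrite (le_trans (cosM_le1 _ _))// ger0_norm// gauss_ge0.
have c1 := gauss_kernel_approximation ip cp.
have c2 : (2 * pi)^-1 * trig_integral (fun k => gauss (wn n) k * pc k)
     (fun k => gauss (wn n) k * ps k) x @[n --> \oo] --> (2 * pi)^-1 * trig_integral pc ps x.
  by apply: cvgMr; exact: cvg_trig_integral_gauss.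
apply: (cvg_unique _ c1) => //=.
by under eq_fun do rewrite H.
Qed.

End kernel.

(** * Measures on the negative half-line and their tails *)

Section neg_measures.
Context (R : realType).
Implicit Types m : {measure set (measurableTypeR R) -> \bar R}.

Definition neg : set R := `]-oo, 0[%classic.

Lemma measurable_neg : measurable neg. Proof. exact: measurable_itv. Qed.

Definition ray (x : R) : set R := `]-oo, - x[%classic.

Lemma measurable_ray x : measurable (ray x). Proof. exact: measurable_itv. Qed.

Let wn (n : nat) : R := n.+1%:R^-1.

Let wn_gt0 n : 0 < wn n. Proof. by rewrite invr_gt0. Qed.

Lemma neg_bigcup_ray : neg = \bigcup_n ray (wn n).
Proof.
apply/seteqP; split=> [x|x [n _]]; rewrite /neg /ray /= !in_itv/=.
  move=> x0; have x1 : 0 < - x / 2 by lra.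
  have [N _ /(_ N (leqnn N)) H] := harmonic_small x1.
  by exists N => //=; rewrite in_itv/=; move: H; rewrite -/(wn N); move: (wn N) => w; lra.
by have := wn_gt0 n; move: (wn n) => w; lra.
Qed.

(** A measure on the open negative half-line is determined by its tails: they
    form a pi-system of sets of finite measure. *)
Lemma measure_neg_unique m1 m2 :
  (forall x, 0 < x -> m1 (ray x) = m2 (ray x)) ->
  (forall x, 0 < x -> (m1 (ray x) < +oo)%E) ->
  forall A, measurable A -> A `<=` neg -> m1 A = m2 A.
Proof.
move=> m12 m1oo A mA An.
have rayI n (x : R) : `]-oo, x[%classic `&` ray (wn n) = ray (Num.max (- x) (wn n)).
  rewrite /ray; apply/seteqP; split=> y /=; rewrite !in_itv/=.
    by move=> [yx yw]; rewrite ltrNr gt_max ltrN2 yx/= ltrNr.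
  by rewrite ltrNr gt_max ltrN2 => /andP[yx yw]; rewrite yx ltrNr.
have max0 n (x : R) : 0 < Num.max (- x) (wn n) by rewrite lt_max wn_gt0 orbT.
have restr n B : measurable B -> m1 (B `&` ray (wn n)) = m2 (B `&` ray (wn n)).
  move=> mB.
  have H := @measure_unique _ R (measurableTypeR R) (@RGenInftyO.G R)
    (fun k => `]-oo, k%:R[%classic) (RGenInftyO.measurableE R) _ _ _
    (mrestr m1 (measurable_ray (wn n))) (mrestr m2 (measurable_ray (wn n))).
  apply: H => //.
  - move=> _ _ [x ->] [y ->]; exists (Num.min x y).
    apply/seteqP; split=> z /=; rewrite !in_itv/= lt_min; last by move/andP.
    by case=> -> ->.
  - by move=> i; exists i%:R.
  - apply/seteqP; split=> // x _.
    exists (Num.truncn `|x|).+1 => //=; rewrite in_itv/=.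
    by rewrite (le_lt_trans (ler_norm _))// truncnS_gt.
  - move=> _ [x ->]; have := m12 _ (max0 n x); rewrite -rayI; exact.
  - by move=> k; have := m1oo _ (max0 n k%:R); rewrite -rayI.
have E : A = \bigcup_n (A `&` ray (wn n)).
  by rewrite -setI_bigcupr -neg_bigcup_ray; exact/esym/setIidl.
have nd : nondecreasing_seq (fun n => A `&` ray (wn n)).
  move=> i j ij; apply/subsetPset; apply: setIS; rewrite /ray => x /=.
  rewrite !in_itv/= => /lt_le_trans; apply.
  by rewrite lerN2 lef_pV2 ?posrE// ler_nat ltnS.
have mAn n : measurable (A `&` ray (wn n)) by apply: measurableI => //; exact: measurable_ray.
have mU : measurable (\bigcup_n (A `&` ray (wn n))) by rewrite -E.
have c1 := nondecreasing_cvg_mu (mu := m1) mAn mU nd.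
have c2 := nondecreasing_cvg_mu (mu := m2) mAn mU nd.
rewrite E -(cvg_lim _ c1)// -(cvg_lim _ c2)//; congr (limn _).
by apply/funext => n /=; exact: restr.
Qed.

Lemma sigma_finite_of_tails m : m `[0%R, +oo[%classic = 0%E ->
  (forall x, 0 < x -> (m (ray x) < +oo)%E) -> sigma_finite setT m.
Proof.
move=> m0 mr; exists (fun n => ray (wn n) `|` `[0%R, +oo[%classic).
  apply/esym/seteqP; split=> // x _.
  have [x0|x0] := ltP (x : R) 0; last first.
    by exists 0%N => //; right; rewrite /= in_itv/= andbT.
  have : neg x by rewrite /neg /= in_itv.
  by rewrite neg_bigcup_ray => -[n _ xn]; exists n => //; left.
move=> n; split; first by apply: measurableU => //; exact: measurable_ray.
have mray := measurable_ray (wn n).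
have mI : measurable (`[0%R, +oo[%classic : set R) by exact: measurable_itv.
have := measureU2 m mray mI; move=> /le_lt_trans; apply.
by rewrite [X in (_ + X)%E]m0 adde0; exact: mr.
Qed.

End neg_measures.

Section tails.
Context (R : realType).
Variables (alpha c : R) (theta : R -> R).
Hypotheses (alpha12 : 1 < alpha < 2) (c1 : 1 < c).
Hypothesis adm : admissible c alpha theta.

Let c0 : 0 < c. Proof. exact: lt_trans c1. Qed.

(** The scaling factor [c^(1/alpha)]: the period of [theta] is its logarithm. *)
Definition ratio : R := c `^ alpha^-1.

Let alpha0 : 0 < alpha. Proof. by case/andP: alpha12 => *; lra. Qed.

Lemma ratio_pow : ratio `^ alpha = c.
Proof. by rewrite -powRrM mulVf ?gt_eqF// powRr1// ltW. Qed.

Lemma ratio_gt1 : 1 < ratio.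
Proof.
rewrite /ratio /powR (gt_eqF c0).
by rewrite expR_gt1 mulr_gt0 ?invr_gt0// ln_gt0.
Qed.

Let ratio0 : 0 < ratio. Proof. by have := ratio_gt1; lra. Qed.

Lemma ratio_lt : ratio < c.
Proof.
have a1 : 1 < alpha by case/andP: alpha12.
have ra := ratio_gt1; have r0 := ratio0.
rewrite -[X in _ < X]ratio_pow /powR gt_eqF// -[X in X < _]lnK ?posrE//.
by rewrite ltr_expR ltr_pMl// ln_gt0.
Qed.

Definition tail (x : R) : R := x `^ (- alpha) * theta (ln x).

Lemma tail_gt0 x : 0 < x -> 0 < tail x.
Proof.
by move=> x0; case: adm => t0 _ _; rewrite mulr_gt0// powR_gt0.
Qed.

Lemma tail_scaling x : 0 < x -> tail (ratio * x) = c^-1 * tail x.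
Proof.
move=> x0; case: adm => _ per _.
rewrite /tail powRM ?ltW// lnM ?posrE// addrC per powRN ratio_pow.
by rewrite mulrA.
Qed.

Lemma tail_pow n : tail (ratio ^+ n) = c ^- n * tail 1.
Proof.
elim: n => [|n IH]; first by rewrite !expr0 invr1 mul1r.
rewrite exprS tail_scaling ?exprn_gt0// IH mulrA -invfM; congr (_^-1 * _).
by rewrite exprS.
Qed.

Lemma periodic_int (p : R) : periodic theta p -> forall (n : int) u,
  theta (u + n%:~R * p) = theta u.
Proof.
move=> per [n|n] u.
  have -> : u + (Posz n)%:~R * p = u + p *+ n by rewrite -mulr_natl.
  exact: periodicn.
rewrite -(periodicn per n.+1 (u + _)); congr theta.
by rewrite NegzE rmorphN mulNr -mulr_natl subrK.
Qed.

(** Monotonicity of [tail] bounds [theta] from below on one period. *)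
Lemma theta_lower_bound : exists2 t0, 0 < t0 & forall u, t0 <= theta u.
Proof.
have [t0 per mono] := adm.
pose p := ln ratio.
have p0 : 0 < p by rewrite ln_gt0// ratio_gt1.
exists (c^-1 * theta p); first by rewrite mulr_gt0// invr_gt0 c0.
move=> u.
pose n := Num.floor (u / p).
have /andP[n1 n2] := floor_itv (u / p).
pose v := u - n%:~R * p.
have v0 : 0 <= v by rewrite subr_ge0 -ler_pdivlMr.
have v1 : v <= p.
  by move: n2; rewrite /v ltr_pdivrMr// intrD mulrDl mul1r; lra.
have -> : theta u = theta v.
  by rewrite -(periodic_int per n v) subrK.
have ev : 0 < expR v by exact: expR_gt0.
have el : expR v <= ratio by rewrite -[ratio]lnK ?posrE// ler_expR.
have := mono _ _ ev el; rewrite powRN ratio_pow expRK => h.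
apply: le_trans h _.
apply: ler_piMl; first exact: ltW.
rewrite powRN invf_le1 ?powR_gt0// -(powRr0 (expR v)).
by apply: ler_powR; [rewrite -[leLHS]expR0 ler_expR|exact: ltW].
Qed.

End tails.

(** * The semistable Levy measure *)

(** Bernoulli's inequality. *)
Lemma exprn_unbounded (R : realType) (M x : R) : 1 < x -> exists n, M <= x ^+ n.
Proof.
move=> x1; have d0 : 0 < x - 1 by rewrite subr_gt0.
have x0 : 0 < x by exact: lt_trans x1.
exists (Num.truncn (`|M| / (x - 1))).+1.
have h : `|M| / (x - 1) < (Num.truncn (`|M| / (x - 1))).+1%:R by rewrite truncnS_gt.
set N := (Num.truncn _).+1 in h *.
have bern n : 1 + n%:R * (x - 1) <= x ^+ n.
  elim: n => [|k IH]; first by rewrite mul0r addr0 expr0.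
  rewrite exprS -natr1.
  have h1 : 0 <= k%:R * (x - 1) * (x - 1) by rewrite !mulr_ge0// ltW.
  have := ler_wpM2l (ltW x0) IH; apply: le_trans.
  rewrite -subr_ge0 (_ : _ - _ = k%:R * (x - 1) * (x - 1))//; ring.
move: h; rewrite ltr_pdivrMr// => /ltW h.
apply: le_trans (bern N); apply: (le_trans (ler_norm M)); apply: (le_trans h).
by rewrite lerDr.
Qed.

Section semistable_measure.
Context (R : realType).
Variables (alpha c : R) (theta : R -> R).
Hypotheses (alpha12 : 1 < alpha < 2) (c1 : 1 < c).
Hypothesis adm : admissible c alpha theta.
Variable phi : {measure set (measurableTypeR R) -> \bar R}.
Hypothesis semi : semistable_levy_measure alpha theta phi.
Local Notation L := (ratio alpha c).
Local Notation tl := (tail alpha theta).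

Let c0 : 0 < c. Proof. exact: lt_trans c1. Qed.

Let L1 : 1 < L. Proof. exact: ratio_gt1 alpha12 c1. Qed.

Let L0 : 0 < L. Proof. exact: lt_trans L1. Qed.

Lemma semistable_ray x : 0 < x -> phi (ray x) = (tl x)%:E.
Proof. by move=> x0; case: semi => _ _ /(_ x x0). Qed.

Lemma semistable_sigma_finite : sigma_finite setT phi.
Proof.
case: semi => _ p0 _; apply: sigma_finite_of_tails => // x x0.
by rewrite semistable_ray// ltry.
Qed.

(** The natural majorant of compensated exponentials. *)
Definition levy_weight (y : R) : R := Num.min (y ^+ 2) `|y|.

Lemma levy_weight_ge0 y : 0 <= levy_weight y.
Proof. by rewrite le_min sqr_ge0/=. Qed.

Lemma measurable_levy_weight : measurable_fun setT levy_weight.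
Proof. by apply: measurable_minr; meas. Qed.

(** [\sum_n block n y] dominates [`|y|] for [y < - 1]: the block [n] such that
    [L ^ n < - y <= L ^ (n + 1)] does. *)
Let block (n : nat) (y : R) : \bar R :=
  ((L ^+ n.+1)%:E * (\1_(ray (L ^+ n)) y)%:E)%E.

Let block_ge0 n y : (0 <= block n y)%E.
Proof. by rewrite mule_ge0// lee_fin// exprn_ge0// ltW. Qed.

Let measurable_block n : measurable_fun setT (block n).
Proof.
apply: emeasurable_funM; first exact: measurable_cst.
by apply/measurable_EFinP; apply: measurable_indic; exact: measurable_ray.
Qed.

(** The tails decay like [c ^- n] while [L < c], so the integrals of the blocks
    form a geometric series. *)
Let integral_block n :
  (\int[phi]_(y in @neg R) block n y = (L * tl 1 * (L / c) ^+ n)%:E)%E.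
Proof.
have Ln0 : 0 < L ^+ n by rewrite exprn_gt0.
have mI : measurable_fun (@neg R) (fun y => (\1_(ray (L ^+ n)) y)%:E : \bar R).
  apply/measurable_EFinP; apply: measurable_funTS; apply: measurable_indic.
  exact: measurable_ray.
have Ln1 : 0 <= L ^+ n.+1 by rewrite exprn_ge0// ltW.
rewrite (ge0_integralZl_EFin phi (@measurable_neg R) _ mI Ln1); last first.
  by move=> y _; rewrite lee_fin.
rewrite integral_indic//; [|exact: measurable_neg|exact: measurable_ray].
rewrite (_ : _ `&` _ = ray (L ^+ n)).
  rewrite semistable_ray// (tail_pow alpha12 c1 adm) -EFinM; congr (_%:E).
  by rewrite exprS exprMn exprVn; ring.
apply/setIidl => y; rewrite /ray /neg /= !in_itv/= => /lt_trans; apply.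
by rewrite oppr_lt0.
Qed.

Let weight_le (y : R) : y < 0 ->
  ((levy_weight y)%:E <= (Num.min 1 (y ^+ 2))%:E + \sum_(n <oo) block n y)%E.
Proof.
move=> y0; have [y1|y1] := leP `|y| 1.
  apply: (@le_trans _ _ ((Num.min 1 (y ^+ 2))%:E)).
    rewrite lee_fin ge_min; apply/orP; left; rewrite le_min lexx andbT.
    by rewrite -real_normK ?num_real// expr_le1.
  by rewrite leeDl// nneseries_ge0.
have ex := exprn_unbounded `|y| L1.
pose n := ex_minn ex.
have [m n_def] : exists m, n = m.+1.
  rewrite /n; case: ex_minnP => -[|m]; last by exists m.
  by rewrite expr0 leNgt y1.
have yn : `|y| <= L ^+ m.+1 by rewrite -n_def /n; case: ex_minnP.
have ym : L ^+ m < `|y|.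
  rewrite ltNge; apply/negP => h; have : (n <= m)%N.
    by rewrite /n; case: ex_minnP => k _; exact.
  by rewrite n_def ltnn.
apply: (@le_trans _ _ (\sum_(n <oo) block n y)%E); last first.
  by rewrite leeDr// lee_fin le_min ler01 sqr_ge0.
apply: (@le_trans _ _ (\sum_(0 <= i < m.+1) block i y)%E); last first.
  exact: nneseries_lim_ge.
rewrite big_nat_recr//= (@le_trans _ _ (block m y))//; last first.
  by rewrite leeDr// sume_ge0.
rewrite /block indicE mem_set ?mule1 ?lee_fin.
  by rewrite ge_min yn orbT.
by rewrite /ray /= in_itv/=; move: ym; rewrite ltr0_norm// ltrNr.
Qed.

(** Near [0] this is the defining property of a Levy measure; at infinity it
    uses [1 < alpha], through [ratio_lt]. *)
Lemma integrable_levy_weight : phi.-integrable (@neg R) (EFin \o levy_weight).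
Proof.
have mn := @measurable_neg R.
apply/integrableP; split.
  by apply/measurable_EFinP; apply: measurable_funTS; exact: measurable_levy_weight.
apply: (@le_lt_trans _ _
    (\int[phi]_(y in @neg R) ((Num.min 1 (y ^+ 2))%:E + \sum_(n <oo) block n y))%E).
  apply: ge0_le_integral => //.
  - do 2 apply: measurableT_comp => //.
    by apply: measurable_funTS; exact: measurable_levy_weight.
  - apply: emeasurable_funD.
      by apply/measurable_EFinP; apply: measurable_minr; meas.
    apply: ge0_emeasurable_sum => // k _.
    by apply: measurable_funTS; exact: measurable_block.
  - move=> y; rewrite /neg /= in_itv/= => y0.
    by rewrite ger0_norm ?levy_weight_ge0//; exact: weight_le.
rewrite ge0_integralD//; first last.
- apply: ge0_emeasurable_sum => // k _.
  by apply: measurable_funTS; exact: measurable_block.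
- by move=> y _; exact: nneseries_ge0.
- by apply/measurable_EFinP; apply: measurable_minr; meas.
- by move=> y _; rewrite lee_fin le_min ler01 sqr_ge0.
apply: lte_add_pinfty.
  case: semi => -[_ h] _ _; apply: le_lt_trans h.
  apply: ge0_subset_integral => //.
  - by apply/measurable_EFinP; apply: measurable_minr; meas.
  - by move=> y _; rewrite lee_fin le_min ler01 sqr_ge0.
rewrite integral_nneseries//; last first.
  by move=> n; apply: measurable_funTS; exact: measurable_block.
under eq_eseriesr do rewrite integral_block.
have q1 : `|L / c| < 1.
  rewrite ger0_norm ?divr_ge0 ?(ltW L0) ?(ltW c0)// ltr_pdivrMr// mul1r.
  exact: ratio_lt.
have cv := cvg_geometric_series (a := L * tl 1) q1.
rewrite (_ : (\sum_(n <oo) _)%E = (L * tl 1 * (1 - L / c)^-1)%:E) ?ltry//.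
apply/cvg_lim => //.
rewrite (_ : (fun n => _) = EFin \o series (geometric (L * tl 1) (L / c))).
  by apply: cvg_EFin => //; exact: nearW.
by apply/funext => n; rewrite /= /series/= -sumEFin.
Qed.

(** Self-similarity: dilating [phi] by the factor [c `^ alpha^-1] multiplies
    its tails, hence the measure itself, by [c]. *)
Lemma semistable_scaling (f : R -> R) : measurable_fun setT f ->
  (forall y, 0 <= f y) ->
  \int[phi]_(y in @neg R) f (L * y) = c * \int[phi]_(y in @neg R) f y.
Proof.
move=> mf f0; have mn := @measurable_neg R.
have mL : measurable_fun setT (fun y : measurableTypeR R => (L * y : measurableTypeR R)).
  by meas.
pose m1' := [the {measure set (measurableTypeR R) -> \bar R} of
  pushforward phi (fun y : measurableTypeR R => (L * y : measurableTypeR R))].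
pose m1 := m1' mL.
pose m2 : {measure set (measurableTypeR R) -> \bar R} :=
  [the measure _ _ of mscale (NngNum (ltW c0)) phi].
have E A : measurable A -> A `<=` @neg R -> m1 A = m2 A.
  apply: measure_neg_unique => x x0; have xL : 0 < x / L by rewrite divr_gt0.
    transitivity (phi (ray (x / L))).
      congr (phi _); apply/seteqP; split => y; rewrite /ray /= !in_itv/=.
        by rewrite -mulNr ltr_pdivlMr// mulrC.
      by rewrite -mulNr ltr_pdivlMr// mulrC.
    rewrite /m2 /= /mscale /= !semistable_ray// -EFinM; congr (_%:E).
    have := tail_scaling alpha12 c1 adm xL.
    by rewrite mulrCA divff ?gt_eqF// mulr1 => ->; rewrite mulVKf// gt_eqF.
  rewrite (_ : m1 (ray x) = phi (ray (x / L))); first by rewrite semistable_ray// ltry.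
  congr (phi _); apply/seteqP; split => y; rewrite /ray /= !in_itv/=.
    by rewrite -mulNr ltr_pdivlMr// mulrC.
  by rewrite -mulNr ltr_pdivlMr// mulrC.
have mfn : measurable_fun (@neg R) (EFin \o f).
  by apply/measurable_EFinP; exact: measurable_funTS.
have := ge0_integral_pushforward mL phi mn mfn.
rewrite (eq_measure_integral m2 (m1 := m1)); last by move=> A mA /E ->.
rewrite ge0_integral_mscale//; last by move=> y _; rewrite lee_fin.
rewrite (_ : _ @^-1` _ = @neg R); last first.
  apply/seteqP; split => y; rewrite /neg /= !in_itv/=.
    by rewrite pmulr_rlt0.
  by rewrite pmulr_rlt0.
move=> H; rewrite /Rintegral.
rewrite (_ : (\int[phi]_(y in @neg R) (f (L * y))%:E =
  c%:E * \int[phi]_(y in @neg R) (f y)%:E)%E); last first.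
  by rewrite H//; move=> y _; rewrite lee_fin.
case: (\int[phi]_(y in @neg R) (f y)%:E)%E => [r| |] //=.
  by rewrite gt0_muley ?lte_fin//= mulr0.
by rewrite gt0_muleNy ?lte_fin//= mulr0.
Qed.

End semistable_measure.

(** The rays have the measures prescribed by [theta], so [measure_neg_unique]
    applies; this is why [g] and [f] depend on [c], [alpha] and [theta] only. *)
Lemma semistable_measure_unique (R : realType) (alpha : R) theta
    (phi1 phi2 : {measure set (measurableTypeR R) -> \bar R}) (f : R -> R) :
  semistable_levy_measure alpha theta phi1 ->
  semistable_levy_measure alpha theta phi2 ->
  \int[phi1]_(y in @neg R) f y = \int[phi2]_(y in @neg R) f y.
Proof.
move=> s1 s2; rewrite /Rintegral; congr fine.
apply: eq_measure_integral => A mA An.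
apply: measure_neg_unique mA An => x x0.
  by rewrite (semistable_ray s1)// (semistable_ray s2).
by rewrite (semistable_ray s1)// ltry.
Qed.

(** * The characteristic and the Laplace exponent *)

Section compensated_kernels.
Context (R : realType).

(** Second-order Taylor bound for compensated increments, to the left of [x]:
    the mean value theorem once controls large increments, and twice the small
    ones. *)
Lemma compensated_le (f f1 f2 : R -> R) (x y A B : R) : y < 0 ->
  (forall z, z <= x -> is_derive z 1 f (f1 z)) ->
  (forall z, z <= x -> is_derive z 1 f1 (f2 z)) ->
  (forall z, z <= x -> `|f1 z| <= A) -> (forall z, z <= x -> `|f2 z| <= B) ->
  `|f (x + y) - f x - y * f1 x| <= (2 * A + B) * levy_weight y.
Proof.
move=> y0 df df1 fA fB.
have xy : x + y < x by lra.
have cf (g g' : R -> R) (u v : R) : v <= x ->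
    (forall z, z <= x -> is_derive z 1 g (g' z)) ->
    {within `[u, v], continuous g}.
  move=> vx dg; apply: derivable_within_continuous => z.
  rewrite in_itv/= => /andP[_ zv].
  by have := dg z (le_trans zv vx); move=> [].
have [z zxy fE] : exists2 z, z \in `](x + y), x[ & f x - f (x + y) = f1 z * (x - (x + y)).
  apply: MVT => //; last exact: cf df.
  by move=> z; rewrite in_itv/= => /andP[_ /ltW]; exact: df.
move: zxy; rewrite in_itv/= => /andP[z1 z2].
have [w wzx f1E] : exists2 w, w \in `]z, x[ & f1 x - f1 z = f2 w * (x - z).
  apply: MVT => //; last exact: cf df1.
  by move=> w; rewrite in_itv/= => /andP[_ /ltW]; exact: df1.
move: wzx; rewrite in_itv/= => /andP[w1 w2].
have E : f (x + y) - f x - y * f1 x = y * (f1 z - f1 x).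
  have -> : f (x + y) - f x = - (f x - f (x + y)) by rewrite opprB.
  by rewrite fE; ring.
have A0 : 0 <= A by apply: le_trans (fA x (lexx x)).
have B0 : 0 <= B by apply: le_trans (fB x (lexx x)).
have d1 : `|f1 z - f1 x| <= 2 * A.
  rewrite (le_trans (ler_normB _ _))//.
  by have := fA z (ltW z2); have := fA x (lexx x); lra.
have d2 : `|f1 z - f1 x| <= B * `|y|.
  rewrite distrC f1E normrM ler_pM//; first by apply: fB; exact: ltW.
  by rewrite (ltr0_norm y0) ger0_norm ?subr_ge0; lra.
rewrite E normrM mulrC.
rewrite /levy_weight; have [yy|yy] := leP (y ^+ 2) `|y|.
  apply: le_trans (ler_wpM2r (normr_ge0 y) d2) _.
  rewrite -mulrA -expr2 real_normK ?num_real// ler_wpM2r ?sqr_ge0//; lra.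
by rewrite ler_wpM2r//; lra.
Qed.

Lemma cos_compensated_le (k y : R) : y < 0 ->
  `|cos (k * y) - 1| <= (2 * `|k| + k ^+ 2) * levy_weight y.
Proof.
move=> y0.
have H := @compensated_le (fun z => cos (k * z)) (fun z => - (k * sin (k * z)))
  (fun z => - (k ^+ 2 * cos (k * z))) 0 y `|k| (k ^+ 2) y0 _ _ _ _.
move: H; rewrite add0r !mulr0 cos0 sin0 mulr0 oppr0 mulr0 subr0; apply.
- by move=> z _; deriv.
- by move=> z _; deriv.
- by move=> z _; rewrite normrN; exact: sinM_le1.
- move=> z _; rewrite normrN (le_trans (cosM_le1 _ _))//.
  by rewrite ger0_norm// sqr_ge0.
Qed.

Lemma sin_compensated_le (k y : R) : y < 0 ->
  `|sin (k * y) - k * y| <= (2 * `|k| + k ^+ 2) * levy_weight y.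
Proof.
move=> y0.
have H := @compensated_le (fun z => sin (k * z)) (fun z => k * cos (k * z))
  (fun z => - (k ^+ 2 * sin (k * z))) 0 y `|k| (k ^+ 2) y0 _ _ _ _.
move: H; rewrite add0r !mulr0 cos0 sin0 subr0 mulr1 (mulrC y); apply.
- by move=> z _; deriv.
- by move=> z _; deriv.
- by move=> z _; exact: cosM_le1.
- move=> z _; rewrite normrN (le_trans (sinM_le1 _ _))//.
  by rewrite ger0_norm// sqr_ge0.
Qed.

Lemma expR_compensated_le (l y : R) : 0 <= l -> y < 0 ->
  `|expR (l * y) - 1 - l * y| <= (2 * l + l ^+ 2) * levy_weight y.
Proof.
move=> l0 y0.
have H := @compensated_le (fun z => expR (l * z)) (fun z => l * expR (l * z))
  (fun z => l ^+ 2 * expR (l * z)) 0 y l (l ^+ 2) y0 _ _ _ _.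
have le1 z : z <= 0 -> expR (l * z) <= 1.
  by move=> z0; rewrite -[leRHS]expR0 ler_expR mulr_ge0_le0.
move: H; rewrite add0r !mulr0 expR0 mulr1 (mulrC y); apply.
- by move=> z _; deriv.
- by move=> z _; deriv.
- move=> z z0; rewrite normrM (ger0_norm l0) (ger0_norm (expR_ge0 _)).
  by rewrite ler_piMr// le1.
- move=> z z0; rewrite normrM (ger0_norm (sqr_ge0 _)) (ger0_norm (expR_ge0 _)).
  by rewrite ler_piMr ?sqr_ge0// le1.
Qed.

Lemma dexpR_compensated_le (l y : R) : 0 <= l -> y < 0 ->
  `|y * (expR (l * y) - 1)| <= (1 + l) * levy_weight y.
Proof.
move=> l0 y0.
have e1 : expR (l * y) <= 1.
  by rewrite -[leRHS]expR0 ler_expR mulr_ge0_le0// ltW.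
have e0 := expR_gt0 (l * y).
have ey := expR_ge1Dx (l * y).
have d : `|expR (l * y) - 1| = 1 - expR (l * y) by rewrite ler0_norm; lra.
rewrite normrM d /levy_weight; have [yy|yy] := leP (y ^+ 2) `|y|.
  rewrite -real_normK ?num_real// (ltr0_norm y0); nra.
by rewrite mulrC ler_wpM2r//; lra.
Qed.

End compensated_kernels.

Section exponents.
Context (R : realType).
Local Notation mu := (@lebesgue_measure R).
Variable phi : {measure set (measurableTypeR R) -> \bar R}.
Hypothesis iw : phi.-integrable (@neg R) (EFin \o @levy_weight R).

(** [psi k = psi_re k + i psi_im k], while [Psi l] is the value at [k = - i l]
    of the continuation of [psi] to the lower half-plane, which exists because
    the jumps are negative; [dPsi] is the derivative of [Psi]. *)
Definition psi_re (k : R) : R := \int[phi]_(y in @neg R) (cos (k * y) - 1).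
Definition psi_im (k : R) : R := \int[phi]_(y in @neg R) (sin (k * y) - k * y).
Definition Psi (l : R) : R := \int[phi]_(y in @neg R) (expR (l * y) - 1 - l * y).
Definition dPsi (l : R) : R := \int[phi]_(y in @neg R) (y * (expR (l * y) - 1)).

Let mn : measurable (@neg R : set (measurableTypeR R)).
Proof. exact: measurable_neg. Qed.

Let neg_lt0 (y : measurableTypeR R) : @neg R y -> (y : R) < 0.
Proof. by rewrite /neg /= in_itv. Qed.

Lemma integrable_weight_le (f : R -> R) (K : R) : measurable_fun setT f ->
  (forall y, y < 0 -> `|f y| <= K * levy_weight y) ->
  phi.-integrable (@neg R) (EFin \o f).
Proof.
move=> mf fK.
apply: (@dominated_integrable _ _ _ phi _ _ (fun y => K * levy_weight y)) => //.
- exact: measurable_funTS.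
- by apply: RintegrableZl => //; exact: measurable_neg.
Qed.

Lemma integrable_cos_compensated k :
  phi.-integrable (@neg R) (EFin \o (fun y => cos (k * y) - 1)).
Proof.
by apply: integrable_weight_le (cos_compensated_le k); meas.
Qed.

Lemma integrable_sin_compensated k :
  phi.-integrable (@neg R) (EFin \o (fun y => sin (k * y) - k * y)).
Proof.
by apply: integrable_weight_le (sin_compensated_le k); meas.
Qed.

Lemma integrable_expR_compensated l : 0 <= l ->
  phi.-integrable (@neg R) (EFin \o (fun y => expR (l * y) - 1 - l * y)).
Proof.
by move=> l0; apply: integrable_weight_le (fun y => expR_compensated_le l0); meas.
Qed.

Lemma integrable_dexpR_compensated l : 0 <= l ->
  phi.-integrable (@neg R) (EFin \o (fun y => y * (expR (l * y) - 1))).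
Proof.
by move=> l0; apply: integrable_weight_le (fun y => dexpR_compensated_le l0); meas.
Qed.

Let near_le (k x : R) : `|x - k| < 1 -> `|x| <= `|k| + 1.
Proof.
move=> xk; rewrite -[x](subrK k) (le_trans (ler_normD _ _))// addrC lerD2l.
exact: ltW.
Qed.

Let near_weight (k x : R) : `|x - k| < 1 ->
  2 * `|x| + x ^+ 2 <= 2 * (`|k| + 1) + (`|k| + 1) ^+ 2.
Proof.
move=> /near_le h; rewrite -(real_normK (num_real x)).
apply: lerD; first by rewrite ler_wpM2l.
by rewrite lerXn2r ?nnegrE// addr_ge0.
Qed.

Lemma continuous_psi_re : continuous psi_re.
Proof.
move=> k.
apply: (@continuous_Rintegral _ _ _ phi (@neg R) (fun k y => cos (k * y) - 1)
  (fun y => (2 * (`|k| + 1) + (`|k| + 1) ^+ 2) * levy_weight y) k 1) => //.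
- by move=> x _; meas.
- move=> x y _ _; apply: differentiable_continuous; apply/derivable1_diffP.
  by apply: ex_derive.
- by apply: RintegrableZl => //; exact: measurable_neg.
- move=> x y xk /neg_lt0 y0; apply: le_trans (cos_compensated_le x y0) _.
  by rewrite ler_wpM2r ?levy_weight_ge0// near_weight.
Qed.

Lemma continuous_psi_im : continuous psi_im.
Proof.
move=> k.
apply: (@continuous_Rintegral _ _ _ phi (@neg R) (fun k y => sin (k * y) - k * y)
  (fun y => (2 * (`|k| + 1) + (`|k| + 1) ^+ 2) * levy_weight y) k 1) => //.
- by move=> x _; meas.
- move=> x y _ _; apply: differentiable_continuous; apply/derivable1_diffP.
  by apply: ex_derive.
- by apply: RintegrableZl => //; exact: measurable_neg.
- move=> x y xk /neg_lt0 y0; apply: le_trans (sin_compensated_le x y0) _.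
  by rewrite ler_wpM2r ?levy_weight_ge0// near_weight.
Qed.

Lemma psi_re_le0 k : psi_re k <= 0.
Proof.
rewrite -oppr_ge0 -mulN1r /psi_re -RintegralZl//.
  by apply: Rintegral_ge0 => y _; rewrite mulN1r oppr_ge0 subr_le0 cos_le1.
exact: integrable_cos_compensated.
Qed.

Lemma is_derive_Psi (l : R) : 0 < l -> is_derive l 1 Psi (dPsi l).
Proof.
move=> l0.
have pos (x : R) : `|x - l| < l -> 0 < x by rewrite ltr_norml => /andP[? ?]; lra.
have ub (x : R) : `|x - l| < l -> x <= 2 * l by rewrite ltr_norml => /andP[? ?]; lra.
apply: (@is_derive_Rintegral _ _ _ phi (@neg R)
  (fun l y => expR (l * y) - 1 - l * y) (fun l y => y * (expR (l * y) - 1))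
  (fun y => (1 + 2 * l) * levy_weight y) l l) => //.
- by move=> x /pos/ltW; exact: integrable_expR_compensated.
- by move=> x y _ _; deriv.
- by apply: RintegrableZl => //; exact: measurable_neg.
- move=> x y xl /neg_lt0 y0; have x0 := ltW (pos _ xl).
  apply: le_trans (dexpR_compensated_le x0 y0) _.
  by rewrite ler_wpM2r ?levy_weight_ge0// lerD2l ub.
Qed.

Lemma continuous_dPsi (l : R) : 0 < l -> {for l, continuous dPsi}.
Proof.
move=> l0.
have pos (x : R) : `|x - l| < l -> 0 < x by rewrite ltr_norml => /andP[? ?]; lra.
have ub (x : R) : `|x - l| < l -> x <= 2 * l by rewrite ltr_norml => /andP[? ?]; lra.
apply: (@continuous_Rintegral _ _ _ phi (@neg R)
  (fun l y => y * (expR (l * y) - 1))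
  (fun y => (1 + 2 * l) * levy_weight y) l l) => //.
- by move=> x _; meas.
- move=> x y _ _; apply: differentiable_continuous; apply/derivable1_diffP.
  by apply: ex_derive.
- by apply: RintegrableZl => //; exact: measurable_neg.
- move=> x y xl /neg_lt0 y0; have x0 := ltW (pos _ xl).
  apply: le_trans (dexpR_compensated_le x0 y0) _.
  by rewrite ler_wpM2r ?levy_weight_ge0// lerD2l ub.
Qed.

Lemma Psi_ge0 l : 0 <= Psi l.
Proof.
apply: Rintegral_ge0 => y _.
by have := expR_ge1Dx (l * y); rewrite -subr_ge0 opprD addrA.
Qed.

Hypothesis ray0 : (0 < phi (ray 1))%E.
Hypothesis rayoo : (phi (ray 1) < +oo)%E.

(** Markov's inequality. *)
Lemma Rintegral_subset_ge (E : set R) (f : R -> R) (e : R) :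
  measurable (E : set (measurableTypeR R)) -> E `<=` @neg R ->
  (phi E < +oo)%E -> phi.-integrable (@neg R) (EFin \o f) ->
  (forall y, y < 0 -> 0 <= f y) -> (forall y, E y -> e <= f y) ->
  e * fine (phi E) <= \int[phi]_(y in @neg R) f y.
Proof.
move=> mE En Eoo fi f0 fe.
have fir : phi.-integrable E (EFin \o f) by exact: integrableS fi.
rewrite -Rintegral_cst//.
apply: (@le_trans _ _ (\int[phi]_(y in E) f y)).
  apply: le_Rintegral => //.
  by apply: measurable_bounded_integrable => //; exact: bounded_cst.
rewrite -[X in _ <= Rintegral _ X _](setDUK En).
rewrite Rintegral_setU//; last 2 first.
- by rewrite setDUK.
- by apply/disj_setPS => y [yr [_]].
- rewrite lerDl; apply: Rintegral_ge0 => y [/neg_lt0 y0 _]; exact: f0.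
exact: measurableD.
Qed.

Lemma dPsi_gt0 (l : R) : 0 < l -> 0 < dPsi l.
Proof.
move=> l0.
have e1 : 0 < 1 - expR (- l) by rewrite subr_gt0 -[ltRHS]expR0 ltr_expR oppr_lt0.
apply: (@lt_le_trans _ _ ((1 - expR (- l)) * fine (phi (ray 1)))).
  by rewrite mulr_gt0// fine_gt0// ray0.
apply: Rintegral_subset_ge => //.
- exact: measurable_ray.
- by move=> y; rewrite /ray /neg /= !in_itv/= => /lt_trans; apply; rewrite oppr_lt0.
- exact/integrable_dexpR_compensated/ltW.
- move=> y y0; rewrite mulr_le0// ?subr_le0; first exact: ltW.
  by rewrite -[leRHS]expR0 ler_expR pmulr_rle0// ltW.
- move=> y; rewrite /ray /= in_itv/= => y1.
  have : expR (l * y) <= expR (- l) by rewrite ler_expR; nra.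
  by nra.
Qed.

Lemma Psi_increasing (l l' : R) : 0 < l -> l < l' -> Psi l < Psi l'.
Proof.
move=> l0 ll.
have [z zl E] : exists2 z, z \in `]l, l'[ & Psi l' - Psi l = dPsi z * (l' - l).
  apply: MVT => //.
    by move=> z; rewrite in_itv/= => /andP[lz _]; apply: is_derive_Psi; lra.
  apply: derivable_within_continuous => z; rewrite in_itv/= => /andP[lz _].
  by have [] : is_derive z 1 Psi (dPsi z) by apply: is_derive_Psi; lra.
move: zl; rewrite in_itv/= => /andP[lz _].
rewrite -subr_gt0 E mulr_gt0 ?subr_gt0//; apply: dPsi_gt0; lra.
Qed.

Lemma Psi_gt0 (l : R) : 0 < l -> 0 < Psi l.
Proof.
move=> l0; apply: (le_lt_trans (Psi_ge0 (l / 2))).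
by apply: Psi_increasing; lra.
Qed.

Lemma Psi_inj (l l' : R) : 0 < l -> 0 < l' -> Psi l = Psi l' -> l = l'.
Proof.
move=> l0 l0' E; have [ll|ll|//] := ltgtP l l'.
  by have := Psi_increasing l0 ll; rewrite E ltxx.
by have := Psi_increasing l0' ll; rewrite E ltxx.
Qed.

End exponents.

(** * Growth of the characteristic exponent *)

Section power_majorant.
Context (R : realType).
Local Notation mu := (@lebesgue_measure R).
Variable a : R.
Hypothesis a1 : 1 < a.

(** [(1 + `|x|) ^ (- a)]. *)
Definition power_decay (x : R) : R := expR (- (a * ln (1 + `|x|))).

Let pos (x : R) : 0 < 1 + `|x|. Proof. by rewrite ltr_pwDl. Qed.

Lemma continuous_power_decay : continuous power_decay.
Proof.
move=> x; apply: continuous_comp; last exact: continuous_expR.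
apply: cvgN; apply: cvgMr.
apply: (@cvg_comp _ _ _ (fun x : R => 1 + `|x|) (@ln R) _ (nbhs (1 + `|x|))).
  by apply: cvgD; [exact: cvg_cst|exact: norm_continuous].
exact: continuous_ln.
Qed.

Lemma integrable_power_decay : mu.-integrable setT (EFin \o power_decay).
Proof.
have mp : measurable_fun setT power_decay.
  exact: continuous_measurable_fun continuous_power_decay.
apply/integrableP; split; first exact/measurable_EFinP.
under eq_integral => x _ do rewrite /= ger0_norm ?expR_ge0//.
rewrite ge0_symfun_integralT.
- rewrite (_ : [set x | _] = `[0, +oo[%classic); last first.
    by apply/seteqP; split => x /=; rewrite in_itv/= andbT.
  pose F (x : R) := - (a - 1)^-1 * expR (- ((a - 1) * ln (1 + x))).
  have d0 : 0 < a - 1 by rewrite subr_gt0.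
  have dF (x : R) : 0 <= x -> is_derive x 1 F (power_decay x).
    move=> x0; have x1 : 0 < 1 + x by lra.
    rewrite /power_decay (ger0_norm x0) /F.
    have dl : is_derive x 1 (fun x => ln (1 + x)) (1 + x)^-1.
      have h := is_derive1_ln x1.
      have := @is_derive1_comp _ (@ln R) (fun x => 1 + x) x (1 + x)^-1 1.
      rewrite mulr1; apply => //.
      by apply: is_derive_eq; rewrite add0r mulr1.
    apply: is_derive_eq; rewrite /GRing.scale /=.
    have -> : expR (- (a * ln (1 + x))) = expR (- ((a - 1) * ln (1 + x))) * (1 + x)^-1.
      rewrite -[X in X^-1]lnK ?posrE// -expRN -expRD; congr expR.
      by ring.
    by field; rewrite !gt_eqF.
  rewrite (@ge0_continuous_FTC2y _ power_decay F 0 0).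
  + by rewrite -EFinB -EFinM ltry.
  + by move=> x _; exact: expR_ge0.
  + exact: continuous_subspaceT continuous_power_decay.
  + apply/cvgrPdist_le => /= e e0.
    pose M := - ln ((a - 1) * e) / (a - 1).
    near=> x.
    have x0 : 0 <= x by near: x; exact: nbhs_pinfty_ge.
    have xM : expR M <= x by near: x; exact: nbhs_pinfty_ge.
    have lM : M <= ln (1 + x).
      by rewrite -[M]expRK ler_ln ?posrE ?expR_gt0//; lra.
    have i0 : 0 <= (a - 1)^-1 by rewrite invr_ge0 ltW.
    rewrite sub0r normrN /F normrM normrN (ger0_norm i0) (ger0_norm (expR_ge0 _)).
    rewrite mulrC ler_pdivrMr// mulrC.
    rewrite -[leRHS]lnK ?posrE ?mulr_gt0// ler_expR.
    rewrite (mulrC (ln _)) (mulrC e) lerNl; apply: (le_trans _ (ler_wpM2l (ltW d0) lM)).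
    by rewrite /M [leRHS]mulrCA divff ?gt_eqF// mulr1.
  + by move=> x x0; have [] := dF x (ltW x0).
  + apply: cvg_at_right_filter; apply: differentiable_continuous.
    by apply/derivable1_diffP; have [] := dF 0 (lexx _).
  + move=> x; rewrite in_itv/= andbT => x0; rewrite derive1E.
    by have h := dF x (ltW x0); rewrite derive_val.
- by move=> x; exact: expR_ge0.
- exact: continuous_power_decay.
- by move=> x; rewrite /power_decay /= normrN.
Unshelve. all: end_near. Qed.

(** Superlinear growth of the symbol [b] makes the resolvent integrable at
    infinity, and [s] keeps it bounded near [0]. *)
Lemma integrable_resolvent (b : R -> R) (s C : R) : 0 < s -> 0 < C ->
  measurable_fun setT b -> (forall k, 0 <= b k) ->
  (forall k, k != 0 -> C * expR (a * ln `|k|) <= b k) ->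
  mu.-integrable setT (EFin \o (fun k => (s + b k)^-1)).
Proof.
move=> s0 C0 mb b0 bC.
have a0 : 0 < a by exact: lt_trans a1.
pose K := expR (a * ln 2) * (s^-1 + C^-1).
have sb k : 0 < s + b k by rewrite ltr_pwDl.
apply: (@dominated_integrable _ _ _ mu _ _ (fun k => K * power_decay k)) => //.
- rewrite (_ : (fun k => _) = (fun k => expR (- ln (s + b k)))).
    apply: (measurableT_comp (@measurable_expR R)).
    apply: (measurableT_comp (@oppr_measurable _ setT)).
    by apply: (measurableT_comp (@measurable_ln R)); meas.
  by apply/funext => k; rewrite expRN lnK// posrE.
- by apply: RintegrableZl => //; exact: integrable_power_decay.
- move=> k _; have r0 : 0 <= (s + b k)^-1 by rewrite invr_ge0 ltW.
  rewrite (ger0_norm r0).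
  have i0 : 0 < s^-1 by rewrite invr_gt0.
  have j0 : 0 < C^-1 by rewrite invr_gt0.
  have -> : K * power_decay k = (s^-1 + C^-1) * expR (a * (ln 2 - ln (1 + `|k|))).
    by rewrite /K /power_decay mulrAC mulrC -expRD; congr (_ * expR _); ring.
  have [k1|k1] := leP `|k| 1.
    apply: (@le_trans _ _ (s^-1 * 1)).
      by rewrite mulr1 lef_pV2 ?posrE// lerDl.
    apply: ler_pM => //; [exact: ltW|by rewrite lerDl ltW|].
    rewrite -[leLHS]expR0 ler_expR; apply: mulr_ge0; first exact: ltW.
    rewrite subr_ge0 ler_ln ?posrE//.
    by have := normr_ge0 k; lra.
  have k0 : k != 0 by rewrite -normr_gt0; lra.
  have kp : 0 < `|k| by rewrite normr_gt0.
  apply: (@le_trans _ _ (C^-1 * expR (- (a * ln `|k|)))).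
    rewrite expRN -invfM lef_pV2 ?posrE ?mulr_gt0 ?expR_gt0//.
    by rewrite (le_trans (bC k k0))// lerDr ltW.
  apply: ler_pM; [exact: ltW|exact: expR_ge0|by rewrite lerDr ltW|].
  rewrite ler_expR -mulrN ler_pM2l// lerNl opprB lerBlDr -lnM ?posrE//.
  by rewrite ler_ln ?posrE ?mulr_gt0//; lra.
Qed.

End power_majorant.

Section semistable_exponent.
Context (R : realType).
Local Notation mu := (@lebesgue_measure R).
Variables (alpha c : R) (theta : R -> R).
Hypotheses (alpha12 : 1 < alpha < 2) (c1 : 1 < c).
Hypothesis adm : admissible c alpha theta.
Variable phi : {measure set (measurableTypeR R) -> \bar R}.
Hypothesis semi : semistable_levy_measure alpha theta phi.
Local Notation L := (ratio alpha c).
Local Notation tl := (tail alpha theta).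

Let c0 : 0 < c. Proof. exact: lt_trans c1. Qed.

Let L1 : 1 < L. Proof. exact: ratio_gt1 alpha12 c1. Qed.

Let L0 : 0 < L. Proof. exact: lt_trans L1. Qed.

Let iw : phi.-integrable (@neg R) (EFin \o @levy_weight R).
Proof. exact: (integrable_levy_weight alpha12 c1 adm semi). Qed.

(** The real part of the characteristic exponent has order [alpha]: on the
    ring where [`|k y|] lies between [L^-1] and [1] the function
    [1 - cos (k y)] is bounded below, and the ring has mass of order
    [`|k| ^ alpha]. *)
Lemma psi_re_growth : exists2 C, 0 < C &
  forall k, k != 0 -> C * expR (alpha * ln `|k|) <= - psi_re phi k.
Proof.
have [t0 t00 tt] := theta_lower_bound alpha12 c1 adm.
pose e : R := 1 - cos L^-1.
have Li0 : 0 < L^-1 by rewrite invr_gt0.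
have Li1 : L^-1 < 1 by rewrite invf_lt1.
have p2 := @pi_ge2 R.
have e0 : 0 < e.
  by rewrite subr_gt0 -[ltRHS](@cos0 R) ltr_cos ?in_itv//= ?lexx ?ltW//; lra.
exists (e * (c - 1) * t0).
  by rewrite !mulr_gt0// subr_gt0.
move=> k k0; have kp : 0 < `|k| by rewrite normr_gt0.
pose x := `|k|^-1.
have x0 : 0 < x by rewrite invr_gt0.
have xL0 : 0 < x / L by rewrite divr_gt0.
have mx := @measurable_ray R x.
have mxL := @measurable_ray R (x / L).
pose E : set R := ray (x / L) `\` ray x.
have phE : fine (phi E) = (c - 1) * tl x.
  have fin : (phi (ray (x / L)) < +oo)%E by rewrite (semistable_ray semi xL0) ltry.
  have D : phi E = (phi (ray (x / L)) - phi (ray (x / L) `&` ray x))%E.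
    exact: measureD.
  rewrite setIidr in D; last first.
    move=> y; rewrite /ray /= !in_itv/= => /lt_le_trans; apply.
    by rewrite lerN2 ler_pdivrMr// ler_peMr// ltW.
  transitivity (fine (phi (ray (x / L)) - phi (ray x))); first by congr fine; exact: D.
  rewrite (semistable_ray semi xL0) (semistable_ray semi x0) /= mulrBl mul1r.
  congr (_ - _); have := tail_scaling alpha12 c1 adm xL0.
  by rewrite mulrCA divff ?gt_eqF// mulr1 => ->; rewrite mulVKf// gt_eqF.
have tx : expR (alpha * ln `|k|) * t0 <= tl x.
  rewrite /tail /powR gt_eqF// mulNr -mulrN -lnV ?posrE// invrK.
  by rewrite ler_wpM2l// expR_ge0.
have H : e * fine (phi E) <= - psi_re phi k.
  rewrite -mulN1r /psi_re -RintegralZl//; [|exact: measurable_neg|exact: integrable_cos_compensated].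
  apply: Rintegral_subset_ge => //.
  - exact: measurableD.
  - move=> y [+ _]; rewrite /ray /neg /= !in_itv/= => /lt_trans; apply.
    by rewrite oppr_lt0.
  - apply: (@le_lt_trans _ _ (phi (ray (x / L)))).
      by apply: le_measure; rewrite ?inE//; [exact: measurableD|exact: subDsetl].
    by rewrite (semistable_ray semi xL0) ltry.
  - by apply: RintegrableZl; [exact: measurable_neg|exact: integrable_cos_compensated].
  - move=> y; rewrite /E /ray /= !in_itv/= => -[y1 /negP]; rewrite -leNgt => y2.
    rewrite mulN1r opprB lerD2l lerN2 -cos_norm normrM.
    have ny : `|y| = - y by rewrite ltr0_norm// (lt_trans y1)// oppr_lt0.
    have h1 : L^-1 <= `|k| * `|y|.
      by rewrite mulrC -ler_pdivrMr// ny lerNr mulrC ltW.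
    have h2 : `|k| * `|y| <= 1.
      by rewrite mulrC -ler_pdivlMr// mul1r ny lerNl.
    rewrite le_eqVlt in h1; case/predU1P : h1 => [<-//|h1].
    apply/ltW; rewrite ltr_cos ?in_itv//=; apply/andP; split; lra.
have c10 : 0 <= c - 1 by rewrite subr_ge0 ltW.
apply: le_trans H; rewrite phE -!mulrA.
apply: ler_wpM2l; first exact: ltW.
by rewrite ler_wpM2l// mulrC.
Qed.

Lemma integrable_psi_resolvent (s : R) : 0 < s ->
  mu.-integrable setT (EFin \o (fun k => (s - psi_re phi k)^-1)).
Proof.
move=> s0; have [C C0 HC] := psi_re_growth.
have a1 : 1 < alpha by case/andP: alpha12.
apply: (integrable_resolvent a1 s0 C0 _ _ HC).
- apply: (measurableT_comp (@oppr_measurable _ setT)).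
  exact: continuous_measurable_fun (continuous_psi_re iw).
- by move=> k; rewrite oppr_ge0 psi_re_le0.
Qed.

Lemma semistable_ray1_gt0 : (0 < phi (ray 1))%E.
Proof. by rewrite (semistable_ray semi ltr01) lte_fin (tail_gt0 adm). Qed.

Lemma semistable_ray1_lty : (phi (ray 1) < +oo)%E.
Proof. by rewrite (semistable_ray semi ltr01) ltry. Qed.

(** Self-similarity of the exponent; it makes [Psi] unbounded, hence surjective,
    and is the source of the periodicity of [g]. *)
Lemma Psi_scaling l : Psi phi (L * l) = c * Psi phi l.
Proof.
rewrite /Psi -(semistable_scaling alpha12 c1 adm semi).
- by apply: eq_Rintegral => y _; rewrite mulrA (mulrC l).
- by meas.
- by move=> y; have := expR_ge1Dx (l * y); rewrite -subr_ge0 opprD addrA.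
Qed.

Let Psi_pow n l : Psi phi (L ^+ n * l) = c ^+ n * Psi phi l.
Proof.
elim: n => [|n IH]; first by rewrite !expr0 !mul1r.
by rewrite exprS -mulrA Psi_scaling IH mulrA -exprS.
Qed.

Lemma Psi_surjective (s : R) : 0 < s -> exists2 q, 0 < q & Psi phi q = s.
Proof.
move=> s0.
have P1 : 0 < Psi phi 1 by apply: Psi_gt0 => //; [exact: semistable_ray1_gt0|exact: semistable_ray1_lty].
have [n hn] := exprn_unbounded (s / Psi phi 1) c1.
have [m hm] := exprn_unbounded (Psi phi 1 / s) c1.
pose u := L ^- m; pose v := L ^+ n.
have u0 : 0 < u by rewrite invr_gt0 exprn_gt0.
have v0 : 0 < v by rewrite exprn_gt0.
have Pv : s <= Psi phi v by rewrite /v -[_ ^+ n]mulr1 Psi_pow -ler_pdivrMr.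
have Pu : Psi phi u <= s.
  have : Psi phi (L ^+ m * u) = c ^+ m * Psi phi u by exact: Psi_pow.
  rewrite /u divff ?gt_eqF ?exprn_gt0// => E.
  rewrite -(ler_pM2l (_ : 0 < c ^+ m)) ?exprn_gt0// -E.
  by rewrite -ler_pdivrMr.
have uv : u <= v.
  by rewrite (@le_trans _ _ 1)// ?invf_le1 ?exprn_gt0// exprn_ege1// ltW.
have cP : {within `[u, v], continuous (Psi phi)}.
  apply: derivable_within_continuous => z; rewrite in_itv/= => /andP[uz _].
  by have [] := is_derive_Psi iw (lt_le_trans u0 uz).
have Ps : Num.min (Psi phi u) (Psi phi v) <= s <= Num.max (Psi phi u) (Psi phi v).
  by rewrite ge_min Pu/= le_max Pv orbT.
have [q + qs] := IVT uv cP Ps.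
by rewrite in_itv/= => /andP[uq _]; exists q => //; exact: lt_le_trans uq.
Qed.

End semistable_exponent.

(** * The inverse of the Laplace exponent and its periodic factor *)

(** The inverse of [Psi] on the positive half-line. *)
Definition Phi (R : realType) (phi : {measure set (measurableTypeR R) -> \bar R})
    (s : R) : R := xget 1 [set q | 0 < q /\ Psi phi q = s].

Section inverse_exponent.
Context (R : realType).
Variables (alpha c : R) (theta : R -> R).
Hypotheses (alpha12 : 1 < alpha < 2) (c1 : 1 < c).
Hypothesis adm : admissible c alpha theta.
Variable phi : {measure set (measurableTypeR R) -> \bar R}.
Hypothesis semi : semistable_levy_measure alpha theta phi.
Local Notation L := (ratio alpha c).

Let iw : phi.-integrable (@neg R) (EFin \o @levy_weight R).
Proof. exact: (integrable_levy_weight alpha12 c1 adm semi). Qed.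

Let ray0 := semistable_ray1_gt0 adm semi.
Let rayoo := semistable_ray1_lty semi.

Let PhiP s : 0 < s -> 0 < Phi phi s /\ Psi phi (Phi phi s) = s.
Proof.
move=> s0; have [q q0 qs] := Psi_surjective alpha12 c1 adm semi s0.
exact: (@xgetPex _ 1 [set q | 0 < q /\ Psi phi q = s] (ex_intro _ q (conj q0 qs))).
Qed.

Lemma Phi_gt0 s : 0 < s -> 0 < Phi phi s. Proof. by case/PhiP. Qed.

Lemma PhiK s : 0 < s -> Psi phi (Phi phi s) = s. Proof. by case/PhiP. Qed.

Lemma PsiK q : 0 < q -> Phi phi (Psi phi q) = q.
Proof.
move=> q0; have P0 := Psi_gt0 iw ray0 rayoo q0.
by apply: (Psi_inj iw ray0 rayoo) => //; [exact: Phi_gt0|exact: PhiK].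
Qed.

Lemma is_derive_Phi (s : R) : 0 < s ->
  is_derive s 1 (Phi phi) (dPsi phi (Phi phi s))^-1.
Proof.
move=> s0; rewrite -{1}(PhiK s0).
have q0 := Phi_gt0 s0.
apply: is_derive_inverse.
- by near=> q; apply: PsiK; near: q; exact: lt_nbhsr.
- near=> q; apply: differentiable_continuous; apply/derivable1_diffP.
  have q1 : 0 < q by near: q; exact: lt_nbhsr.
  by have [] := is_derive_Psi iw q1.
- exact: is_derive_Psi.
- by rewrite gt_eqF// dPsi_gt0.
Unshelve. all: end_near. Qed.

Lemma Phi_scaling s : 0 < s -> Phi phi (c * s) = L * Phi phi s.
Proof.
move=> s0; have q0 := Phi_gt0 s0.
rewrite -{1}(PhiK s0) -(Psi_scaling alpha12 c1 adm semi) PsiK// mulr_gt0//.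
exact: lt_trans (ratio_gt1 alpha12 c1).
Qed.

(** The periodic factor of the inverse exponent, in logarithmic coordinates. *)
Definition periodic_factor (u : R) : R := expR (- (u / alpha)) * Phi phi (expR u).

Lemma periodic_factor_periodic : periodic periodic_factor (ln c).
Proof.
move=> u; have c0 : 0 < c by exact: lt_trans c1.
rewrite /periodic_factor expRD lnK ?posrE// mulrC (mulrC (expR u)) Phi_scaling ?expR_gt0//.
rewrite [RHS]mulrC mulrAC mulrC; congr (_ * _).
rewrite /ratio /powR gt_eqF// -expRD; congr expR.
by rewrite mulrDl opprD (mulrC _ (ln c)) addrCA subrr addr0.
Qed.

Definition dperiodic_factor (u : R) : R :=
  expR (- (u / alpha)) *
    (expR u / dPsi phi (Phi phi (expR u)) - Phi phi (expR u) / alpha).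

Lemma is_derive_periodic_factor (u : R) :
  is_derive u 1 periodic_factor (dperiodic_factor u).
Proof.
have dF : is_derive u 1 (fun u => Phi phi (expR u))
    ((dPsi phi (Phi phi (expR u)))^-1 * expR u).
  have h := is_derive_Phi (expR_gt0 u).
  exact: (@is_derive1_comp _ (Phi phi) (@expR R) u _ _ h (is_derive_expR u)).
have a0 : alpha != 0 by case/andP: alpha12 => a1 _; rewrite gt_eqF// (lt_trans _ a1).
rewrite /periodic_factor; apply: is_derive_eq; rewrite /GRing.scale /= /dperiodic_factor.
by rewrite !mulr0 !add0r !mulr1; ring.
Qed.

Lemma continuously_differentiable_periodic_factor :
  continuously_differentiable periodic_factor.
Proof.
split; first by move=> u; have [] := is_derive_periodic_factor u.
rewrite (_ : derive1 _ = dperiodic_factor); last first.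
  apply/funext => u; rewrite derive1E.
  by have h := is_derive_periodic_factor u; rewrite derive_val.
have cF u : {for u, continuous (fun u => Phi phi (expR u))}.
  apply: continuous_comp; first exact: continuous_expR.
  apply: differentiable_continuous; apply/derivable1_diffP.
  by have [] := is_derive_Phi (expR_gt0 u).
move=> u; rewrite /dperiodic_factor.
have q0 := Phi_gt0 (expR_gt0 u).
apply: cvgM.
  apply: continuous_comp; last exact: continuous_expR.
  by apply: cvgN; apply: cvgMl; exact: cvg_id.
apply: cvgB; last by apply: cvgMl; exact: cF.
apply: cvgM; first exact: continuous_expR.
apply: cvgV; first by rewrite gt_eqF// dPsi_gt0.
apply: (@cvg_comp _ _ _ (fun u => Phi phi (expR u)) (dPsi phi) _ (nbhs (Phi phi (expR u)))).
  exact: cF.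
exact: continuous_dPsi.
Qed.

Lemma Phi_periodic_factor s : 0 < s ->
  s `^ alpha^-1 * periodic_factor (ln s) = Phi phi s.
Proof.
move=> s0; rewrite /periodic_factor lnK ?posrE// mulrA /powR gt_eqF//.
by rewrite -expRD mulrC (mulrC _ (ln s)) subrr expR0 mulr1.
Qed.

End inverse_exponent.

(** * The resolvent density and its smoothed equation *)

Section resolvent.
Context (R : realType).
Local Notation mu := (@lebesgue_measure R).
Variable phi : {measure set (measurableTypeR R) -> \bar R}.
Hypothesis sf : sigma_finite setT phi.
Hypothesis iw : phi.-integrable (@neg R) (EFin \o @levy_weight R).
Variable s : R.
Hypothesis s0 : 0 < s.
Hypothesis ires : mu.-integrable setT (EFin \o (fun k => (s - psi_re phi k)^-1)).
Local Notation A := (psi_re phi).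
Local Notation B := (psi_im phi).

(** Real and imaginary part of [1 / (s - psi k)]. *)
Definition res_re (k : R) : R := (s - A k) / ((s - A k) ^+ 2 + B k ^+ 2).
Definition res_im (k : R) : R := B k / ((s - A k) ^+ 2 + B k ^+ 2).

Let pi2 : 0 < 2 * pi :> R. Proof. by rewrite mulr_gt0// pi_gt0. Qed.

Lemma sA_ge k : s <= s - A k.
Proof. by rewrite lerBrDr gerDl psi_re_le0. Qed.

Lemma sA_gt0 k : 0 < s - A k. Proof. exact: lt_le_trans s0 (sA_ge k). Qed.

Let den_gt0 k : 0 < (s - A k) ^+ 2 + B k ^+ 2.
Proof. by rewrite ltr_pwDl ?sqr_ge0// exprn_gt0// sA_gt0. Qed.

Let mA : measurable_fun setT A.
Proof. exact: continuous_measurable_fun (continuous_psi_re iw). Qed.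

Let mB : measurable_fun setT B.
Proof. exact: continuous_measurable_fun (continuous_psi_im iw). Qed.

Let mden : measurable_fun setT (fun k => ((s - A k) ^+ 2 + B k ^+ 2)^-1).
Proof.
rewrite (_ : (fun k => _) = (fun k => expR (- ln ((s - A k) ^+ 2 + B k ^+ 2)))).
  apply: (measurableT_comp (@measurable_expR R)).
  apply: (measurableT_comp (@oppr_measurable _ setT)).
  by apply: (measurableT_comp (@measurable_ln R)); meas.
by apply/funext => k; rewrite expRN lnK// posrE.
Qed.

Lemma measurable_res_re : measurable_fun setT res_re.
Proof. by apply: measurable_funM => //; meas. Qed.

Lemma measurable_res_im : measurable_fun setT res_im.
Proof. by apply: measurable_funM => //; meas. Qed.

Lemma res_re_le k : `|res_re k| <= (s - A k)^-1.
Proof.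
have r0 := sA_gt0 k; have d0 := den_gt0 k.
rewrite /res_re ger0_norm; last by rewrite divr_ge0 ?ltW.
rewrite ler_pdivrMr// mulrDr expr2 mulKf ?gt_eqF// lerDl.
by rewrite mulr_ge0 ?sqr_ge0// invr_ge0 ltW.
Qed.

Lemma res_im_le k : `|res_im k| <= (s - A k)^-1.
Proof.
have r0 := sA_gt0 k; have d0 := den_gt0 k.
rewrite /res_im normrM normfV (gtr0_norm d0) ler_pdivrMr// mulrC ler_pdivlMr//.
rewrite -(real_normK (num_real (B k))).
move: (normr_ge0 (B k)) r0; move: (s - A k) `|B k| => r b b0 r0.
have : 0 <= (r - b) ^+ 2 by exact: sqr_ge0.
by have := mulr_ge0 b0 (ltW r0); nra.
Qed.

Lemma integrable_res_re : mu.-integrable setT (EFin \o res_re).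
Proof.
apply: (@dominated_integrable _ _ _ mu _ _ (fun k => (s - A k)^-1)) => //.
  exact: measurable_res_re.
by move=> k _; exact: res_re_le.
Qed.

Lemma integrable_res_im : mu.-integrable setT (EFin \o res_im).
Proof.
apply: (@dominated_integrable _ _ _ mu _ _ (fun k => (s - A k)^-1)) => //.
  exact: measurable_res_im.
by move=> k _; exact: res_im_le.
Qed.

(** The real part of [(s - psi) / (s - psi) * (x - i y) = x - i y], the form in
    which the resolvent enters [smooth_resolvent_equation]. *)
Lemma resolvent_eq (k x y : R) :
  s * (res_re k * x + res_im k * y) -
    (res_re k * (x * A k + y * B k) + res_im k * (y * A k - x * B k)) = x.
Proof. by rewrite /res_re /res_im; field; rewrite gt_eqF. Qed.

(** The resolvent density, as a Fourier integral. *)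
Definition resolvent_density (x : R) : R :=
  (2 * pi)^-1 * trig_integral res_re res_im x.

Lemma resolvent_density_bounded : exists M, forall x, `|resolvent_density x| <= M.
Proof.
exists ((2 * pi)^-1 * \int[mu]_k (`|res_re k| + `|res_im k|)) => x.
rewrite /resolvent_density normrM ger0_norm ?invr_ge0; last exact: ltW.
apply: ler_wpM2l; first by rewrite invr_ge0 ltW.
exact: (trig_integral_le integrable_res_re integrable_res_im x).
Qed.

Lemma continuous_resolvent_density : continuous resolvent_density.
Proof.
move=> x; apply: cvgMr.
exact: (continuous_trig_integral integrable_res_re integrable_res_im).
Qed.

Section smoothing.
Variable w : R.
Hypothesis w0 : 0 < w.

Let m1 k := gauss w k * res_re k.
Let m2 k := gauss w k * res_im k.

Let sV0 : 0 < s^-1. Proof. by rewrite invr_gt0. Qed.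

Let res_re_sV k : `|res_re k| <= s^-1.
Proof. by apply: (le_trans (res_re_le k)); rewrite lef_pV2 ?posrE ?sA_gt0// sA_ge. Qed.

Let res_im_sV k : `|res_im k| <= s^-1.
Proof. by apply: (le_trans (res_im_le k)); rewrite lef_pV2 ?posrE ?sA_gt0// sA_ge. Qed.

Let integrable_moment (f : R -> R) (K : R) : measurable_fun setT f ->
  (forall k, `|f k| <= K * (1 + k ^+ 2)) ->
  mu.-integrable setT (EFin \o (fun k => f k * gauss w k)).
Proof.
move=> mf fK; have := @integrable_gauss_moment R w 0 f K w0 mf.
have E : (fun x => f x * gauss w (x - 0)) = (fun k => f k * gauss w k).
  by apply/funext => k; rewrite subr0.
by rewrite E; apply => k; rewrite subr0.
Qed.

Let moment1 (k : R) : 1 <= 1 + k ^+ 2. Proof. by rewrite lerDl sqr_ge0. Qed.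

Let momentk (k : R) : `|k| <= 1 + k ^+ 2.
Proof.
by rewrite -(real_normK (num_real k)); have := normr_ge0 k; nra.
Qed.

Let i1 : mu.-integrable setT (EFin \o m1).
Proof.
have -> : m1 = (fun k => res_re k * gauss w k) by apply/funext => k; rewrite /m1 mulrC.
apply: (@integrable_moment _ s^-1); first exact: measurable_res_re.
by move=> k; rewrite (le_trans (res_re_sV k))// ler_peMr ?moment1// ltW.
Qed.

Let i2 : mu.-integrable setT (EFin \o m2).
Proof.
have -> : m2 = (fun k => res_im k * gauss w k) by apply/funext => k; rewrite /m2 mulrC.
apply: (@integrable_moment _ s^-1); first exact: measurable_res_im.
by move=> k; rewrite (le_trans (res_im_sV k))// ler_peMr ?moment1// ltW.
Qed.

Let ik1 : mu.-integrable setT (EFin \o (fun k => k * m1 k)).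
Proof.
have -> : (fun k => k * m1 k) = (fun k => (k * res_re k) * gauss w k).
  by apply/funext => k; rewrite /m1; ring.
apply: (@integrable_moment _ s^-1).
  by apply: measurable_funM => //; exact: measurable_res_re.
by move=> k; rewrite normrM mulrC ler_pM.
Qed.

Let ik2 : mu.-integrable setT (EFin \o (fun k => k * m2 k)).
Proof.
have -> : (fun k => k * m2 k) = (fun k => (k * res_im k) * gauss w k).
  by apply/funext => k; rewrite /m2; ring.
apply: (@integrable_moment _ s^-1).
  by apply: measurable_funM => //; exact: measurable_res_im.
by move=> k; rewrite normrM mulrC ler_pM.
Qed.

(** The resolvent density convolved with a gaussian of variance [w]. *)
Definition smooth_resolvent (a : R) : R := (2 * pi)^-1 * trig_integral m1 m2 a.

Definition dsmooth_resolvent (a : R) : R :=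
  (2 * pi)^-1 * trig_integral (fun k => k * m2 k) (fun k => - (k * m1 k)) a.

Lemma smooth_resolvent_bounded : exists2 K, 0 <= K & forall x, `|smooth_resolvent x| <= K.
Proof.
exists ((2 * pi)^-1 * \int[mu]_k (`|m1 k| + `|m2 k|)).
  apply: mulr_ge0; first by rewrite invr_ge0 ltW.
  by apply: Rintegral_ge0 => k _; exact: addr_ge0.
move=> x; rewrite /smooth_resolvent normrM ger0_norm ?invr_ge0; last exact: ltW.
apply: ler_wpM2l; first by rewrite invr_ge0 ltW.
exact: (trig_integral_le i1 i2 x).
Qed.

Lemma smooth_resolventE (a : R) :
  smooth_resolvent a = \int[mu]_x (resolvent_density x * gauss_kernel w (x - a)).
Proof.
rewrite /smooth_resolvent /resolvent_density.
rewrite -(gauss_kernel_convolution a w0 integrable_res_re integrable_res_im).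
rewrite -RintegralZl//; first by apply: eq_Rintegral => x _; ring.
apply: (@integrable_bounded_mul _ _ _ mu _ (trig_integral res_re res_im)
  (fun x => gauss_kernel w (x - a)) (\int[mu]_k (`|res_re k| + `|res_im k|))) => //.
- apply: continuous_measurable_fun.
  exact: continuous_trig_integral integrable_res_re integrable_res_im.
- move=> x _; exact: (trig_integral_le integrable_res_re integrable_res_im x).
- exact: integrable_gauss_kernel.
Qed.

Lemma is_derive_smooth_resolvent (a : R) :
  is_derive a 1 smooth_resolvent (dsmooth_resolvent a).
Proof.
have h := is_derive_trig_integral i1 i2 ik1 ik2 a.
rewrite /smooth_resolvent; apply: is_derive_eq.
by [].
Qed.

Let iNk1 : mu.-integrable setT (EFin \o (fun k => - (k * m1 k))).
Proof. exact: RintegrableN. Qed.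

(** The integrand of the compensated increment of the smoothed density at [a]
    by the jump [z.2], at frequency [z.1]. *)
Let increment (a : R) (z : R * R) : R :=
  (m1 z.1 * (cos (z.1 * a) * (cos (z.1 * z.2) - 1) +
             sin (z.1 * a) * (sin (z.1 * z.2) - z.1 * z.2)) +
   m2 z.1 * (sin (z.1 * a) * (cos (z.1 * z.2) - 1) -
             cos (z.1 * a) * (sin (z.1 * z.2) - z.1 * z.2))).

Let majorant (k : R) : R := 4 * s^-1 * (2 * `|k| + k ^+ 2) * gauss w k.

Let majorant_ge0 k : 0 <= majorant k.
Proof.
by rewrite !mulr_ge0 ?gauss_ge0// ?(ltW sV0)// addr_ge0 ?sqr_ge0// mulr_ge0.
Qed.

Let integrable_majorant : mu.-integrable setT (EFin \o majorant).
Proof.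
apply: (@integrable_moment _ (4 * s^-1 * 3)); first by meas.
move=> k; rewrite ger0_norm; last first.
  by rewrite !mulr_ge0// ?(ltW sV0)// addr_ge0 ?sqr_ge0// mulr_ge0.
rewrite -[leRHS]mulrA; apply: ler_wpM2l; first by rewrite mulr_ge0// ltW.
by have := momentk k; have := sqr_ge0 k; lra.
Qed.

Let measurable_increment a : measurable_fun setT (increment a).
Proof.
have mg := measurable_gauss w.
have := measurable_res_re; have := measurable_res_im => mi mr.
by rewrite /increment /m1 /m2; meas.
Qed.

Let increment_le a k y : y < 0 ->
  `|increment a (k, y)| <= majorant k * levy_weight y.
Proof.
move=> y0; rewrite /increment /=.
have C1 := cos_compensated_le k y0; have S1 := sin_compensated_le k y0.
set K := (2 * `|k| + k ^+ 2) * levy_weight y in C1 S1.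
set Cc := cos (k * y) - 1 in C1 *.
set Ss := sin (k * y) - k * y in S1 *.
have ca : `|cos (k * a)| <= 1 by rewrite ler_norml cos_geN1 cos_le1.
have sa : `|sin (k * a)| <= 1 by rewrite ler_norml sin_geN1 sin_le1.
have K0 : 0 <= K by apply: le_trans C1.
have b1 : `|cos (k * a) * Cc + sin (k * a) * Ss| <= 2 * K.
  rewrite (le_trans (ler_normD _ _))// !normrM.
  have -> : 2 * K = 1 * K + 1 * K by ring.
  by apply: lerD; exact: ler_pM.
have b2 : `|sin (k * a) * Cc - cos (k * a) * Ss| <= 2 * K.
  rewrite (le_trans (ler_normB _ _))// !normrM.
  have -> : 2 * K = 1 * K + 1 * K by ring.
  by apply: lerD; exact: ler_pM.
have g0 := gauss_ge0 w k.
have n1 : `|m1 k| <= s^-1 * gauss w k.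
  by rewrite /m1 normrM (ger0_norm g0) mulrC ler_wpM2r.
have n2 : `|m2 k| <= s^-1 * gauss w k.
  by rewrite /m2 normrM (ger0_norm g0) mulrC ler_wpM2r.
rewrite (le_trans (ler_normD _ _))// (normrM (m1 k)) (normrM (m2 k)).
have -> : majorant k * levy_weight y =
    s^-1 * gauss w k * (2 * K) + s^-1 * gauss w k * (2 * K).
  by rewrite /majorant /K; ring.
by apply: lerD; exact: ler_pM.
Qed.

Let integrable_increment a y : y < 0 ->
  mu.-integrable setT (EFin \o (fun k => increment a (k, y))).
Proof.
move=> y0; apply: (@dominated_integrable _ _ _ mu _ _
  (fun k => levy_weight y * majorant k)) => //.
- exact: (measurableT_comp (measurable_increment a)).
- exact: RintegrableZl.
- by move=> k _; rewrite mulrC; exact: increment_le.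
Qed.

Lemma smooth_incrementE (a y : R) : y < 0 ->
  smooth_resolvent (a - y) - smooth_resolvent a + y * dsmooth_resolvent a =
  (2 * pi)^-1 * \int[mu]_k increment a (k, y).
Proof.
move=> y0.
rewrite /smooth_resolvent /dsmooth_resolvent -mulrBr mulrCA -mulrDr; congr (_ * _).
rewrite /trig_integral -RintegralZl//; last exact: integrable_trig.
rewrite -RintegralB//; [|exact: integrable_trig..].
rewrite -RintegralD//; first last.
- by apply: RintegrableZl => //; exact: integrable_trig.
- by apply: RintegrableB => //; exact: integrable_trig.
apply: eq_Rintegral => k _; rewrite /increment /=.
by rewrite mulrBr cosB sinB; ring.
Qed.

Lemma smooth_increment_le (a : R) : exists K, forall y, y < 0 ->
  `|smooth_resolvent (a - y) - smooth_resolvent a + y * dsmooth_resolvent a|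
    <= K * levy_weight y.
Proof.
exists ((2 * pi)^-1 * \int[mu]_k majorant k) => y y0.
rewrite smooth_incrementE// normrM ger0_norm ?invr_ge0; last exact: ltW.
rewrite -mulrA; apply: ler_wpM2l; first by rewrite invr_ge0 ltW.
apply: le_trans (le_normr_Rintegral _ (integrable_increment a y0)) _ => //.
rewrite mulrC -RintegralZl//; apply: le_Rintegral => //.
- exact: integrable_norm (integrable_increment a y0).
- exact: RintegrableZl.
- by move=> k _; rewrite mulrC; exact: increment_le.
Qed.

Lemma continuous_smooth_resolvent : continuous smooth_resolvent.
Proof. by move=> x; apply: cvgMr; exact: continuous_trig_integral. Qed.

Lemma integrable_smooth_increment (a : R) : phi.-integrable (@neg R) (EFin \o
  (fun y => smooth_resolvent (a - y) - smooth_resolvent a + y * dsmooth_resolvent a)).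
Proof.
have [K HK] := smooth_increment_le a.
apply: (integrable_weight_le iw _ HK).
have mU : measurable_fun setT smooth_resolvent.
  exact: continuous_measurable_fun continuous_smooth_resolvent.
by meas.
Qed.

(** The smoothed resolvent density [U] solves [s U - A U = gauss_kernel w],
    where [A] is the generator: by Fubini's theorem the generator acts on the
    Fourier integral as multiplication by the characteristic exponent. *)
Lemma smooth_resolvent_equation (a : R) :
  s * smooth_resolvent a - \int[phi]_(y in @neg R)
    (smooth_resolvent (a - y) - smooth_resolvent a + y * dsmooth_resolvent a) =
  gauss_kernel w a.
Proof.
have mn : measurable (@neg R : set (measurableTypeR R)) by exact: measurable_neg.
have nlt (y : R) : y \in (@neg R : set (measurableTypeR R)) -> y < 0.
  by rewrite inE /neg /= in_itv.
under eq_Rintegral => y yn do rewrite smooth_incrementE ?nlt//.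
have h2 := @Rintegral_swap_dominated _ _ _ _ _ phi mu (@neg R) setT
  (fun z => increment a (z.2, z.1)) (@levy_weight R) majorant
  sf (@sigma_finite_lebesgue R) mn measurableT.
have mh : measurable_fun setT (fun z : measurableTypeR R * measurableTypeR R => increment a (z.2, z.1)).
  apply: (measurableT_comp (measurable_increment a)).
  by apply: measurable_fun_pair; [exact: measurable_snd|exact: measurable_fst].
have {}h2 : \int[phi]_(y in @neg R) (\int[mu]_k increment a (k, y)) =
    \int[mu]_k (\int[phi]_(y in @neg R) increment a (k, y)).
  apply: h2 => // y k; rewrite /neg /= in_itv/= => y0 _.
  by rewrite mulrC; exact: increment_le.
rewrite RintegralZl//; last first.
  have := RintegrableZl (2 * pi) mn (integrable_smooth_increment a).
  apply: eq_integrable => // y yn /=.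
  by rewrite smooth_incrementE ?nlt// mulVKf// gt_eqF.
rewrite h2.
have E k : \int[phi]_(y in @neg R) increment a (k, y) =
  m1 k * (cos (k * a) * A k + sin (k * a) * B k) +
  m2 k * (sin (k * a) * A k - cos (k * a) * B k).
  have iC := integrable_cos_compensated iw k.
  have iS := integrable_sin_compensated iw k.
  rewrite /increment /=.
  rewrite RintegralD//; first last.
  - apply: RintegrableZl => //; apply: RintegrableB => //; exact: RintegrableZl.
  - apply: RintegrableZl => //; apply: RintegrableD => //; exact: RintegrableZl.
  rewrite RintegralZl//; last by apply: RintegrableD => //; exact: RintegrableZl.
  rewrite RintegralZl//; last by apply: RintegrableB => //; exact: RintegrableZl.
  rewrite RintegralD//; [|exact: RintegrableZl..].
  rewrite RintegralB//; [|exact: RintegrableZl..].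
  by rewrite !RintegralZl.
have ig : mu.-integrable setT (EFin \o (fun k => gauss w k * cos (k * a))).
  apply: (@dominated_integrable _ _ _ mu _ _ (gauss w)) => //.
  - by have := measurable_gauss w => ?; meas.
  - exact: integrable_gauss0.
  - by move=> k _; rewrite (le_trans (cosM_le1 _ _))// ger0_norm// gauss_ge0.
have {}E k : \int[phi]_(y in @neg R) increment a (k, y) =
  s * (m1 k * cos (k * a) + m2 k * sin (k * a)) - gauss w k * cos (k * a).
  have := congr1 ( *%R (gauss w k)) (resolvent_eq k (cos (k * a)) (sin (k * a))).
  by rewrite E => <-; rewrite /m1 /m2; ring.
under eq_Rintegral => k _ do rewrite E.
rewrite RintegralB//; last by apply: RintegrableZl => //; exact: integrable_trig.
rewrite RintegralZl//; last exact: integrable_trig.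
by rewrite gauss_kernel_fourier// /smooth_resolvent /trig_integral; ring.
Qed.

End smoothing.
End resolvent.

(** * The Laplace transform in time of the densities *)

Section exponential_half_line.
Context (R : realType).
Local Notation mu := (@lebesgue_measure R).

Let derive_exp (r x : R) : r != 0 ->
  is_derive x 1 (fun x => - r^-1 * expR (- (r * x))) (expR (- (r * x))).
Proof. by move=> r0; deriv. Qed.

Lemma cvg_expRN (r : R) : 0 < r -> expR (- (r * x)) @[x --> +oo] --> (0 : R).
Proof.
move=> r0; apply/cvgrPdist_le => /= e e0; near=> x.
have x1 : (r * e)^-1 <= x.
  by near: x; apply: nbhs_pinfty_ge; exact: num_real.
have x0 : 0 < x by apply: lt_le_trans x1; rewrite invr_gt0 mulr_gt0.
rewrite sub0r normrN ger0_norm ?expR_ge0// expRN.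
rewrite invf_ple ?posrE ?expR_gt0//.
have h := expR_ge1Dx (r * x).
have : e^-1 <= r * x.
  by rewrite -ler_pdivrMl//; move: x1; rewrite invfM.
lra.
Unshelve. all: end_near. Qed.

Let integral_exp (r : R) : 0 < r ->
  (\int[mu]_(x in `]0%R, +oo[) (expR (- (r * x)))%:E = (r^-1)%:E)%E.
Proof.
move=> r0.
have ce : continuous (fun x : R => expR (- (r * x))).
  move=> x; apply: differentiable_continuous; apply/derivable1_diffP.
  by apply: ex_derive.
rewrite integral_itv_obnd_cbnd; last first.
  by apply/measurable_EFinP; apply: measurable_funTS; exact: continuous_measurable_fun.
have rn : r != 0 by rewrite gt_eqF.
pose F (x : R) := - r^-1 * expR (- (r * x)).
have dF (x : R) : is_derive x 1 F (expR (- (r * x))) by exact: derive_exp.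
rewrite (@ge0_continuous_FTC2y _ _ F 0 0).
- by rewrite /F mulr0 oppr0 expR0 mulr1 -EFinB sub0r opprK.
- by move=> x _; exact: expR_ge0.
- exact: continuous_subspaceT.
- by rewrite -[X in _ --> X](mulr0 (- r^-1)); apply: cvgMr; exact: cvg_expRN.
- by move=> x _; have [] := dF x.
- apply: cvg_at_right_filter; apply: differentiable_continuous.
  by apply/derivable1_diffP; have [] := dF 0.
- by move=> x _; rewrite derive1E; have h := dF x; rewrite derive_val.
Qed.

Lemma integrable_exp_half_line (r : R) : 0 < r ->
  mu.-integrable `]0%R, +oo[ (EFin \o (fun x => expR (- (r * x)))).
Proof.
move=> r0; apply/integrableP; split.
  apply/measurable_EFinP; apply: measurable_funTS.
  by meas.
under eq_integral => x _ do rewrite /= ger0_norm ?expR_ge0//.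
by rewrite integral_exp// ltry.
Qed.

Lemma Rintegral_exp_half_line (r : R) : 0 < r ->
  \int[mu]_(x in `]0, +oo[) expR (- (r * x)) = r^-1.
Proof. by move=> r0; rewrite /Rintegral integral_exp. Qed.

(** The Laplace transform of a rotating unit vector. *)
Lemma Rintegral_damped_cos (r b j : R) : 0 < r ->
  \int[mu]_(t in `]0, +oo[) (expR (- (r * t)) * cos (j - t * b)) =
  r / (r ^+ 2 + b ^+ 2) * cos j + b / (r ^+ 2 + b ^+ 2) * sin j.
Proof.
move=> r0.
have d0 : r ^+ 2 + b ^+ 2 != 0 by rewrite gt_eqF// ltr_pwDl ?sqr_ge0// exprn_gt0.
pose d := (r ^+ 2 + b ^+ 2)^-1.
pose F (t : R) := expR (- (r * t)) *
  (- (r * d) * cos (j - t * b) - b * d * sin (j - t * b)).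
have dF (t : R) : is_derive t 1 F (expR (- (r * t)) * cos (j - t * b)).
  by rewrite /F /d; deriv.
have cF : F n%:R @[n --> \oo] --> (0 : R).
  have e0 : expR (- (r * n%:R)) @[n --> \oo] --> (0 : R).
    apply: (@cvg_comp _ _ _ (fun n : nat => n%:R : R) (fun x => expR (- (r * x))) _ +oo).
      exact: cvgr_idn.
    exact: cvg_expRN.
  pose K := `|r * d| + `|b * d|.
  have eK : K * expR (- (r * n%:R)) @[n --> \oo] --> (0 : R).
    by rewrite -[X in _ --> X](mulr0 K); apply: cvgMr.
  apply: norm_cvg0; apply: (@squeeze_cvgr _ _ _ _ (cst 0) _ _ _ _ _ eK); last exact: cvg_cst.
  apply: nearW => n /=; rewrite normr_ge0/= /F normrM mulrC (ger0_norm (expR_ge0 _)).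
  rewrite ler_wpM2r ?expR_ge0// (le_trans (ler_normB _ _))//.
  by rewrite /K -(normrN (r * d)) lerD ?cosM_le1 ?sinM_le1.
rewrite (@Rintegral_half_line _ _ F 0)//.
- by rewrite /F !mulr0 oppr0 expR0 mul0r subr0 mul1r sub0r opprD !opprK !mulNr opprK.
- apply: (@dominated_integrable _ _ _ mu _ _ (fun t => expR (- (r * t)))) => //.
  + by meas.
  + exact: integrable_exp_half_line.
  + move=> t _; rewrite (le_trans (cosM_le1 _ _))// ger0_norm// expR_ge0.
- move=> t; apply: differentiable_continuous; apply/derivable1_diffP.
  by apply: ex_derive.
Qed.

End exponential_half_line.

Lemma EFin_Rintegral d (T : measurableType d) (R : realType)
    (m : {measure set T -> \bar R}) (D : set T) (f : T -> R) : measurable D ->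
  m.-integrable D (EFin \o f) ->
  (\int[m]_(x in D) (f x)%:E)%E = (\int[m]_(x in D) f x)%:E.
Proof.
by move=> mD fi; rewrite /Rintegral fineK//; exact: (integrable_fin_num mD fi).
Qed.

Section time_transform.
Context (R : realType).
Local Notation mu := (@lebesgue_measure R).
Variable phi : {measure set (measurableTypeR R) -> \bar R}.
Hypothesis iw : phi.-integrable (@neg R) (EFin \o @levy_weight R).
Hypothesis ires : forall s, 0 < s ->
  mu.-integrable setT (EFin \o (fun k => (s - psi_re phi k)^-1)).
Variable p : R -> R -> R.
Hypothesis dens : semistable_densities phi p.
Local Notation A := (psi_re phi).
Local Notation B := (psi_im phi).

Lemma psiE k : psi phi k = (A k +i* B k)%C.
Proof.
rewrite /psi /Cintegral; congr (_ +i* _)%C; apply: eq_Rintegral => y _ /=.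
  by rewrite expR0; ring.
by rewrite expR0; ring.
Qed.

Let mA : measurable_fun setT A.
Proof. exact: continuous_measurable_fun (continuous_psi_re iw). Qed.

Let mB : measurable_fun setT B.
Proof. exact: continuous_measurable_fun (continuous_psi_im iw). Qed.

(** Real form of the hypothesis on the Fourier transform. *)
Lemma characteristic_function t k : 0 < t ->
  \int[mu]_x (cos (k * x) * p x t) = expR (t * A k) * cos (t * B k) /\
  \int[mu]_x (sin (k * x) * p x t) = expR (t * A k) * sin (t * B k).
Proof.
move=> t0; have [_ _ /(_ k)] := dens t0.
rewrite psiE /fourier_transform /Cintegral /expC => -[].
rewrite /= !mul0r ?mulr0 ?subr0 ?add0r ?addr0. move=> H1 H2; split.
  rewrite -H1; apply: eq_Rintegral => x _.
  by rewrite expR0; ring.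
rewrite -H2; apply: eq_Rintegral => x _.
by rewrite expR0; ring.
Qed.

(** Since [exp (- z) <= 1 / (1 + z)], the resolvent dominates the semigroup. *)
Lemma integrable_expR_psi_re t : 0 < t ->
  mu.-integrable setT (EFin \o (fun k => expR (t * A k))).
Proof.
move=> t0; have tV : 0 < t^-1 by rewrite invr_gt0.
apply: (@dominated_integrable _ _ _ mu _ _ (fun k => t^-1 * (t^-1 - A k)^-1)) => //.
- by meas.
- by apply: RintegrableZl => //; exact: ires.
- move=> k _; have A0 := psi_re_le0 iw k.
  rewrite ger0_norm ?expR_ge0// -invfM.
  have -> : t * (t^-1 - A k) = 1 - t * A k by rewrite mulrBr divff ?gt_eqF.
  have h := expR_ge1Dx (- (t * A k)).
  have h0 : 0 < 1 - t * A k.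
    by rewrite subr_gt0 (le_lt_trans _ ltr01)// pmulr_rle0.
  by rewrite -[t * A k]opprK expRN lef_pV2 ?posrE ?expR_gt0// opprK.
Qed.

Lemma density_inversion x t : 0 < t -> p x t = (2 * pi)^-1 *
  trig_integral (fun k => expR (t * A k) * cos (t * B k))
                (fun k => expR (t * A k) * sin (t * B k)) x.
Proof.
move=> t0; have [[mp p0 p1] cp _] := dens t0.
have ip : mu.-integrable setT (EFin \o (p ^~ t)).
  apply/integrableP; split; first exact/measurable_EFinP.
  under eq_integral => y _ do rewrite /= ger0_norm//.
  by rewrite p1 ltry.
have iE := integrable_expR_psi_re t0.
have fc : (fun k => \int[mu]_y (cos (k * y) * p y t)) =
    (fun k => expR (t * A k) * cos (t * B k)).
  by apply/funext => k; have [] := characteristic_function k t0.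
have fs : (fun k => \int[mu]_y (sin (k * y) * p y t)) =
    (fun k => expR (t * A k) * sin (t * B k)).
  by apply/funext => k; have [] := characteristic_function k t0.
have := @fourier_inversion R (p ^~ t) x ip (cp x); rewrite /= fc fs; apply.
- apply: (@dominated_integrable _ _ _ mu _ _ (fun k => expR (t * A k))) => //.
    by meas.
  by move=> k _; rewrite (le_trans (cosM_le1 _ _))// ger0_norm ?expR_ge0.
- apply: (@dominated_integrable _ _ _ mu _ _ (fun k => expR (t * A k))) => //.
    by meas.
  by move=> k _; rewrite (le_trans (sinM_le1 _ _))// ger0_norm ?expR_ge0.
Qed.

(** The Laplace transform in time of the inversion formula, by Fubini. *)
Lemma laplace_time_resolvent x s : 0 < s ->
  laplace_time p x s = (resolvent_density phi s x)%:E.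
Proof.
move=> s0.
have pi2 : 0 < 2 * pi :> R by rewrite mulr_gt0// pi_gt0.
have mD : measurable (`]0%R, +oo[%classic : set (measurableTypeR R)) by exact: measurable_itv.
pose h (z : R * R) := expR (- ((s - A z.1) * z.2)) * cos (z.1 * x - z.2 * B z.1).
have mh : measurable_fun setT h.
  have mA1 : measurable_fun setT (fun z : R * R => A z.1) by exact: (measurableT_comp mA measurable_fst).
  have mB1 : measurable_fun setT (fun z : R * R => B z.1) by exact: (measurableT_comp mB measurable_fst).
  by rewrite /h; meas.
have r0 k : 0 < s - A k by exact: sA_gt0.
have h_le k t : `|h (k, t)| <= expR (- ((s - A k) * t)).
  by rewrite /h /= (le_trans (cosM_le1 _ _))// ger0_norm ?expR_ge0.
have ih2 k : setT k -> mu.-integrable `]0%R, +oo[ (EFin \o (fun t => h (k, t))).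
  move=> _; apply: (@dominated_integrable _ _ _ mu _ _ (fun t => expR (- ((s - A k) * t)))) => //.
  - by apply: measurable_funTS; exact: (measurableT_comp mh).
  - exact: integrable_exp_half_line.
have ih1 t : `]0%R, +oo[%classic t -> mu.-integrable setT (EFin \o (fun k => h (k, t))).
  rewrite /= in_itv/= andbT => t0.
  apply: (@dominated_integrable _ _ _ mu _ _ (fun k => expR (t * A k))) => //.
  - exact: (measurableT_comp mh).
  - exact: integrable_expR_psi_re.
  - move=> k _; apply: (le_trans (h_le k t)); rewrite ler_expR mulrBl opprB.
    by rewrite mulrC gerBl mulr_ge0// ltW.
have hf k : setT k -> \int[mu]_(t in `]0%R, +oo[) `|h (k, t)| <= (s - A k)^-1.
  move=> _; rewrite -(Rintegral_exp_half_line (r0 k)); apply: le_Rintegral => //.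
  - exact: integrable_norm (ih2 k I).
  - exact: integrable_exp_half_line.
have sl := @sigma_finite_lebesgue R.
have SW := Rintegral_swap sl sl measurableT mD mh ih2 ih1 (ires s0) hf.
have IS := integrable_Rintegral_swap sl sl measurableT mD mh ih2 ih1 (ires s0) hf.
have E t : `]0%R, +oo[%classic t ->
    expR (- (s * t)) * p x t = (2 * pi)^-1 * \int[mu]_k h (k, t).
  move=> Dt; have t0 : 0 < t by move: Dt; rewrite /= in_itv/= andbT.
  pose G k := expR (t * A k) * cos (t * B k) * cos (k * x) +
    expR (t * A k) * sin (t * B k) * sin (k * x).
  have hG k : h (k, t) = expR (- (s * t)) * G k.
    rewrite /h /G /= cosB.
    have -> : - ((s - A k) * t) = - (s * t) + t * A k by ring.
    by rewrite expRD; ring.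
  have iG : mu.-integrable setT (EFin \o G).
    have := RintegrableZl (expR (s * t)) measurableT (ih1 t Dt).
    congr (mu.-integrable _ (EFin \o _)); apply/funext => k.
    by rewrite hG mulrA -expRD subrr expR0 mul1r.
  rewrite (density_inversion x t0) mulrCA; congr (_ * _).
  rewrite -(RintegralZl _ measurableT iG).
  by apply: eq_Rintegral => k _; rewrite hG.
rewrite /laplace_time.
have -> : (\int[mu]_(t in `]0%R, +oo[) (expR (- (s * t)) * p x t)%:E =
    \int[mu]_(t in `]0%R, +oo[) ((2 * pi)^-1 * \int[mu]_k h (k, t))%:E)%E.
  by apply: eq_integral => t; rewrite inE => /E ->.
have iS2 := RintegrableZl (2 * pi)^-1 mD IS.
have <- : \int[mu]_(t in `]0%R, +oo[) ((2 * pi)^-1 * \int[mu]_k h (k, t)) =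
    resolvent_density phi s x.
  rewrite (RintegralZl _ mD IS) -SW; congr (_ * _).
  by apply: eq_Rintegral => k _; rewrite /h /= Rintegral_damped_cos.
exact: EFin_Rintegral iS2.
Qed.

End time_transform.

(** * The exponential form on the positive half-line *)

Section maximum_principle.
Context (R : realType).
Variable phi : {measure set (measurableTypeR R) -> \bar R}.

(** Since the jumps are negative, the generator at [x] only sees the values on
    the right of [x], so the maximum principle holds on half-lines
    [`[d, +oo[]: at an interior maximum the first derivative vanishes and the
    increments are nonpositive. *)
Lemma maximum_principle (v dv : R -> R) (s M d : R) : 0 < s ->
  (forall x, is_derive (x : R) 1 v (dv x)) -> v d <= M ->
  (exists N, forall x, N <= x -> v x <= M) ->
  (forall x, d < x ->
    s * v x - \int[phi]_(y in @neg R) (v (x - y) - v x + y * dv x) <= s * M) ->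
  forall x, d <= x -> v x <= M.
Proof.
move=> s0 dvx vd [N vN] eqn x1 dx1; rewrite leNgt; apply/negP => Mv1.
pose b := Num.max N x1 + 1.
have Nb : N <= b by rewrite (@le_trans _ _ (Num.max N x1))// ?le_max ?lexx// lerDl.
have x1b : x1 <= b by rewrite (@le_trans _ _ (Num.max N x1))// ?le_max ?lexx ?orbT// lerDl.
have db : d <= b by exact: le_trans x1b.
have der x : derivable v x 1 by have [] := dvx x.
have cv : {within `[d, b], continuous v}.
  by apply: derivable_within_continuous => x _.
have [x0 x0db x0max] := EVT_max db cv.
have Mv0 : M < v x0.
  by rewrite (lt_le_trans Mv1)// x0max// in_itv/= dx1.
move: x0db; rewrite in_itv/= => /andP[dx0 x0b].
have dx0' : d < x0.
  by rewrite lt_neqAle dx0 andbT; apply/eqP => E; move: Mv0; rewrite -E ltNge vd.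
have x0b' : x0 < b.
  rewrite lt_neqAle x0b andbT; apply/eqP => E; move: Mv0.
  by rewrite E ltNge vN.
have D0 : dv x0 = 0.
  have h0 : is_derive x0 1 v 0.
    apply: (@derive1_at_max R v d b) => //.
    - by rewrite in_itv/= dx0' x0b'.
    - by move=> t; rewrite in_itv/= => /andP[dt tb]; apply: x0max; rewrite in_itv/= !ltW.
  by have [_ <-] := dvx x0; have [_ ->] := h0.
have v0 y : y < 0 -> v (x0 - y) <= v x0.
  move=> y0; have [yb|yb] := leP (x0 - y) b.
    by apply: x0max; rewrite in_itv/= yb andbT (le_trans dx0)// lerBrDl gerDr ltW.
  by rewrite (le_trans _ (ltW Mv0))// vN// (le_trans Nb)// ltW.
have := eqn x0 dx0'; rewrite D0.
have I0 : 0 <= - \int[phi]_(y in @neg R) (v (x0 - y) - v x0 + y * 0).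
  rewrite oppr_ge0 /Rintegral -lee_fin.
  have : (\int[phi]_(y in @neg R) (v (x0 - y) - v x0 + y * 0)%:E <= 0)%E.
    have -> : (\int[phi]_(y in @neg R) (v (x0 - y) - v x0 + y * 0)%:E =
        \int[phi]_(y in @neg R) - (v x0 - v (x0 - y))%:E)%E.
      by apply: eq_integral => y _; rewrite -EFinN; congr (_%:E); ring.
    rewrite integral_ge0N; last first.
      by move=> y; rewrite /neg /= in_itv/= => y0; rewrite lee_fin subr_ge0 v0.
    rewrite oppe_le0; apply: integral_ge0 => y; rewrite /neg /= in_itv/= => y0.
    by rewrite lee_fin subr_ge0 v0.
  by case: (\int[phi]_(y in _) _)%E => //.
have sM : s * M < s * v x0 by rewrite ltr_pM2l.
by move=> h; move: sM; rewrite ltNge (le_trans _ h)// lerDl.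
Qed.

End maximum_principle.

Section exponential_decay.
Context (R : realType).
Local Notation mu := (@lebesgue_measure R).
Variable phi : {measure set (measurableTypeR R) -> \bar R}.
Hypothesis sf : sigma_finite setT phi.
Hypothesis iw : phi.-integrable (@neg R) (EFin \o @levy_weight R).
Variables s q : R.
Hypotheses (s0 : 0 < s) (q0 : 0 < q) (Pq : Psi phi q = s).
Hypothesis ires : mu.-integrable setT (EFin \o (fun k => (s - psi_re phi k)^-1)).

Let mn : measurable (@neg R : set (measurableTypeR R)).
Proof. exact: measurable_neg. Qed.

Section smoothed.
Variables (w d : R).
Hypotheses (w0 : 0 < w) (d0 : 0 < d).
Local Notation U := (smooth_resolvent phi s w).
Local Notation dU := (dsmooth_resolvent phi s w).

(** Comparison of [U] on [`[d, +oo[] with the multiple of [expR (- (q * x))]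
    that agrees with it at [d]: the exponential is annihilated by [s - A], so the
    difference solves the equation with right-hand side [gauss_kernel w],
    which is at most [gauss_kernel w d] there. The term [eta * x]
    makes the difference negative at infinity. *)
Let comparison (sg eta : R) : `|sg| = 1 -> 0 < eta -> forall x, d <= x ->
  sg * (U x - U d * expR (- (q * (x - d)))) - eta * x <= gauss_kernel w d / s.
Proof.
move=> sg1 eta0.
have [K K0 UK] := smooth_resolvent_bounded iw s0 w0.
pose e x := expR (- (q * (x - d))).
(* the sign [sg] treats both bounds at once *)
pose v x := sg * (U x - U d * e x) - eta * x.
pose dv x := sg * (dU x + q * U d * e x) - eta.
have M0 : 0 <= gauss_kernel w d / s by rewrite divr_ge0 ?gauss_kernel_ge0 ?ltW.
have sgle x : sg * x <= `|x|.
  by rewrite (le_trans (ler_norm _))// normrM sg1 mul1r.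
apply: (@maximum_principle R phi v dv s) => //.
- move=> x; have h := is_derive_smooth_resolvent iw s0 w0 x.
  by rewrite /v /dv /e; deriv.
- by rewrite /v /e subrr mulr0 oppr0 expR0 mulr1 subrr mulr0 sub0r (le_trans _ M0)// oppr_le0 mulr_ge0// ltW.
- exists (Num.max d (2 * K / eta)) => x; rewrite ge_max => /andP[dx Kx].
  have e1 : e x <= 1.
    by rewrite /e -[leRHS]expR0 ler_expR oppr_le0 mulr_ge0 ?subr_ge0 ?(ltW q0).
  have e0 : 0 <= e x by exact: expR_ge0.
  have h1 : sg * (U x - U d * e x) <= 2 * K.
    rewrite (le_trans (sgle _))// (le_trans (ler_normB _ _))// (normrM (U d)) (ger0_norm e0).
    have := UK x; have := UK d; have : `|U d| * e x <= `|U d| by rewrite ler_piMr.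
    by lra.
  have h2 : 2 * K <= eta * x by rewrite -ler_pdivrMl// mulrC.
  rewrite /v; apply: (le_trans _ M0); rewrite subr_le0; exact: le_trans h1 h2.
- move=> x dx.
  have iU := integrable_smooth_increment iw s0 w0 x.
  have iE := integrable_expR_compensated iw (ltW q0).
  have -> : \int[phi]_(y in @neg R) (v (x - y) - v x + y * dv x) =
     sg * (\int[phi]_(y in @neg R) (U (x - y) - U x + y * dU x) - U d * e x * s).
    have iE' := RintegrableZl (U d * e x) mn iE.
    have -> : U d * e x * s =
        \int[phi]_(y in @neg R) (U d * e x * (expR (q * y) - 1 - q * y)).
      by rewrite (RintegralZl _ mn iE) -/(Psi phi q) Pq.
    have iUE := RintegrableB mn iU iE'.
    rewrite -(RintegralB mn iU iE') -(RintegralZl sg mn iUE).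
    apply: eq_Rintegral => y _; rewrite /v /dv.
    have -> : e (x - y) = e x * expR (q * y) by rewrite /e -expRD; congr expR; ring.
    by ring.
  have E := smooth_resolvent_equation sf iw s0 w0 x.
  have -> : s * v x - sg * (\int[phi]_(y in @neg R) (U (x - y) - U x + y * dU x) -
      U d * e x * s) = sg * gauss_kernel w x - s * eta * x.
    by rewrite -E /v; ring.
  have x0 : 0 <= x by apply: ltW; exact: lt_trans dx.
  have -> : s * (gauss_kernel w d / s) = gauss_kernel w d by rewrite mulrCA divff ?mulr1// gt_eqF.
  have g1 : gauss_kernel w x <= gauss_kernel w d.
    rewrite /gauss_kernel ler_wpM2l// ?invr_ge0 ?sqrtr_ge0// /gauss ler_expR lerN2.
    rewrite ler_pM2r// ler_pM2l ?invr_gt0// lerXn2r ?nnegrE//; exact: ltW.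
  have : sg * gauss_kernel w x <= gauss_kernel w x.
    by rewrite (le_trans (sgle _))// ger0_norm// gauss_kernel_ge0.
  have : 0 <= s * eta * x by rewrite !mulr_ge0// ltW.
  by lra.
Qed.

(** The bound is uniform in [x] and vanishes with [w]. *)
Lemma smooth_resolvent_decay x : d <= x ->
  `|U x - U d * expR (- (q * (x - d)))| <= gauss_kernel w d / s.
Proof.
move=> dx; have x0 : 0 < x by exact: lt_le_trans dx.
have H sg : `|sg| = 1 -> sg * (U x - U d * expR (- (q * (x - d)))) <= gauss_kernel w d / s.
  move=> sg1; apply/ler_addgt0Pr => e e0.
  have ex0 : 0 < e / x by rewrite divr_gt0.
  have := comparison sg1 ex0 dx; rewrite divfK ?gt_eqF//; lra.
rewrite ler_norml; apply/andP; split.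
  by have := H (- 1); rewrite normrN1 mulN1r => /(_ erefl); rewrite lerNl.
by have := H 1; rewrite normr1 mul1r => /(_ erefl).
Qed.

End smoothed.

Lemma cvg_smooth_resolvent x :
  smooth_resolvent phi s n.+1%:R^-1 x @[n --> \oo] --> resolvent_density phi s x.
Proof.
apply: cvgMr; apply: cvg_trig_integral_gauss.
- exact: integrable_res_re.
- exact: integrable_res_im.
Qed.

Lemma resolvent_density_step d x : 0 < d -> d <= x ->
  resolvent_density phi s x = resolvent_density phi s d * expR (- (q * (x - d))).
Proof.
move=> d0 dx; apply/eqP; rewrite -subr_eq0 -normr_eq0; apply/eqP.
have c1 : `|smooth_resolvent phi s n.+1%:R^-1 x -
    smooth_resolvent phi s n.+1%:R^-1 d * expR (- (q * (x - d)))| @[n --> \oo] -->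
   `|resolvent_density phi s x - resolvent_density phi s d * expR (- (q * (x - d)))|.
  apply: cvg_norm; apply: cvgB; first exact: cvg_smooth_resolvent.
  by apply: cvgMl; exact: cvg_smooth_resolvent.
have c2 : `|smooth_resolvent phi s n.+1%:R^-1 x -
    smooth_resolvent phi s n.+1%:R^-1 d * expR (- (q * (x - d)))| @[n --> \oo] --> (0 : R).
  have h : gauss_kernel n.+1%:R^-1 d / s @[n --> \oo] --> (0 : R).
    rewrite -[X in _ --> X](mul0r s^-1); apply: cvgMl.
    exact: cvg_gauss_kernel_away.
  apply: (@squeeze_cvgr _ _ _ _ (cst 0) _ _ _ _ _ h); last exact: cvg_cst.
  apply: nearW => n; rewrite normr_ge0/=.
  by apply: smooth_resolvent_decay => //; rewrite invr_gt0.
exact: cvg_unique c1 c2.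
Qed.

(** The constant can be read off at any point, here at [1]. *)
Lemma resolvent_density_exponential : exists C, forall x, 0 < x ->
  resolvent_density phi s x = C * expR (- (q * x)).
Proof.
exists (resolvent_density phi s 1 * expR q) => x x0.
have [x1|x1] := leP 1 x.
  rewrite (resolvent_density_step ltr01 x1).
  have -> : expR (- (q * (x - 1))) = expR q * expR (- (q * x)).
    by rewrite -expRD; congr expR; ring.
  by rewrite mulrA.
rewrite (resolvent_density_step x0 (ltW x1)); set ux := resolvent_density _ _ x.
rewrite -!mulrA -!expRD.
have -> : - (q * (1 - x)) + (q + - (q * x)) = 0 by ring.
by rewrite expR0 mulr1.
Qed.

End exponential_decay.

(** * The bilateral Laplace transform of the resolvent density *)

Section tilted_gaussian.
Context (R : realType).
Local Notation mu := (@lebesgue_measure R).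
Variables l w : R.
Hypotheses (l0 : 0 < l) (w1 : 1 <= w).

(** A gaussian bump of variance [w] which, as [w] grows, becomes the
    exponential [expR (l * x)]. *)
Definition tilted (x : R) : R := expR (l * x) * gauss w^-1 x.
Definition dtilted (x : R) : R := (l - x / w) * tilted x.
Definition ddtilted (x : R) : R := ((l - x / w) ^+ 2 - w^-1) * tilted x.

Let w0 : 0 < w. Proof. exact: lt_le_trans w1. Qed.

Let wV0 : 0 < w^-1. Proof. by rewrite invr_gt0. Qed.

Let wV1 : w^-1 <= 1. Proof. by rewrite invf_le1. Qed.

Lemma tilted0 : tilted 0 = 1.
Proof. by rewrite /tilted mulr0 expR0 gauss0 mulr1. Qed.

Lemma is_derive_tilted (x : R) : is_derive x 1 tilted (dtilted x).
Proof. by rewrite /tilted /dtilted /tilted /gauss; deriv; rewrite gt_eqF. Qed.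

Lemma is_derive_dtilted (x : R) : is_derive x 1 dtilted (ddtilted x).
Proof.
rewrite /dtilted /ddtilted /tilted /gauss; deriv; by rewrite gt_eqF.
Qed.

Lemma tilted_ge0 x : 0 <= tilted x.
Proof. by apply: mulr_ge0; [exact: expR_ge0|exact: gauss_ge0]. Qed.

Lemma tilted_le x : tilted x <= expR (l * x).
Proof. by rewrite ler_piMr ?expR_ge0// gauss_le1// ltW. Qed.

Let gauss_small x : gauss w^-1 x <= (1 + w^-1 * x ^+ 2 / 2)^-1.
Proof.
have h : 0 <= w^-1 * x ^+ 2 / 2 by rewrite divr_ge0// mulr_ge0 ?sqr_ge0// ltW.
rewrite /gauss expRN lef_pV2 ?posrE ?expR_gt0//; first exact: expR_ge1Dx.
by rewrite ltr_pwDl.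
Qed.

Let gauss_moment1 x : `|x / w| * gauss w^-1 x <= 1.
Proof.
have h : 0 <= w^-1 * x ^+ 2 / 2 by rewrite divr_ge0// mulr_ge0 ?sqr_ge0// ltW.
have h1 : 0 < 1 + w^-1 * x ^+ 2 / 2 by rewrite ltr_pwDl.
apply: (le_trans (ler_wpM2l _ (gauss_small x))); first exact: normr_ge0.
rewrite ler_pdivrMr// mul1r normrM (gtr0_norm wV0).
rewrite -(real_normK (num_real x)); move: (normr_ge0 x) wV0 wV1.
move: `|x| w^-1 => z e z0 e0 e1.
have : 0 <= e * (z - 1) ^+ 2 by rewrite mulr_ge0 ?sqr_ge0// ltW.
rewrite -subr_ge0 => hz; rewrite -subr_ge0.
rewrite (_ : _ - _ = (e * (z - 1) ^+ 2) / 2 + (1 - e / 2)); last by field.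
by lra.
Qed.

Let gauss_moment2 x : (x / w) ^+ 2 * gauss w^-1 x <= 2.
Proof.
have h : 0 <= w^-1 * x ^+ 2 / 2 by rewrite divr_ge0// mulr_ge0 ?sqr_ge0// ltW.
have h1 : 0 < 1 + w^-1 * x ^+ 2 / 2 by rewrite ltr_pwDl.
apply: (le_trans (ler_wpM2l _ (gauss_small x))); first exact: sqr_ge0.
rewrite ler_pdivrMr// exprMn; move: (sqr_ge0 x) wV0 wV1.
move: (x ^+ 2) w^-1 => z e z0 e0 e1.
have : e * (e * z) <= 1 * (e * z) by rewrite ler_wpM2r// mulr_ge0// ltW.
rewrite expr2; have := mulr_ge0 (ltW e0) z0; lra.
Qed.

Lemma dtilted_le x : `|dtilted x| <= (l + 1) * expR (l * x).
Proof.
rewrite /dtilted /tilted mulrCA normrM (ger0_norm (expR_ge0 _)) mulrC.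
rewrite ler_wpM2r ?expR_ge0// normrM (ger0_norm (gauss_ge0 _ _)).
apply: (le_trans (ler_wpM2r (gauss_ge0 _ _) (ler_normB _ _))).
rewrite mulrDl lerD// (gtr0_norm l0) ler_piMr ?gauss_le1//; exact: ltW.
Qed.

Lemma ddtilted_le x : `|ddtilted x| <= (2 * l ^+ 2 + 5) * expR (l * x).
Proof.
rewrite /ddtilted /tilted mulrCA normrM (ger0_norm (expR_ge0 _)) mulrC.
rewrite ler_wpM2r ?expR_ge0// normrM (ger0_norm (gauss_ge0 _ _)).
have g1 : gauss w^-1 x <= 1 by rewrite gauss_le1// ltW.
have g0 := gauss_ge0 w^-1 x.
have h : `|(l - x / w) ^+ 2 - w^-1| <= 2 * l ^+ 2 + 2 * (x / w) ^+ 2 + 1.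
  rewrite (le_trans (ler_normB _ _))// ger0_norm ?sqr_ge0// (gtr0_norm wV0) lerD//.
  rewrite -subr_ge0 (_ : _ - _ = (l + x / w) ^+ 2) ?sqr_ge0//; ring.
apply: (le_trans (ler_wpM2r g0 h)).
have h2 := gauss_moment2 x.
have h3 : l ^+ 2 * gauss w^-1 x <= l ^+ 2 by rewrite ler_piMr ?sqr_ge0.
rewrite !mulrDl mul1r -!mulrA; lra.
Qed.

(** Uniformly in [w], compensated increments are dominated. *)
Lemma tilted_increment_le x y : y < 0 ->
  `|tilted (x + y) - tilted x - y * dtilted x| <=
  (2 * (l + 1) + (2 * l ^+ 2 + 5)) * levy_weight y * expR (l * x).
Proof.
move=> y0; rewrite mulrAC mulrDl -mulrA.
apply: (@compensated_le _ tilted dtilted ddtilted) => //.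
- by move=> z _; exact: is_derive_tilted.
- by move=> z _; exact: is_derive_dtilted.
- move=> z zx; apply: (le_trans (dtilted_le z)).
  by rewrite ler_pM2l ?ler_expR ?ler_pM2l// addr_gt0.
- move=> z zx; apply: (le_trans (ddtilted_le z)).
  by rewrite ler_pM2l ?ler_expR ?ler_pM2l// ltr_wpDl// mulr_ge0 ?sqr_ge0.
Qed.

(** The normalising constant relating [tilted] to a shifted gaussian kernel. *)
Definition tilted_norm : R := Num.sqrt (2 * pi * w) * expR (l ^+ 2 * w / 2).

Let peak_neq0 : Num.sqrt (2 * pi * w) != 0.
Proof. by rewrite gt_eqF// sqrtr_gt0 !mulr_gt0// pi_gt0. Qed.

Lemma tilted_kernel x : tilted_norm * gauss_kernel w (x - l * w) = tilted x.
Proof.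
rewrite /tilted_norm /gauss_kernel /tilted mulrACA divff// mul1r /gauss -!expRD.
by congr expR; field; rewrite gt_eqF.
Qed.

End tilted_gaussian.

Section laplace_identity.
Context (R : realType).
Local Notation mu := (@lebesgue_measure R).
Variable phi : {measure set (measurableTypeR R) -> \bar R}.
Hypothesis sf : sigma_finite setT phi.
Hypothesis iw : phi.-integrable (@neg R) (EFin \o @levy_weight R).
Variables s q : R.
Hypothesis s0 : 0 < s.
Hypothesis ires : mu.-integrable setT (EFin \o (fun k => (s - psi_re phi k)^-1)).
Local Notation u := (resolvent_density phi s).

Let mn : measurable (@neg R : set (measurableTypeR R)).
Proof. exact: measurable_neg. Qed.

Let cu : continuous u. Proof. exact: continuous_resolvent_density. Qed.

Let mu_u : measurable_fun setT u. Proof. exact: continuous_measurable_fun cu. Qed.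

Lemma integrable_exp_abs (r : R) : 0 < r ->
  mu.-integrable setT (EFin \o (fun x => expR (- (r * `|x|)))).
Proof.
move=> r0; have me : measurable_fun setT (fun x : R => expR (- (r * `|x|))) by meas.
apply/integrableP; split; first exact/measurable_EFinP.
under eq_integral => x _ do rewrite /= ger0_norm ?expR_ge0//.
rewrite ge0_symfun_integralT.
- rewrite (_ : [set x | _] = `[0, +oo[%classic); last first.
    by apply/seteqP; split => x /=; rewrite in_itv/= andbT.
  rewrite -integral_itv_obnd_cbnd; last by apply/measurable_EFinP; exact: measurable_funTS.
  have -> : (\int[mu]_(x in `]0%R, +oo[) (expR (- (r * `|x|)))%:E =
    \int[mu]_(x in `]0%R, +oo[) (expR (- (r * x)))%:E)%E.
    by apply: eq_integral => x; rewrite inE /= in_itv/= andbT => x0; rewrite gtr0_norm.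
  rewrite (EFin_Rintegral _ (integrable_exp_half_line r0))//.
  by rewrite -EFinM ltry.
- by move=> x; exact: expR_ge0.
- move=> x; apply: continuous_comp; last exact: continuous_expR.
  by apply: cvgN; apply: cvgMr; exact: norm_continuous.
- by move=> x /=; rewrite normrN.
Qed.

Section smoothed_derivative.
Variables (w a : R).
Hypothesis w0 : 0 < w.

(** The derivative of the smoothed density falls on the gaussian kernel. *)
Lemma dsmooth_resolventE : dsmooth_resolvent phi s w a =
  \int[mu]_x (u x * ((x - a) / w * gauss_kernel w (x - a))).
Proof.
have [M HM] := resolvent_density_bounded iw s0 ires.
have M0 : 0 <= M by apply: le_trans (HM 0).
have wV0 : 0 < w^-1 by rewrite invr_gt0.
pose P := (Num.sqrt (2 * pi * w))^-1.
have P0 : 0 <= P by rewrite invr_ge0 sqrtr_ge0.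
have mg := measurable_gauss_kernel w.
pose G (x : R) := (M * (2 / w) * P * expR (w^-1 / 2)) * ((1 + (x - a) ^+ 2) * gauss (w^-1 / 2) (x - a)).
have Gi : mu.-integrable setT (EFin \o G).
  apply: RintegrableZl => //; apply: (@integrable_gauss_moment _ _ _ _ 1).
  - by rewrite divr_gt0.
  - by meas.
  - by move=> x; rewrite mul1r ger0_norm// addr_ge0 ?sqr_ge0.
have d1 : is_derive a 1 (fun b => \int[mu]_x (u x * gauss_kernel w (x - b)))
   (\int[mu]_x (u x * ((x - a) / w * gauss_kernel w (x - a)))).
  apply: (@is_derive_Rintegral _ _ _ mu setT
    (fun b x => u x * gauss_kernel w (x - b))
    (fun b x => u x * ((x - b) / w * gauss_kernel w (x - b))) G a 1) => //.
  - move=> b _; apply: (@integrable_bounded_mul _ _ _ mu _ u _ M) => //.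
    exact: integrable_gauss_kernel.
  - move=> b x _ _; rewrite /gauss_kernel /gauss; deriv.
    by rewrite !gt_eqF// sqrtr_gt0 !mulr_gt0// pi_gt0.
  - move=> b x ba _.
    have ba1 : (b - a) ^+ 2 <= 1 by rewrite -real_normK ?num_real// expr_le1// ltW.
    have gb : gauss_kernel w (x - b) <= P * (expR (w^-1 / 2) * gauss (w^-1 / 2) (x - a)).
      rewrite /gauss_kernel -/P ler_wpM2l// /gauss -expRD ler_expR.
      rewrite -subr_ge0 (_ : _ - _ = (w^-1 / 4) * (2 + 2 * (x - b) ^+ 2 - (x - a) ^+ 2)); last by field; rewrite gt_eqF.
      apply: mulr_ge0; first by rewrite divr_ge0// ltW.
      have : 0 <= (x - b - (b - a)) ^+ 2 by exact: sqr_ge0.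
      rewrite (_ : x - a = (x - b) + (b - a)); last by ring.
      move: ba1; move: (x - b) (b - a) => y z; nra.
    have xb : `|x - b| <= 2 * (1 + (x - a) ^+ 2).
      have : `|x - b| <= `|x - a| + 1.
        rewrite (_ : x - b = (x - a) - (b - a)); last by ring.
        by rewrite (le_trans (ler_normB _ _))// lerD2l ltW.
      rewrite -(real_normK (num_real (x - a))); have := normr_ge0 (x - a).
      by move: `|x - a| `|x - b| => y z; nra.
    rewrite (normrM (u x)) (normrM ((x - b) / w)) (normrM (x - b)) (ger0_norm (gauss_kernel_ge0 _ _)) (gtr0_norm wV0).
    have -> : G x = M * (2 * (1 + (x - a) ^+ 2) / w *
       (P * (expR (w^-1 / 2) * gauss (w^-1 / 2) (x - a)))).
      by rewrite /G; field; rewrite gt_eqF.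
    have x2 : `|x - b| / w <= 2 * (1 + (x - a) ^+ 2) / w.
      by rewrite ler_wpM2r// ltW.
    apply: ler_pM => //; first by rewrite mulr_ge0 ?gauss_kernel_ge0// mulr_ge0// ltW.
    apply: ler_pM => //; first by rewrite mulr_ge0// ltW.
    exact: gauss_kernel_ge0.
have := is_derive_smooth_resolvent iw s0 w0 a.
rewrite (_ : smooth_resolvent phi s w = (fun b => \int[mu]_x (u x * gauss_kernel w (x - b)))).
  by move=> d2; have [_ <-] := d2; have [_ ->] := d1.
by apply/funext => b; rewrite (smooth_resolventE iw s0 ires w0).
Qed.

End smoothed_derivative.

Variable C : R.
Hypothesis uC : forall x, 0 < x -> u x = C * expR (- (q * x)).

Section fixed_tilt.
Variable l : R.
Hypotheses (l0 : 0 < l) (lq : l < q).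

Let dom_u : exists2 K, 0 <= K & forall x, `|u x| * expR (l * x) <=
  K * expR (- (Num.min l (q - l) * `|x|)).
Proof.
have [M HM] := resolvent_density_bounded iw s0 ires.
have M0 : 0 <= M by apply: le_trans (HM 0).
exists (M + `|C|); first by rewrite addr_ge0.
move=> x; have [x0|x0] := ltP 0 x.
  rewrite (uC x0) normrM (ger0_norm (expR_ge0 _)) -mulrA -expRD.
  apply: ler_pM => //; first by rewrite lerDr.
  rewrite ler_expR (gtr0_norm x0) -subr_ge0.
  rewrite (_ : _ - _ = (q - l - Num.min l (q - l)) * x); last by ring.
  by rewrite mulr_ge0 ?(ltW x0)// subr_ge0 ge_min lexx orbT.
apply: ler_pM => //; first by rewrite (le_trans (HM x))// lerDl.
rewrite ler_expR (ler0_norm x0) mulrN opprK -subr_ge0 -mulrBl.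
by rewrite mulr_le0// subr_le0 ge_min lexx.
Qed.

Lemma integrable_tilted_density :
  mu.-integrable setT (EFin \o (fun x => `|u x| * expR (l * x))).
Proof.
have [K K0 HK] := dom_u.
have r0 : 0 < Num.min l (q - l) by rewrite lt_min l0 subr_gt0.
apply: (@dominated_integrable _ _ _ mu _ _
  (fun x => K * expR (- (Num.min l (q - l) * `|x|)))) => //.
- by meas.
- by apply: RintegrableZl => //; exact: integrable_exp_abs.
- by move=> x _; rewrite ger0_norm// mulr_ge0// expR_ge0.
Qed.

(** The bilateral Laplace transform of the resolvent density at [- l]. *)
Definition tilted_mass : R := \int[mu]_x (u x * expR (l * x)).

Let K : R := 2 * (l + 1) + (2 * l ^+ 2 + 5).

Let I w := \int[mu]_x (u x * tilted l w x).
Let J w y := \int[mu]_x (u x * (tilted l w (x + y) - tilted l w x - y * dtilted l w x)).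

Let measurable_tilted w : measurable_fun setT (tilted l w).
Proof. by have := @measurable_gauss R w^-1 => ?; rewrite /tilted; meas. Qed.

Let measurable_dtilted w : measurable_fun setT (dtilted l w).
Proof. by have := @measurable_tilted w => ?; rewrite /dtilted; meas. Qed.

Let integrable_I w : 1 <= w -> mu.-integrable setT (EFin \o (fun x => u x * tilted l w x)).
Proof.
move=> w1; have w0 : 0 < w by exact: lt_le_trans w1.
have mt := @measurable_tilted w.
apply: (@dominated_integrable _ _ _ mu _ _ (fun x => `|u x| * expR (l * x))) => //.
- by meas.
- exact: integrable_tilted_density.
- move=> x _; rewrite normrM ler_wpM2l// (ger0_norm (tilted_ge0 _ _ _)).
  exact: tilted_le.
Qed.

Let integrable_dI w : 1 <= w -> mu.-integrable setT (EFin \o (fun x => u x * dtilted l w x)).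
Proof.
move=> w1; have w0 : 0 < w by exact: lt_le_trans w1.
have mt := @measurable_dtilted w.
apply: (@dominated_integrable _ _ _ mu _ _ (fun x => (l + 1) * (`|u x| * expR (l * x)))) => //.
- by meas.
- by apply: RintegrableZl => //; exact: integrable_tilted_density.
- move=> x _; rewrite normrM mulrCA ler_wpM2l//; exact: dtilted_le.
Qed.

Let integrable_shift w y : 1 <= w -> y < 0 ->
  mu.-integrable setT (EFin \o (fun x => u x * tilted l w (x + y))).
Proof.
move=> w1 y0; have w0 : 0 < w by exact: lt_le_trans w1.
have mt := @measurable_tilted w.
apply: (@dominated_integrable _ _ _ mu _ _ (fun x => `|u x| * expR (l * x))) => //.
- by meas.
- exact: integrable_tilted_density.
- move=> x _; rewrite normrM ler_wpM2l// (ger0_norm (tilted_ge0 _ _ _)).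
  apply: (le_trans (tilted_le l w1 (x + y))).
  by rewrite ler_expR ler_pM2l// gerDl ltW.
Qed.

Let tilted_smooth w (a := l * w) (k := tilted_norm l w) : 1 <= w ->
  I w = k * smooth_resolvent phi s w a /\
  (forall y, y < 0 -> J w y = k * (smooth_resolvent phi s w (a - y) -
    smooth_resolvent phi s w a + y * dsmooth_resolvent phi s w a)).
Proof.
move=> w1; have w0 : 0 < w by exact: lt_le_trans w1.
have UE b : k * smooth_resolvent phi s w b = \int[mu]_x (u x * (k * gauss_kernel w (x - b))).
  rewrite (smooth_resolventE iw s0 ires w0) -RintegralZl//.
    by apply: eq_Rintegral => x _; ring.
  have [M HM] := resolvent_density_bounded iw s0 ires.
  apply: (@integrable_bounded_mul _ _ _ mu _ u _ M) => //.
  exact: integrable_gauss_kernel.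
have U0 : k * smooth_resolvent phi s w a = I w.
  by rewrite UE; apply: eq_Rintegral => x _; rewrite tilted_kernel.
have Uy y : k * smooth_resolvent phi s w (a - y) = \int[mu]_x (u x * tilted l w (x + y)).
  rewrite UE; apply: eq_Rintegral => x _; congr (_ * _).
  by rewrite -tilted_kernel//; congr (_ * gauss_kernel _ _); rewrite /a; ring.
have dU : k * dsmooth_resolvent phi s w a = - \int[mu]_x (u x * dtilted l w x).
  have E x : u x * dtilted l w x = - (k * (u x * ((x - a) / w * gauss_kernel w (x - a)))).
    by rewrite /dtilted -tilted_kernel// /a -/k; field; rewrite gt_eqF.
  have k0 : k != 0.
    by rewrite mulf_neq0// gt_eqF ?expR_gt0// sqrtr_gt0 !mulr_gt0// pi_gt0.
  have iG : mu.-integrable setT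
      (EFin \o (fun x => u x * ((x - a) / w * gauss_kernel w (x - a)))).
    have := RintegrableZl (- k^-1) measurableT (integrable_dI w1).
    congr (mu.-integrable _ (EFin \o _)); apply/funext => x.
    by rewrite E mulrN mulNr opprK mulKf.
  rewrite dsmooth_resolventE// -(RintegralZl k measurableT iG).
  rewrite -[RHS]mulN1r -(RintegralZl (- 1) measurableT (integrable_dI w1)).
  by apply: eq_Rintegral => x _; rewrite E mulN1r opprK.
split=> [|y y0]; first by rewrite U0.
rewrite /J.
rewrite (_ : k * _ = k * smooth_resolvent phi s w (a - y) -
  k * smooth_resolvent phi s w a + y * (k * dsmooth_resolvent phi s w a)); last by ring.
have i1 := integrable_shift w1 y0; have i2 := integrable_I w1.
have i3 := RintegrableZl y measurableT (integrable_dI w1).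
have i12 := RintegrableB measurableT i1 i2.
rewrite Uy U0 dU mulrN -(RintegralZl y measurableT (integrable_dI w1)).
rewrite -(RintegralB measurableT i1 i2) -(RintegralB measurableT i12 i3).
by apply: eq_Rintegral => x _; ring.
Qed.

Let measurable_J w : 1 <= w -> measurable_fun (@neg R) (J w).
Proof.
move=> w1; have w0 : 0 < w by exact: lt_le_trans w1.
have [_ JE] := tilted_smooth w1.
have iU := integrable_smooth_increment iw s0 w0 (l * w).
apply: (measurable_integrable (m := phi)).
have := RintegrableZl (tilted_norm l w) mn iU; apply: eq_integrable => // y.
by rewrite inE /neg /= in_itv/= => y0; rewrite JE.
Qed.

(** The equation of the smoothed density, read at the center of the tilted
    gaussian. *)
Let tilted_equation w : 1 <= w -> s * I w - \int[phi]_(y in @neg R) J w y = 1.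
Proof.
move=> w1; have w0 : 0 < w by exact: lt_le_trans w1.
have [U0 JE] := tilted_smooth w1.
pose a := l * w; pose k := tilted_norm l w.
have iU := integrable_smooth_increment iw s0 w0 a.
have -> : \int[phi]_(y in @neg R) J w y =
    k * \int[phi]_(y in @neg R) (smooth_resolvent phi s w (a - y) -
    smooth_resolvent phi s w a + y * dsmooth_resolvent phi s w a).
  rewrite -(RintegralZl k mn iU); apply: eq_Rintegral => y.
  by rewrite inE /neg /= in_itv/= => y0; exact: JE.
rewrite U0 -/a -/k mulrCA -mulrBr (smooth_resolvent_equation sf iw s0 w0).
have -> : gauss_kernel w a = gauss_kernel w (0 - a).
  by rewrite /gauss_kernel /gauss sub0r sqrrN.
by rewrite /k /a tilted_kernel// tilted0.
Qed.

Let wn (n : nat) : R := n.+1%:R.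

Let wn1 n : 1 <= wn n. Proof. by rewrite /wn ler1n. Qed.

Let cvg_wnV (x : R) : x / wn n @[n --> \oo] --> (0 : R).
Proof.
by rewrite -[X in _ --> X](mulr0 x); apply: cvgMr; exact: cvg_harmonic.
Qed.

Let cvg_tilted x : tilted l (wn n) x @[n --> \oo] --> expR (l * x).
Proof.
rewrite -[X in _ --> X]mulr1; apply: cvgMr; exact: cvg_gauss_wn.
Qed.

Let cvg_dtilted x : dtilted l (wn n) x @[n --> \oo] --> l * expR (l * x).
Proof.
apply: cvgM; last exact: cvg_tilted.
rewrite -[X in _ --> X]subr0; apply: cvgB; first exact: cvg_cst.
exact: cvg_wnV.
Qed.

Let cvg_I : I (wn n) @[n --> \oo] --> tilted_mass.
Proof.
apply: (@Rintegral_dominated_cvg _ _ _ mu setT (fun n x => u x * tilted l (wn n) x) _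
  (fun x => `|u x| * expR (l * x))) => //.
- by move=> n; have := @measurable_tilted (wn n) => ?; meas.
- by move=> x _; apply: cvgMr; exact: cvg_tilted.
- exact: integrable_tilted_density.
- move=> n x _; rewrite normrM ler_wpM2l// (ger0_norm (tilted_ge0 _ _ _)).
  exact: tilted_le.
Qed.

Let J_dom w x y : 1 <= w -> y < 0 ->
  `|u x * (tilted l w (x + y) - tilted l w x - y * dtilted l w x)| <=
  K * levy_weight y * (`|u x| * expR (l * x)).
Proof.
move=> w1 y0; rewrite (normrM (u x)) [leRHS]mulrCA ler_wpM2l//; exact: tilted_increment_le.
Qed.

Let cvg_J y : y < 0 ->
  J (wn n) y @[n --> \oo] --> tilted_mass * (expR (l * y) - 1 - l * y).
Proof.
move=> y0.
rewrite /tilted_mass -RintegralZr//; last first.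
  apply: (@dominated_integrable _ _ _ mu _ _ (fun x => `|u x| * expR (l * x))) => //.
  - by meas.
  - exact: integrable_tilted_density.
  - by move=> x _; rewrite normrM (ger0_norm (expR_ge0 _)).
apply: (@Rintegral_dominated_cvg _ _ _ mu setT
  (fun n x => u x * (tilted l (wn n) (x + y) - tilted l (wn n) x - y * dtilted l (wn n) x)) _
  (fun x => K * levy_weight y * (`|u x| * expR (l * x)))) => //.
- move=> n; have := @measurable_tilted (wn n); have := @measurable_dtilted (wn n) => ? ?; meas.
- move=> x _.
  rewrite (_ : u x * _ * _ = u x * (expR (l * (x + y)) - expR (l * x) - y * (l * expR (l * x)))).
    apply: cvgMr; apply: cvgB; last by apply: cvgMr; exact: cvg_dtilted.
    by apply: cvgB; exact: cvg_tilted.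
  by rewrite (mulrDr l x y) expRD; ring.
- by apply: RintegrableZl => //; exact: integrable_tilted_density.
- by move=> n x _; exact: J_dom.
Qed.

Let cvg_intJ : (\int[phi]_(y in @neg R) J (wn n) y) @[n --> \oo] -->
  tilted_mass * Psi phi l.
Proof.
rewrite /Psi -RintegralZl//; last exact/integrable_expR_compensated/ltW.
pose E := \int[mu]_x (`|u x| * expR (l * x)).
apply: (@Rintegral_dominated_cvg _ _ _ phi (@neg R) (fun n => J (wn n)) _
  (fun y => K * E * levy_weight y)) => //.
- by move=> n; exact: measurable_J.
- exact: RintegrableZl.
- move=> n y; rewrite /neg /= in_itv/= => y0.
  have iJ : mu.-integrable setT (EFin \o (fun x => u x * (tilted l (wn n) (x + y) - tilted l (wn n) x - y * dtilted l (wn n) x))).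
    apply: (@dominated_integrable _ _ _ mu _ _ (fun x => K * levy_weight y * (`|u x| * expR (l * x)))) => //.
    + have := @measurable_tilted (wn n); have := @measurable_dtilted (wn n) => ? ?; meas.
    + by apply: RintegrableZl => //; exact: integrable_tilted_density.
    + by move=> x _; exact: J_dom.
  apply: (le_trans (le_normr_Rintegral _ iJ)) => //.
  rewrite mulrAC /E -RintegralZl//; last exact: integrable_tilted_density.
  apply: le_Rintegral => //.
  + exact: integrable_norm iJ.
  + by apply: RintegrableZl => //; exact: integrable_tilted_density.
  + by move=> x _; exact: J_dom.
Qed.

(** Formally, [s - psi] at [k = - i l] times the transform of the resolvent
    density is [1]. For the exponential itself the pairing with the equation has
    no direct meaning, and [tilted_equation] is passed to the limit [w] to
    infinity instead. *)
Lemma tilted_massE : (s - Psi phi l) * tilted_mass = 1.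
Proof.
have c1 : s * I (wn n) - \int[phi]_(y in @neg R) J (wn n) y @[n --> \oo] -->
    s * tilted_mass - tilted_mass * Psi phi l.
  by apply: cvgB; [apply: cvgMr; exact: cvg_I|exact: cvg_intJ].
have c2 : s * I (wn n) - \int[phi]_(y in @neg R) J (wn n) y @[n --> \oo] --> (1 : R).
  rewrite (_ : (fun n => _) = cst 1); first exact: cvg_cst.
  by apply/funext => n; rewrite tilted_equation.
have := cvg_unique _ c1 c2 => <- //.
by rewrite mulrBl (mulrC tilted_mass).
Qed.

End fixed_tilt.
End laplace_identity.

(** * The exponential constant and the theorem *)

Section exponential_constant.
Context (R : realType).
Local Notation mu := (@lebesgue_measure R).
Variable phi : {measure set (measurableTypeR R) -> \bar R}.
Hypothesis sf : sigma_finite setT phi.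
Hypothesis iw : phi.-integrable (@neg R) (EFin \o @levy_weight R).
Variables s q : R.
Hypotheses (s0 : 0 < s) (q0 : 0 < q) (Pq : Psi phi q = s).
Hypothesis ires : mu.-integrable setT (EFin \o (fun k => (s - psi_re phi k)^-1)).
Variable C : R.
Local Notation u := (resolvent_density phi s).
Hypothesis uC : forall x, 0 < x -> u x = C * expR (- (q * x)).

(** As [l] increases to [q], the Laplace transform of the resolvent density
    has the pole [C / (q - l)], up to a bounded remainder coming from the
    negative half-line. *)
Lemma tilted_mass_pole : exists N : R, forall l : R, q / 2 <= l -> l < q ->
  `|tilted_mass phi s l - C / (q - l)| <= N.
Proof.
have [M HM] := resolvent_density_bounded iw s0 ires.
have M0 : 0 <= M by apply: le_trans (HM 0).
have q2 : 0 < q / 2 by rewrite divr_gt0.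
pose D : set (measurableTypeR R) := `]-oo, 0]%classic.
have mD : measurable D by exact: measurable_itv.
have mP : measurable (`]0%R, +oo[%classic : set (measurableTypeR R)) by exact: measurable_itv.
have iB : mu.-integrable D (EFin \o (fun x => M * expR (- (q / 2 * `|x|)))).
  apply: RintegrableZl => //; apply: (@integrableS _ _ _ mu setT) => //.
  exact: integrable_exp_abs.
exists (\int[mu]_(x in D) (M * expR (- (q / 2 * `|x|)))) => l ql lq.
have l0 : 0 < l by exact: lt_le_trans ql.
have cu : continuous u by exact: continuous_resolvent_density.
have mu_u : measurable_fun setT u by exact: continuous_measurable_fun.
have iE : mu.-integrable setT (EFin \o (fun x => u x * expR (l * x))).
  apply: (@dominated_integrable _ _ _ mu _ _ (fun x => `|u x| * expR (l * x))) => //.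
  - by meas.
  - exact: (integrable_tilted_density iw s0 ires uC).
  - by move=> x _; rewrite normrM (ger0_norm (expR_ge0 _)).
have TE : setT = D `|` `]0%R, +oo[%classic.
  apply/esym/seteqP; split=> // x _; rewrite /D /= !in_itv/= andbT.
  by have [|] := leP (x : R) 0; [left|right].
have iED : mu.-integrable D (EFin \o (fun x => u x * expR (l * x))).
  exact: (integrableS measurableT).
have -> : tilted_mass phi s l = \int[mu]_(x in D) (u x * expR (l * x)) +
    \int[mu]_(x in `]0%R, +oo[) (u x * expR (l * x)).
  rewrite /tilted_mass TE Rintegral_setU//; first by rewrite -TE.
  apply/disj_setPS => x [] /=; rewrite /D /= !in_itv/= andbT => x0.
  by rewrite ltNge x0.
have -> : \int[mu]_(x in `]0%R, +oo[) (u x * expR (l * x)) = C / (q - l).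
  have d0 : 0 < q - l by rewrite subr_gt0.
  rewrite -(Rintegral_exp_half_line d0) -RintegralZl//; last exact: integrable_exp_half_line.
  apply: eq_Rintegral => x; rewrite inE /= in_itv/= andbT => x0.
  by rewrite uC// -mulrA -expRD; congr (_ * expR _); ring.
rewrite addrK; apply: (le_trans (le_normr_Rintegral mD iED)).
apply: le_Rintegral => //; first exact: integrable_norm iED.
move=> x; rewrite /D /= in_itv/= => x0.
rewrite (normrM (u x)) (ger0_norm (expR_ge0 _)).
apply: ler_pM; [exact: normr_ge0|exact: expR_ge0|exact: HM|].
by rewrite ler_expR (ler0_norm x0) mulrN opprK ler_wnM2r.
Qed.

(** Multiplying [tilted_mass_pole] by [s - Psi l], which tends to [0] at the rate
    [dPsi q * (q - l)], and using [tilted_massE], identifies the residue. *)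
Lemma exponential_constantE : C * dPsi phi q = 1.
Proof.
have [N HN] := tilted_mass_pole.
(* [q + h n] increases to [q] and stays in the range of [tilted_mass_pole]. *)
pose h (n : nat) : R := - (q / 2) * n.+1%:R^-1.
have q2 : 0 < q / 2 by rewrite divr_gt0.
have nV0 (n : nat) : 0 < n.+1%:R^-1 :> R by rewrite invr_gt0.
have nV1 (n : nat) : n.+1%:R^-1 <= 1 :> R by rewrite invf_le1 ?ler1n.
have h0 n : h n < 0 by rewrite /h mulNr oppr_lt0 mulr_gt0.
have hq n : q / 2 <= q + h n.
  have : q / 2 * n.+1%:R^-1 <= q / 2 by rewrite ler_piMr// ltW.
  rewrite /h mulNr; move: (q / 2 * _) => z hz.
  by rewrite lerBrDr [leRHS](splitr q) lerD2l.
have ch : h n @[n --> \oo] --> (0 : R).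
  by rewrite -[X in _ --> X](mulr0 (- (q / 2))); apply: cvgMr; exact: cvg_harmonic.
pose Dq n := (h n)^-1 * (Psi phi (h n + q) - Psi phi q).
have cD : Dq n @[n --> \oo] --> dPsi phi q.
  have [d e] := is_derive_Psi iw q0.
  have cd : t^-1 * (Psi phi (t + q) - Psi phi q) @[t --> 0^'] --> dPsi phi q.
    rewrite -e; suff -> : (fun t : R => t^-1 * (Psi phi (t + q) - Psi phi q)) =
        (fun t : R => t^-1 *: ((Psi phi \o shift q) (t *: 1) - Psi phi q)) by exact: d.
    by apply/funext => t /=; rewrite /GRing.scale/= mulr1.
  apply: ((cvgr_dnbhsP _ _ _).1 cd h); split=> // n.
  by rewrite lt_eqF.
have E n : C * Dq n - 1 = h n * Dq n * (tilted_mass phi s (q + h n) - C / (q - (q + h n))).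
  have l0 : 0 < q + h n by exact: lt_le_trans q2 (hq n).
  have lq : q + h n < q by rewrite gtrDl.
  have := tilted_massE sf iw s0 ires uC l0 lq.
  have hn : h n != 0 by rewrite lt_eqF.
  have -> : q - (q + h n) = - h n by rewrite opprD addrA subrr add0r.
  move=> tE.
  have DE : s - Psi phi (q + h n) = - (h n * Dq n).
    by rewrite /Dq mulVKf// Pq opprB (addrC q).
  rewrite DE in tE.
  have -> : h n * Dq n * (tilted_mass phi s (q + h n) - C / - h n) =
    - (- (h n * Dq n) * tilted_mass phi s (q + h n)) + Dq n * C * (h n / h n).
    by rewrite invrN; ring.
  by rewrite tE divff//; ring.
have c0 : C * Dq n - 1 @[n --> \oo] --> (0 : R).
  have cb : `|h n| * `|Dq n| * N @[n --> \oo] --> (0 : R).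
    have z : `|0 : R| * `|dPsi phi q| * N = 0 by rewrite normr0 !mul0r.
    rewrite -[X in _ --> X]z.
    apply: (@cvgMl _ _ _ _ (fun n => `|h n| * `|Dq n|)).
    exact: cvgM (cvg_norm ch) (cvg_norm cD).
  apply: norm_cvg0; apply: (squeeze_cvgr _ (cvg_cst 0) cb).
  apply: nearW => n; rewrite normr_ge0/= E normrM (normrM (h n)).
  by rewrite ler_wpM2l ?mulr_ge0// HN// gtrDl.
have c1 : C * Dq n - 1 @[n --> \oo] --> C * dPsi phi q - 1.
  by apply: cvgB; [apply: cvgMr; exact: cD|exact: cvg_cst].
by apply/eqP; rewrite -subr_eq0; apply/eqP; exact: (cvg_unique _ c1 c0).
Qed.

End exponential_constant.

Lemma laplace_time_exponential (R : realType) (alpha c : R) (theta : R -> R)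
    (phi : {measure set (measurableTypeR R) -> \bar R}) (p : R -> R -> R) :
  1 < alpha < 2 -> 1 < c -> admissible c alpha theta ->
  semistable_levy_measure alpha theta phi -> semistable_densities phi p ->
  forall x s, 0 < x -> 0 < s ->
  laplace_time p x s =
    (expR (- (Phi phi s * x)) / dPsi phi (Phi phi s))%:E.
Proof.
move=> alpha12 c1 adm semi dens x s x0 s0.
have iw := integrable_levy_weight alpha12 c1 adm semi.
have sf := semistable_sigma_finite semi.
have ires t (t0 : 0 < t) := integrable_psi_resolvent alpha12 c1 adm semi t0.
have q0 := Phi_gt0 alpha12 c1 adm semi s0.
have Pq := PhiK alpha12 c1 adm semi s0.
rewrite (laplace_time_resolvent iw ires dens x s0); congr (_%:E).
have [C uC] := resolvent_density_exponential sf iw s0 q0 Pq (ires s s0).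
have CE := exponential_constantE sf iw s0 q0 Pq (ires s s0) uC.
have d0 : dPsi phi (Phi phi s) != 0.
  by apply/eqP => d0; move: CE; rewrite d0 mulr0 => /esym/eqP; rewrite oner_eq0.
by rewrite uC// -[C](mulfK d0) CE mul1r mulrC.
Qed.

Theorem theorem3p1 (R : realType) (alpha c : R) (theta : R -> R)
  (halpha : 1 < alpha < 2) (hc : 1 < c)
  (hadm : admissible c alpha theta) (hsmooth : smooth theta) :
  exists g f : R -> R,
    [/\ continuously_differentiable g,
        periodic g (ln c),
        forall s : R, 0 < s -> 0 < s + f s &
        forall (phi : {measure set (measurableTypeR R) -> \bar R}) (p : R -> R -> R),
          semistable_levy_measure alpha theta phi ->
          semistable_densities phi p ->
          forall x s : R, 0 < x -> 0 < s ->
            laplace_time p x s =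
              (alpha^-1 *
                (s `^ alpha^-1 * g (ln s) *
                   expR (- (x * s `^ alpha^-1 * g (ln s))) / (s + f s)))%:E].
Proof.
have a0 : 0 < alpha by case/andP: halpha => a1 _; exact: lt_trans a1.
have [[phi0 semi0]|nophi] := pselect (exists phi : {measure set (measurableTypeR R) -> \bar R},
    semistable_levy_measure alpha theta phi); last first.
  (* without a Levy measure the formula has nothing to say *)
  exists (cst 0), (cst 0); split=> //.
  - split=> [x|]; first exact: derivable_cst.
    rewrite (_ : derive1 _ = cst 0); first exact: cst_continuous.
    by apply/funext => x; rewrite derive1_cst.
  - by move=> s s0; rewrite addr0.
  - by move=> phi p semi; case: nophi; exists phi.
have iw0 := integrable_levy_weight halpha hc hadm semi0.
have r0 := semistable_ray1_gt0 hadm semi0.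
have roo := semistable_ray1_lty semi0.
(* [f] is defined by [s + f s = Phi s * dPsi (Phi s) / alpha] *)
exists (periodic_factor alpha phi0),
  (fun s => Phi phi0 s * dPsi phi0 (Phi phi0 s) / alpha - s); split.
- exact: (continuously_differentiable_periodic_factor halpha hc hadm semi0).
- exact: (periodic_factor_periodic halpha hc hadm semi0).
- move=> s s0; have q0 := Phi_gt0 halpha hc hadm semi0 s0.
  by rewrite addrC subrK divr_gt0// mulr_gt0// dPsi_gt0.
- move=> phi p semi dens x s x0 s0.
  have PsiE : Psi phi = Psi phi0.
    by apply/funext => l; exact: semistable_measure_unique semi semi0.
  have dPsiE : dPsi phi = dPsi phi0.
    by apply/funext => l; exact: semistable_measure_unique semi semi0.
  have PhiE : Phi phi s = Phi phi0 s by rewrite /Phi PsiE.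
  rewrite (laplace_time_exponential halpha hc hadm semi dens x0 s0) dPsiE PhiE.
  rewrite -(mulrA x) (Phi_periodic_factor alpha phi0 s0) (addrC s) subrK; congr (_%:E).
  have q0 := Phi_gt0 halpha hc hadm semi0 s0.
  have d0 := dPsi_gt0 iw0 r0 roo q0.
  by rewrite (mulrC x); field; rewrite !gt_eqF.
Qed.
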